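(* Let $p=k/l>1$, where $k,l$ are integers such that $1\le l<k$, and let $r\in\mathbb{R}$. Then $V_{p,r}$ exists and can be expressed as \[ V_{p,r}(x)=\frac{p^{r+1/2}\sqrt{l}}{x(p-1)^{r+1/2}\sqrt{2\pi}}\; G^{k,0}_{k,k}\!\left(\left.\begin{array}{ccc}\alpha_1,&\ldots,&\alpha_k\\ \beta_1,&\ldots,&\beta_k\end{array}\right|\frac{x^{l}}{c(p)^l}\right),\qquad x\in(0,c(p)), \] where $c(p)=p^p(p-1)^{1-p}$ and \[ \alpha_j=\begin{cases}\dfrac{j}{l}&\text{if }1\le j\le l,\\[2mm]\dfrac{r+j-l}{k-l}&\text{if }l+1\le j\le k,\end{cases}\qquad \beta_j=\frac{r+j}{k}\quad(1\le j\le k). \] Moreover, $\psi_{p,r}$ is the Mellin transform of $V_{p,r}$, i.e. \[ \psi_{p,r}(\sigma)=\int_0^{c(p)}x^{\sigma-1}V_{p,r}(x)\,dx\qquad\text{for }\Re\sigma>1-\frac{1+r}{p}. \]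
   Context: For $p>1$ and $r\in\mathbb{R}$, \[ \psi_{p,r}(\sigma)=\frac{\Gamma\big((\sigma-1)p+r+1\big)}{\Gamma(\sigma)\,\Gamma\big((\sigma-1)(p-1)+r+1\big)}, \] where $1/\Gamma$ is taken to be $0$ at the poles of $\Gamma$ and at removable singularities the value is the limit. $V_{p,r}$ is the inverse Mellin transform of $\psi_{p,r}$: \[ V_{p,r}(x)=\frac{1}{2\pi\mathrm{i}}\int_{d-\mathrm{i}\infty}^{d+\mathrm{i}\infty}x^{-\sigma}\psi_{p,r}(\sigma)\,d\sigma \] whenever it exists; here $d$ is any real number with $d>1-\frac{1+r}{p}$, and the integral is understood as $\lim_{T\to\infty}\int_{d-\mathrm{i}T}^{d+\mathrm{i}T}$. The Meijer function of type $G^{k,0}_{k,k}$ is, for $0<z<1$, \[ G^{k,0}_{k,k}\!\left(\left.\begin{array}{c}a_1,\ldots,a_k\\ b_1,\ldots,b_k\end{array}\right|z\right)=\frac{1}{2\pi\mathrm{i}}\int_{\mathcal L}\frac{\prod_{j=1}^k\Gamma(b_j+u)}{\prod_{j=1}^k\Gamma(a_j+u)}\,z^{-u}\,du, \] the contour $\mathcal L$ running upward with all poles of $\prod_j\Gamma(b_j+u)$ on its left. *)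

(* Defs.v *)
From mathcomp Require Import all_boot all_order all_algebra.
From mathcomp Require Import all_classical all_reals all_analysis.
From mathcomp Require Import complex.

Set Implicit Arguments.
Unset Strict Implicit.
Unset Printing Implicit Defensive.

Import Order.TTheory GRing.Theory Num.Theory.
Import numFieldNormedType.Exports.
Local Open Scope classical_set_scope.
Local Open Scope ring_scope.
Local Open Scope complex_scope.

(** The topology of the complex numbers [R[i]] is the one of [R[i]^o], given by
    the complex modulus. *)

(** [x ^ s = exp (s * ln x)] for a real [x > 0]; only used for such [x]. *)
Definition cpow (R : realType) (x : R) (s : R[i]) : R[i] :=
  (x `^ complex.Re s)%:C *
  (cos (complex.Im s * ln x) +i* sin (complex.Im s * ln x)).

(** Euler's limit [n! n^z / (z (z + 1) ... (z + n))]. At a pole the denominator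
    vanishes for all large [n]; as [0^-1 = 0], both [Gamma z] and [(Gamma z)^-1]
    are then [0], the latter being the usual convention for [1 / Gamma]. *)
Definition Gamma (R : realType) (z : R[i]) : R[i] :=
  lim ((fun n : nat =>
          n`!%:R * cpow n%:R z / \prod_(i < n.+1) (z + i%:R) : R[i]^o) @ \oo).

Definition Gamma_pole (R : realType) (z : R[i]) : Prop :=
  exists n : nat, z = - n%:R.

Definition psi_quotient (R : realType) (p r : R) (s : R[i]) : R[i] :=
  Gamma ((s - 1) * p%:C + r%:C + 1) /
  (Gamma s * Gamma ((s - 1) * (p - 1)%:C + r%:C + 1)).

(** The singularities of [psi_quotient] are among the poles of its numerator;
    there the value is the limit (unspecified if the singularity is a pole). *)
Definition psi (R : realType) (p r : R) (s : R[i]) : R[i] :=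
  if `[< Gamma_pole ((s - 1) * p%:C + r%:C + 1) >]
  then lim ((fun w : R[i]^o => psi_quotient p r w : R[i]^o) @ (s : R[i]^o)^')
  else psi_quotient p r s.

Definition cintegrable (R : realType) (D : set R) (f : R -> R[i]) : Prop :=
  (@lebesgue_measure R).-integrable D (fun t => (complex.Re (f t))%:E) /\
  (@lebesgue_measure R).-integrable D (fun t => (complex.Im (f t))%:E).

Definition cintegral (R : realType) (D : set R) (f : R -> R[i]) : R[i] :=
  Rintegral (@lebesgue_measure R) D (fun t => complex.Re (f t)) +i*
  Rintegral (@lebesgue_measure R) D (fun t => complex.Im (f t)).

(** The integral of [F] along the segment from [d - iT] to [d + iT],
    parametrized by [t |-> d + it]. *)
Definition segment_integral (R : realType) (F : R[i] -> R[i]) (d T : R) : R[i] :=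
  cintegral `[- T, T] (fun t => F (d +i* t) * 'i%C).

(** [(2 pi i)^-1] times the integral of [F] along the upward line [Re = d],
    the latter understood as a limit of symmetric truncations, is [v]. *)
Definition is_line_integral (R : realType) (F : R[i] -> R[i]) (d : R)
    (v : R[i]) : Prop :=
  (forall T : R, cintegrable `[- T, T] (fun t => F (d +i* t) * 'i%C)) /\
  ((fun T : R => (2 * pi%:C * 'i%C)^-1 * segment_integral F d T : R[i]^o)
     @ +oo --> (v : R[i]^o)).

Definition is_V (R : realType) (p r x : R) (v : R[i]) : Prop :=
  forall d : R, 1 - (1 + r) / p < d ->
    is_line_integral (fun s => cpow x (- s) * psi p r s) d v.

Definition V_exists (R : realType) (p r x : R) : Prop :=
  exists v, is_V p r x v.

Definition V (R : realType) (p r x : R) : R[i] :=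
  xget 0 [set v | is_V p r x v].

(** The poles of the numerator have real parts [- Re (b j) - n], so the upward
    lines [Re = d] that leave all of them on the left are those with
    [- Re (b j) < d] for all [j]. *)
Definition is_MeijerG (R : realType) (k : nat) (a b : 'I_k -> R[i]) (z : R)
    (v : R[i]) : Prop :=
  forall d : R, (forall j, - complex.Re (b j) < d) ->
    is_line_integral
      (fun u => (\prod_(j < k) Gamma (b j + u)) / (\prod_(j < k) Gamma (a j + u))
                * cpow z (- u)) d v.

Definition MeijerG_exists (R : realType) (k : nat) (a b : 'I_k -> R[i])
    (z : R) : Prop :=
  exists v, is_MeijerG a b z v.

Definition MeijerG (R : realType) (k : nat) (a b : 'I_k -> R[i]) (z : R) : R[i] :=
  xget 0 [set v | is_MeijerG a b z v].

Definition c_ (R : realType) (p : R) : R := p `^ p * (p - 1) `^ (1 - p).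

(** The 1-based index of [j : 'I_k] is [j.+1]. *)
Definition alpha (R : realType) (k l : nat) (r : R) (j : 'I_k) : R[i] :=
  (if (j.+1 <= l)%N then j.+1%:R / l%:R
   else (r + j.+1%:R - l%:R) / (k%:R - l%:R))%:C.

Definition beta (R : realType) (k : nat) (r : R) (j : 'I_k) : R[i] :=
  ((r + j.+1%:R) / k%:R)%:C.

(* Main.v *)
(** Put [q = p - 1]. As [x] runs over ]0, pi/p[, the point
    [rho x = sin (p x) ^ p / (sin x * sin (q x) ^ q)] decreases from [c(p)] to [0].
    Let [J(b, r)] be [1/pi] times the integral of [rho ^ b * omega r] over
    ]0, pi/p[. By two exact differentials, [J(b, r)] has the contiguity relations
    of [Gamma(pb+r+1) / (Gamma(b+1) Gamma(qb+r+1))]. As [p = k/l], iterating one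
    of them [lN] times and the other [(k-l)N] times moves [b] to [b + lN] with
    [r] fixed; [rho ^ (lN)] concentrates at [x = 0], so Euler's limit for [Gamma]
    gives [psi(s) = J(s - 1, r)].

    The substitution [y = rho x] makes [psi] the Mellin transform of an explicit
    density, differentiable on ]0, c(p)[. By Fubini, its truncated inverse Mellin
    integrals are integrals against a Dirichlet kernel in [ln y], so they
    converge to the density, which is therefore [V], without estimates on [Gamma].

    By Gauss's multiplication formula, a consequence of Euler's limit, the Meijer
    integrand at [u] is a constant times [x ^ (-lu) psi(lu + 1)], so inversion
    evaluates it. The constant involves the limit in Stirling's
    formula, which is [sqrt (2 pi)] because [Gamma(3/2) ^ 2 = pi/4], the case
    [p = 2], [s = 3/2] of the integral formula for [psi]. *)

Require Import Defs.
From mathcomp Require Import all_boot all_order all_algebra.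
From mathcomp Require Import all_classical all_reals all_analysis.
From mathcomp Require Import complex.
From mathcomp Require Import measurable_realfun ring lra.

Set Implicit Arguments.
Unset Strict Implicit.
Unset Printing Implicit Defensive.

Import Order.TTheory GRing.Theory Num.Theory.
Import numFieldNormedType.Exports.
Import ComplexField.Normc.
Local Open Scope classical_set_scope.
Local Open Scope ring_scope.
Local Open Scope complex_scope.

(** * Integration on open intervals *)

(** [psi p r (b + 1)] is the generalized binomial coefficient of [p b + r] over [b], and the curve
    comes from Cauchy's formula for the coefficient of [w ^ b] in [(1 + w) ^ (p b + r)]. With
    [B = 1 + w] the integrand is [(B ^ p / (B - 1)) ^ b * B ^ r / (B - 1)], and the loop around
    [B = 1] is chosen so that [B ^ p / (B - 1)] is real on it:
    [B = sin (p x) / sin (q x) * exp(i x)], where that quotient equals [rho x]. This is the path of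
    steepest descent from the saddle point [B = p / q], at [x = 0], to [B = 0], at [x = pi / p]. The
    other half of the loop is the complex conjugate, which leaves an imaginary part, namely
    [omega r x]. No contour is deformed below: the identities are checked in real trigonometric
    form, and complex [b] are treated through the recurrences. On vertical lines [psi] decays only
    like [|Im s| ^ (-1/2)], so the inversion integrals do not converge absolutely. This is why
    truncations are kept throughout, and why differentiability of the density, not just its
    integrability, is established. *)

Section open_interval_integration.
Context {R : realType}.
Implicit Types (a b x : R) (f F : R -> R).
Notation mu := (@lebesgue_measure R).

Lemma cont_within f a b : (forall x, a <= x <= b -> {for x, continuous f}) ->
  {within `[a, b], continuous f}.
Proof.
move=> h; apply: continuous_in_subspaceT => x /set_mem/=.
by rewrite in_itv/=; exact: h.
Qed.

Lemma cont_measurable f a b : (forall x, a < x < b -> {for x, continuous f}) ->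
  measurable_fun `]a, b[ f.
Proof.
move=> h; apply: open_continuous_measurable_fun; first exact: interval_open.
by move=> x /set_mem/=; rewrite in_itv/=; exact: h.
Qed.

Lemma cont_integrable f a b : (forall x, a <= x <= b -> {for x, continuous f}) ->
  mu.-integrable `[a, b] (EFin \o f).
Proof.
by move=> h; apply: continuous_compact_integrable; [exact: segment_compact|exact: cont_within].
Qed.

Lemma near_oo a b x : a < x < b -> \forall y \near x, a < y < b.
Proof.
move=> xab; have /near_in_itvoo : x \in `]a, b[ by rewrite in_itv.
by apply: filterS => y; rewrite in_itv/=.
Qed.

Lemma near_right_oo a b : a < b -> \forall x \near a^'+, a < x < b.
Proof.
by move=> ab; near=> x; apply/andP; split; near: x; [exact: nbhs_right_gt|exact: nbhs_right_lt].
Unshelve. all: end_near. Qed.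

Lemma near_left_oo a b : a < b -> \forall x \near b^'-, a < x < b.
Proof.
by move=> ab; near=> x; apply/andP; split; near: x; [exact: nbhs_left_gt|exact: nbhs_left_lt].
Unshelve. all: end_near. Qed.

Lemma integrable_addr (D : set R) f F : measurable D ->
  mu.-integrable D (EFin \o f) -> mu.-integrable D (EFin \o F) ->
  mu.-integrable D (EFin \o (fun x => f x + F x)).
Proof. by move=> mD i1 i2; rewrite (_ : EFin \o _ = (EFin \o f) \+ (EFin \o F))%E//; exact: integrableD. Qed.

Lemma integrable_subr (D : set R) f F : measurable D ->
  mu.-integrable D (EFin \o f) -> mu.-integrable D (EFin \o F) ->
  mu.-integrable D (EFin \o (fun x => f x - F x)).
Proof. by move=> mD i1 i2; rewrite (_ : EFin \o _ = (EFin \o f) \- (EFin \o F))%E//; exact: integrableB. Qed.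

Lemma integrable_mulr (D : set R) f (k : R) : measurable D ->
  mu.-integrable D (EFin \o f) -> mu.-integrable D (EFin \o (fun x => k * f x)).
Proof. by move=> mD i1; rewrite (_ : EFin \o _ = (fun x => k%:E * (EFin \o f) x)%E)//; exact: integrableZl. Qed.

Lemma integrable_sub_oo f a b c d : a <= c -> d <= b ->
  mu.-integrable `]a, b[ (EFin \o f) -> mu.-integrable `]c, d[ (EFin \o f).
Proof.
move=> ac db; apply: integrableS; [exact: measurable_itv|exact: measurable_itv|].
by move=> x /=; rewrite !in_itv/= => /andP[h1 h2]; rewrite (le_lt_trans ac)//= (lt_le_trans h2).
Qed.

(** Exhaustion of an open interval by segments: continuity is assumed only inside, so facts about
    segments are applied here and passed to the limit. With [n.+3] the two margins add up to less
    than [b - a], so that every segment is nondegenerate, even for [n = 0]. *)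
Definition shrink a b (n : nat) : set R :=
  `[a + (b - a) / n.+3%:R, b - (b - a) / n.+3%:R].

Lemma shrink_lt a b (n : nat) : a < b ->
  [/\ a < a + (b - a) / n.+3%:R,
   a + (b - a) / n.+3%:R < b - (b - a) / n.+3%:R &
   b - (b - a) / n.+3%:R < b].
Proof.
move=> ab; have n0 : 0 < n.+3%:R :> R by rewrite ltr0n.
have h : 0 < (b - a) / n.+3%:R by rewrite divr_gt0// subr_gt0.
have : (b - a) / n.+3%:R * 2 < b - a.
  by rewrite mulrAC ltr_pdivrMr// ltr_pM2l ?subr_gt0// ltr_nat.
by move: h; set h := (b - a) / _ => h0 h2; split; lra.
Qed.

Lemma shrink_sub a b (n : nat) : a < b -> shrink a b n `<=` `]a, b[.
Proof.
move=> ab x; rewrite /shrink/= !in_itv/= => /andP[h1 h2].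
by have [h3 _ h4] := shrink_lt n ab; rewrite (lt_le_trans h3 h1) (le_lt_trans h2 h4).
Qed.

Lemma measurable_shrink a b n : measurable (shrink a b n).
Proof. exact: measurable_itv. Qed.

Lemma shrink_nd a b : a < b -> nondecreasing_seq (shrink a b).
Proof.
move=> ab m n mn; rewrite subsetEset => x; rewrite /shrink/= !in_itv/= => /andP[h1 h2].
have h : (b - a) / n.+3%:R <= (b - a) / m.+3%:R.
  by rewrite ler_pM2l ?subr_gt0// lef_pV2 ?posrE ?ltr0n// ler_nat !ltnS.
by move: h h1 h2; set u := _ / m.+3%:R; set v := _ / n.+3%:R => *; apply/andP; split; lra.
Qed.

Lemma near_shrink a b x : a < x < b -> \forall n \near \oo, shrink a b n x.
Proof.
move=> /andP[ax xb].
have : \forall n \near \oo, n.+1%:R^-1 < Num.min ((x - a) / (b - a)) ((b - x) / (b - a)).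
  have m0 : 0 < Num.min ((x - a) / (b - a)) ((b - x) / (b - a)).
    by rewrite lt_min !divr_gt0// subr_gt0// (lt_trans ax).
  exact: (near_infty_natSinv_lt (PosNum m0)).
apply: filterS => n; have ab : 0 < b - a by lra.
rewrite lt_min !ltr_pdivlMr// => /andP[h1 h2].
have : (b - a) / n.+3%:R <= (b - a) * n.+1%:R^-1.
  by rewrite ler_pM2l// lef_pV2 ?posrE ?ltr0n// ler_nat ltnS ltnW.
rewrite /shrink/= in_itv/=; move: h1 h2; rewrite [n.+1%:R^-1 * _]mulrC.
by set u := _ / n.+3%:R; set v := _ * n.+1%:R^-1 => *; apply/andP; split; lra.
Qed.

Lemma bigcup_shrink a b : a < b -> \bigcup_n shrink a b n = `]a, b[%classic.
Proof.
move=> ab; apply/seteqP; split => [x [n _]|x]; first exact: shrink_sub.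
rewrite /= in_itv/= => /near_shrink[n _ /(_ n (leqnn n)) h].
by exists n.
Qed.

Lemma ge0_shrink_cvg f a b : a < b -> measurable_fun `]a, b[ f ->
  (forall x, a < x < b -> 0 <= f x) ->
  (\int[mu]_(x in shrink a b n) (f x)%:E)%E @[n --> \oo] -->
  (\int[mu]_(x in `]a, b[) (f x)%:E)%E.
Proof.
move=> ab mf f0; rewrite -(bigcup_shrink ab).
apply: ge0_nondecreasing_set_cvg_integral => //.
- exact: shrink_nd.
- by move=> i; exact: measurable_shrink.
- by move=> i; apply/measurable_EFinP; apply: measurable_funS mf => //; try exact: measurable_itv; exact: shrink_sub.
- move=> i x /shrink_sub-/(_ ab); rewrite /= in_itv/= lee_fin; exact: f0.
Qed.

Lemma shrink_cvg f a b : a < b -> mu.-integrable `]a, b[ (EFin \o f) ->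
  \int[mu]_(x in shrink a b n) (f x) @[n --> \oo] --> \int[mu]_(x in `]a, b[) (f x).
Proof.
move=> ab intf.
have intn n : mu.-integrable (shrink a b n) (EFin \o f).
  by apply: integrableS intf; [exact: measurable_itv|exact: measurable_shrink|exact: shrink_sub].
have /measurable_EFinP mf := measurable_int mu intf.
have Hp : (\int[mu]_(x in shrink a b n) (f^\+ x)%:E)%E @[n --> \oo] -->
    (\int[mu]_(x in `]a, b[) (f^\+ x)%:E)%E.
  apply: ge0_shrink_cvg => //; exact: measurable_funrpos.
have Hm : (\int[mu]_(x in shrink a b n) (f^\- x)%:E)%E @[n --> \oo] -->
    (\int[mu]_(x in `]a, b[) (f^\- x)%:E)%E.
  apply: ge0_shrink_cvg => //; exact: measurable_funrneg.
have e D : measurable D -> mu.-integrable D (EFin \o f) ->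
   \int[mu]_(x in D) (f x) = \int[mu]_(x in D) (f^\+ x) - \int[mu]_(x in D) (f^\- x).
  move=> mD iD; rewrite -RintegralB//; [|exact: integrable_funrpos|exact: integrable_funrneg].
  by apply: eq_Rintegral => x _; rewrite -[in LHS](funrposBneg f).
rewrite e//.
rewrite (_ : (fun n => _) = fun n => \int[mu]_(x in shrink a b n) (f^\+ x)
    - \int[mu]_(x in shrink a b n) (f^\- x)); last first.
  by apply/funext => n; apply: e; [exact: measurable_shrink|exact: intn].
apply: cvgB; rewrite /Rintegral; apply: fine_cvg; rewrite fineK//; apply: integrable_fin_num => //.
- exact: (integrable_funrpos _ intf).
- exact: (integrable_funrneg _ intf).
Qed.

Lemma is_derive_cont f x df : is_derive x 1 f df -> {for x, continuous f}.
Proof. by move=> [? _]; apply/differentiable_continuous/derivable1_diffP. Qed.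

Lemma FTC_seg f F a b : a <= b ->
  (forall x, a <= x <= b -> is_derive x 1 F (f x)) ->
  (forall x, a <= x <= b -> {for x, continuous f}) ->
  \int[mu]_(x in `[a, b]) f x = F b - F a.
Proof.
rewrite le_eqVlt => /predU1P[->|ab] dF cf.
  by rewrite set_itv1 Rintegral_set1 subrr.
rewrite /Rintegral (@continuous_FTC2 _ f F)//.
- exact: cont_within.
- have cF x : a <= x <= b -> {for x, continuous F}.
    by move=> xab; exact: is_derive_cont (dF _ xab).
  split=> [x||].
  + by rewrite in_itv/= => /andP[ax xb]; have [] := dF x; rewrite // !ltW.
  + by apply: cvg_at_right_filter; apply: cF; rewrite lexx ltW.
  + by apply: cvg_at_left_filter; apply: cF; rewrite lexx ltW.
- move=> x; rewrite in_itv/= => /andP[ax xb].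
  have dFx : is_derive x 1 F (f x) by apply: dF; rewrite !ltW.
  by rewrite derive1E; exact: derive_val.
Qed.

Lemma FTC_shrink f F a b n : a < b ->
  (forall x, a < x < b -> is_derive x 1 F (f x)) ->
  (forall x, a < x < b -> {for x, continuous f}) ->
  \int[mu]_(x in shrink a b n) f x =
  F (b - (b - a) / n.+3%:R) - F (a + (b - a) / n.+3%:R).
Proof.
move=> ab dF cf; have [h1 h2 h3] := shrink_lt n ab.
apply: FTC_seg => [|x /andP[h4 h5]|x /andP[h4 h5]]; first exact: ltW.
- by apply: dF; rewrite (lt_le_trans h1)//= (le_lt_trans h5).
- by apply: cf; rewrite (lt_le_trans h1)//= (le_lt_trans h5).
Qed.

Lemma shrink_bound_cvg (k : R) : k / n.+3%:R @[n --> \oo] --> 0.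
Proof.
rewrite -(mulr0 k); apply: cvgMr.
have := @cvg_harmonic R; rewrite -(cvg_shiftn 2); apply: cvg_trans.
by apply: near_eq_cvg; near=> n; rewrite /harmonic /= addnC.
Unshelve. all: end_near. Qed.

Lemma cvg_shrink_left F a b (l : R) : a < b -> F x @[x --> a^'+] --> l ->
  F (a + (b - a) / n.+3%:R) @[n --> \oo] --> l.
Proof.
move=> ab /cvg_at_rightP; apply; split.
  by move=> n; have [] := shrink_lt n ab.
by rewrite -[X in _ --> X]addr0; apply: cvgD; [exact: cvg_cst|exact: shrink_bound_cvg].
Qed.

Lemma cvg_shrink_right F a b (l : R) : a < b -> F x @[x --> b^'-] --> l ->
  F (b - (b - a) / n.+3%:R) @[n --> \oo] --> l.
Proof.
move=> ab /cvg_at_leftP; apply; split.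
  by move=> n; have [] := shrink_lt n ab.
by rewrite -[X in _ --> X]subr0; apply: cvgB; [exact: cvg_cst|exact: shrink_bound_cvg].
Qed.

Lemma FTC_oo f F a b (A B : R) : a < b -> mu.-integrable `]a, b[ (EFin \o f) ->
  (forall x, a < x < b -> is_derive x 1 F (f x)) ->
  (forall x, a < x < b -> {for x, continuous f}) ->
  F x @[x --> a^'+] --> A -> F x @[x --> b^'-] --> B ->
  \int[mu]_(x in `]a, b[) f x = B - A.
Proof.
move=> ab intf dF cf FA FB.
have := shrink_cvg ab intf.
under eq_cvg do rewrite (FTC_shrink _ ab dF cf).
move=> h; apply: (cvg_unique _ h); first exact: Rhausdorff.
by apply: cvgB; [exact: (cvg_shrink_right ab)|exact: (cvg_shrink_left ab)].
Qed.

(** For a nonnegative derivative, the integral over each exhausting segment is a difference of two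
    values of [F], hence at most [2 M]; monotone convergence keeps this bound. It yields
    integrability of functions that are unbounded at an end. *)
Lemma ge0_FTC_integrable f F a b (M : R) : a < b ->
  (forall x, a < x < b -> is_derive x 1 F (f x)) ->
  (forall x, a < x < b -> {for x, continuous f}) ->
  (forall x, a < x < b -> 0 <= f x) ->
  (forall x, a < x < b -> `|F x| <= M) ->
  mu.-integrable `]a, b[ (EFin \o f).
Proof.
move=> ab dF cf f0 FM.
have mf := cont_measurable cf.
apply/integrableP; split; first exact/measurable_EFinP.
under eq_integral => x.
  rewrite inE/= in_itv/= => xab; rewrite /= (ger0_norm (f0 _ xab)); over.
have H := ge0_shrink_cvg ab mf f0.
apply: (@le_lt_trans _ _ (M + M)%:E); last by rewrite ltry.
have <- := cvg_lim (@ereal_hausdorff R) H.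
apply: lime_le; first by apply/cvg_ex; eexists; exact: H.
near=> n.
have i_n : mu.-integrable (shrink a b n) (EFin \o f).
  by apply: cont_integrable => x xab; apply: cf; exact: (@shrink_sub a b n ab).
have -> : (\int[mu]_(x in shrink a b n) (f x)%:E)%E =
    (\int[mu]_(x in shrink a b n) f x)%:E.
  by rewrite /Rintegral fineK//; apply: integrable_fin_num => //; exact: measurable_itv.
rewrite lee_fin (FTC_shrink _ ab dF cf).
have [h1 h2 h3] := shrink_lt n ab.
by rewrite (le_trans (ler_norm _))// (le_trans (ler_normB _ _))// lerD// FM//; apply/andP; split=> //; apply: lt_trans h2 _ || apply: lt_trans h2.
Unshelve. all: end_near. Qed.

Lemma cont_dominated_integrable f F a b :
  (forall x, a < x < b -> {for x, continuous f}) ->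
  (forall x, a < x < b -> `|f x| <= F x) ->
  mu.-integrable `]a, b[ (EFin \o F) -> mu.-integrable `]a, b[ (EFin \o f).
Proof.
move=> cf fF; apply: le_integrable => //=.
  by apply/measurable_EFinP; exact: cont_measurable.
move=> x /=; rewrite in_itv/= => xab; rewrite lee_fin.
by rewrite (le_trans (fF _ xab))// ler_norm.
Qed.

Section decreasing_substitution.
Variables (g g' : R -> R) (a b c d : R).
Hypotheses (ab : a < b)
  (dg : forall x, a < x < b -> is_derive x 1 g (g' x))
  (cg' : forall x, a < x < b -> {for x, continuous g'})
  (g'0 : forall x, a < x < b -> g' x < 0)
  (ga : g x @[x --> a^'+] --> d) (gb : g x @[x --> b^'-] --> c).

Lemma dec_homo x y : a < x -> x < y -> y < b -> g y < g x.
Proof.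
move=> ax xy yb.
have xyab z : x <= z <= y -> a < z < b.
  by move=> /andP[h1 h2]; rewrite (lt_le_trans ax)//= (le_lt_trans h2).
have dgz z : x <= z <= y -> is_derive z 1 g (g' z) by move=> /xyab; exact: dg.
have [||z] := @MVT R g g' x y xy.
- by move=> z; rewrite in_itv/= => /andP[h1 h2]; apply: dgz; rewrite !ltW.
- by apply: cont_within => z /dgz; exact: is_derive_cont.
- rewrite in_itv/= => /andP[h1 h2] e.
  by rewrite -subr_lt0 e nmulr_rlt0 ?subr_gt0// g'0// xyab// !ltW.
Qed.

Lemma dec_range x : a < x < b -> c < g x < d.
Proof.
move=> /andP[ax xb].
(* Passing to the limit at an end weakens an inequality; comparison with a midpoint keeps it
   strict. *)
have cb : \forall y \near a^'+, g ((a + x) / 2) <= g y.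
  near=> y; apply/ltW/dec_homo; last by lra.
    by near: y; exact: nbhs_right_gt.
  by near: y; apply: nbhs_right_lt; lra.
have ca : \forall y \near b^'-, g y <= g ((b + x) / 2).
  near=> y; apply/ltW/dec_homo; [by lra| |].
    by near: y; apply: nbhs_left_gt; lra.
  by near: y; exact: nbhs_left_lt.
apply/andP; split.
  apply: (@le_lt_trans _ _ (g ((b + x) / 2))); last by apply: dec_homo; lra.
  by rewrite -(cvg_lim (@Rhausdorff R) gb); apply: limr_le => //; apply/cvg_ex; exists c.
apply: (@lt_le_trans _ _ (g ((a + x) / 2))); first by apply: dec_homo; lra.
by rewrite -(cvg_lim (@Rhausdorff R) ga); apply: limr_ge => //; apply/cvg_ex; exists d.
Unshelve. all: end_near. Qed.

Lemma dec_derive1 x : a < x < b -> (g^`())%classic x = g' x.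
Proof. by move=> xab; rewrite derive1E; have h := dg xab; exact: derive_val. Qed.

Lemma dec_derive1_cont x : a < x < b -> {for x, continuous (g^`())%classic}.
Proof.
move=> xab; rewrite /prop_for /continuous_at dec_derive1//.
apply: cvg_trans (cg' xab); apply: near_eq_cvg.
by apply: filterS (near_oo xab) => y yab; rewrite dec_derive1.
Qed.

Let A n := a + (b - a) / n.+3%:R.
Let B n := b - (b - a) / n.+3%:R.

Let image_shrink n : set R := `[g (B n), g (A n)].

Let image_shrink_sub n : image_shrink n `<=` `]c, d[.
Proof.
have [h1 h2 h3] := shrink_lt n ab.
move=> y; rewrite /image_shrink/= !in_itv/= => /andP[].
have /andP[h _] : c < g (B n) < d by apply: dec_range; rewrite h3 (lt_trans h1).
have /andP[_ h'] : c < g (A n) < d by apply: dec_range; rewrite h1 (lt_trans h2).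
by move=> /(lt_le_trans h) -> /le_lt_trans ->.
Qed.

Let bigcup_image_shrink : \bigcup_n image_shrink n = `]c, d[%classic.
Proof.
apply/seteqP; split => [x [n _]|x]; first exact: image_shrink_sub.
rewrite /= in_itv/= => /andP[cx xd].
have : \forall n \near \oo, g (B n) < x < g (A n).
  have := cvgr_gt d (cvg_shrink_left ab ga) x xd.
  have := cvgr_lt c (cvg_shrink_right ab gb) x cx.
  by move=> /(_ _)-h1 /(_ _)-h2; near=> n; apply/andP; split; near: n; [exact: h1|exact: h2].
move=> [n _ /(_ n (leqnn n))/=/andP[h1 h2]]; exists n => //.
by rewrite /image_shrink/= in_itv/= !ltW.
Unshelve. all: end_near. Qed.

Let image_shrink_nd : nondecreasing_seq image_shrink.
Proof.
move=> m n mn; rewrite subsetEset => y; rewrite /image_shrink/= !in_itv/=.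
have [h1 h2 h3] := shrink_lt n ab; have [h1' h2' h3'] := shrink_lt m ab.
have := shrink_nd ab mn; rewrite subsetEset => s.
have /s : shrink a b m (A m) by rewrite /shrink/= in_itv/= lexx ltW.
have /s : shrink a b m (B m) by rewrite /shrink/= in_itv/= lexx andbT ltW.
rewrite /shrink/= !in_itv/= => /andP[_ BB] /andP[AA _] /andP[y1 y2].
apply/andP; split.
  apply: le_trans y1; move: BB; rewrite le_eqVlt => /predU1P[e|BB]; first by rewrite /B -e.
  by apply/ltW/dec_homo => //; exact: lt_trans h2'.
apply: le_trans y2 _; move: AA; rewrite le_eqVlt => /predU1P[e|AA]; first by rewrite /A e lexx.
by apply/ltW/dec_homo => //; exact: lt_trans h3'.
Qed.

Lemma ge0_substitution_oo (G : R -> R) :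
  (forall y, c < y < d -> {for y, continuous G}) ->
  (forall y, c < y < d -> 0 <= G y) ->
  (\int[mu]_(y in `]c, d[) (G y)%:E = \int[mu]_(x in `]a, b[) (G (g x) * - g' x)%:E)%E.
Proof.
move=> cG G0.
have cGg x : a < x < b -> {for x, continuous (fun x => G (g x) * - g' x)}.
  move=> xab; apply: cvgM; last by apply: cvgN; exact: cg'.
  apply: continuous_comp; first exact: is_derive_cont (dg xab).
  by apply: cG; exact: dec_range.
have L : (\int[mu]_(y in image_shrink n) (G y)%:E)%E @[n --> \oo] -->
    (\int[mu]_(y in `]c, d[) (G y)%:E)%E.
  rewrite -bigcup_image_shrink; apply: ge0_nondecreasing_set_cvg_integral => //.
  - by move=> i; exact: measurable_itv.
  - move=> i; apply/measurable_EFinP; apply: measurable_funS (cont_measurable cG); last exact: image_shrink_sub.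
    exact: measurable_itv.
  - by move=> i x /image_shrink_sub; rewrite /= in_itv/= lee_fin; exact: G0.
apply: (cvg_unique _ L); first exact: ereal_hausdorff.
have Gg0 x : a < x < b -> 0 <= G (g x) * - g' x.
  by move=> xab; rewrite mulr_ge0 ?oppr_ge0 ?(ltW (g'0 _))// G0// dec_range.
have L' := ge0_shrink_cvg ab (cont_measurable cGg) Gg0.
apply: (cvg_trans _ L').
apply: near_eq_cvg; near=> n; have [h1 h2 h3] := shrink_lt n ab.
have sub x : A n <= x <= B n -> a < x < b.
  by move=> /andP[y1 y2]; rewrite (lt_le_trans h1)//= (le_lt_trans y2).
rewrite /image_shrink (@integration_by_substitution_decreasing _ g G (A n) (B n))//.
- apply: eq_integral => x; rewrite /shrink inE/= in_itv/= => /sub xab.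
  by rewrite /= [in RHS]/GRing.mul/= [in RHS]/GRing.opp/= dec_derive1.
- exact: ltW.
- move=> x y; rewrite !in_itv/= => /sub/andP[x1 x2] /sub/andP[y1 y2] xy.
  exact: dec_homo.
- by move=> x; rewrite in_itv/= => /andP[x1 x2]; apply: dec_derive1_cont; apply: sub; rewrite !ltW.
- by apply/cvg_ex; exists ((g^`())%classic (A n)); apply: cvg_at_right_filter; apply: dec_derive1_cont; apply: sub; rewrite lexx ltW.
- by apply/cvg_ex; exists ((g^`())%classic (B n)); apply: cvg_at_left_filter; apply: dec_derive1_cont; apply: sub; rewrite lexx ltW.
- split.
  + by move=> x; rewrite in_itv/= => /andP[x1 x2]; have [] := dg (sub x _); rewrite ?ltW.
  + by apply: cvg_at_right_filter; apply: is_derive_cont (dg (sub _ _)); rewrite lexx ltW.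
  + by apply: cvg_at_left_filter; apply: is_derive_cont (dg (sub _ _)); rewrite lexx ltW.
- apply: cont_within => y yAB; apply: cG.
  by have := @image_shrink_sub n y; rewrite /image_shrink/= !in_itv/=; exact.
Unshelve. all: end_near. Qed.

(** Integrability of [G] is a conclusion: the nonnegative case applied to [|G|] transports
    finiteness. The signed case then follows from [G = (|G| + G) - |G|], a difference of nonnegative
    continuous functions. *)
Lemma substitution_oo (G : R -> R) :
  (forall y, c < y < d -> {for y, continuous G}) ->
  mu.-integrable `]a, b[ (EFin \o (fun x => G (g x) * - g' x)) ->
  mu.-integrable `]c, d[ (EFin \o G) /\
  \int[mu]_(y in `]c, d[) G y = \int[mu]_(x in `]a, b[) (G (g x) * - g' x).
Proof.
move=> cG iG.
have cnG y : c < y < d -> {for y, continuous (fun x => `|G x|)}.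
  by move=> ycd; apply: (@cvg_norm _ _ _ _ _ G); exact: cG.
have nE : (\int[mu]_(y in `]c, d[) (`|G y|)%:E =
    \int[mu]_(x in `]a, b[) (`|G (g x) * - g' x|)%:E)%E.
  rewrite ge0_substitution_oo//; apply: eq_integral => x; rewrite inE/= in_itv/= => xab.
  by rewrite normrM normrN (ltr0_norm (g'0 _)).
have inG : mu.-integrable `]c, d[ (EFin \o G).
  apply/integrableP; split; first by apply/measurable_EFinP; exact: cont_measurable.
  by have /integrableP[_] := iG; rewrite /= nE.
split => //.
have E1 : \int[mu]_(y in `]c, d[) (G y) = \int[mu]_(y in `]c, d[) (`|G y| + G y) -
    \int[mu]_(y in `]c, d[) (`|G y|).
  rewrite -RintegralB//; [|apply: integrable_addr => //; exact: integrable_norm|exact: integrable_norm].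
  by apply: eq_Rintegral => x _; rewrite addrAC subrr add0r.
have E2 : \int[mu]_(x in `]a, b[) (G (g x) * - g' x) =
   \int[mu]_(x in `]a, b[) (`|G (g x) * - g' x| + G (g x) * - g' x) -
   \int[mu]_(x in `]a, b[) `|G (g x) * - g' x|.
  rewrite -RintegralB//; [|apply: integrable_addr => //; exact: integrable_norm|exact: integrable_norm].
  by apply: eq_Rintegral => x _; rewrite addrAC subrr add0r.
rewrite E1 E2; congr (_ - _); last by rewrite /Rintegral nE.
rewrite /Rintegral ge0_substitution_oo//.
- congr fine; apply: eq_integral => x; rewrite inE/= in_itv/= => xab.
  by rewrite mulrDl normrM normrN (ltr0_norm (g'0 _)).
- by move=> y ycd; apply: cvgD; [exact: cnG|exact: cG].
- by move=> y _; rewrite -lerBlDr sub0r -normrN ler_norm.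
Qed.

End decreasing_substitution.

End open_interval_integration.

(** * The Riemann-Lebesgue lemma for a bounded oscillating kernel *)

Section riemann_lebesgue.
Context {R : realType}.
Implicit Types (a b x : R) (f g : R -> R).
Notation mu := (@lebesgue_measure R).

Lemma Rint_chasles f a b c : a <= c <= b -> mu.-integrable `[a, b] (EFin \o f) ->
  \int[mu]_(x in `[a, b]) f x =
  \int[mu]_(x in `[a, c]) f x + \int[mu]_(x in `[c, b]) f x.
Proof.
move=> /andP[ac cb] fi; rewrite -(@Rintegral_itv_obnd_cbnd _ c).
  by rewrite -(Rintegral_itvB fi) ?bnd_simp// addrC subrK.
apply: integrableS fi; [exact: measurable_itv|exact: measurable_itv|].
by apply: subset_itvr; rewrite bnd_simp.
Qed.

Lemma Rint_split_oo f a b c : a < c < b -> mu.-integrable `]a, b[ (EFin \o f) ->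
  \int[mu]_(x in `]a, b[) f x =
  \int[mu]_(x in `]a, c[) f x + \int[mu]_(x in `]c, b[) f x.
Proof.
move=> /andP[ac cb] fi.
rewrite -(Rintegral_itvB fi (x := c)) ?bnd_simp//; last exact: ltW.
rewrite (@Rintegral_itv_bndo_bndc _ _ c); first by rewrite addrC subrK.
apply: integrableS fi; [exact: measurable_itv|exact: measurable_itv|].
by apply: subset_itvl; rewrite bnd_simp ltW.
Qed.

Lemma continuous_modulus g a b (e : R) : 0 < e ->
  (forall x, a <= x <= b -> {for x, continuous g}) ->
  exists2 d : R, 0 < d & forall x y, a <= x <= b -> a <= y <= b ->
    `|x - y| <= d -> `|g x - g y| <= e.
Proof.
move=> e0 cg.
pose P (d : R) (x : R) := forall y, a <= y <= b -> `|x - y| <= d -> `|g x - g y| <= e.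
have : \forall d \near 0^'+, `[a, b] `<=` P d.
  have /compact_near_coveringP := @segment_compact R a b.
  apply => x /=; rewrite in_itv/= => xab.
  have /cvgrPdist_lt/(_ (e / 2)) := cg x xab.
  rewrite divr_gt0// => /(_ isT)[r /= r0 xr].
  exists (ball x (r / 2), [set d | d < r / 2]) => /=.
    split; first by apply: nbhsx_ballx; rewrite divr_gt0.
    by apply: nbhs_right_lt; rewrite divr_gt0.
  move=> [z d] /= [+ dr] y yab zy; rewrite /ball/= => xz.
  have h1 : `|g x - g z| < e / 2 by apply: xr => /=; lra.
  have h2 : `|g x - g y| < e / 2.
    by apply: xr => /=; rewrite -(subrKA z) (le_lt_trans (ler_normD _ _))//; lra.
  by rewrite -(subrKA (g x)) (le_trans (ler_normD _ _))// distrC; lra.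
move=> h; have [d [d0 dP]] : exists d : R, 0 < d /\ `[a, b] `<=` P d.
  have [d ] := filter_ex (filterI (@nbhs_right_gt R 0) h).
  by move=> [? ?]; exists d.
exists d => // x y xab yab xy; apply: dP => //=; by rewrite in_itv.
Qed.

Section kernel.
Variables (K : R -> R -> R) (a b : R).
Hypotheses (cK : forall T x, a < x < b -> {for x, continuous (K T)})
  (K1 : forall T x, `|K T x| <= 1)
  (K0 : forall u v, a < u -> u <= v -> v < b ->
    \int[mu]_(x in `[u, v]) K T x @[T --> +oo] --> 0).

(** By uniform continuity [g] is nearly constant on pieces of length [d]. On a piece, the constant
    part vanishes in the limit by [K0], and the oscillation of [g] contributes at most [e1] times
    the length because [|K T x| <= 1]. *)
Lemma riemann_lebesgue_seg g u v : a < u -> u <= v -> v < b ->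
  (forall x, u <= x <= v -> {for x, continuous g}) ->
  \int[mu]_(x in `[u, v]) (g x * K T x) @[T --> +oo] --> 0.
Proof.
move=> au uv vb cg; apply/cvgrPdist_le => e e0.
(* Makes [e1 * (v - u) <= e / 2]; the [+ 1] keeps the denominator positive when [u = v]. *)
pose e1 := e / (2 * (v - u + 1)).
have e10 : 0 < e1 by rewrite divr_gt0// mulr_gt0//; lra.
have [d d0 gd] := continuous_modulus e10 cg.
have inab x : u <= x <= v -> a < x < b.
  by move=> /andP[? ?]; apply/andP; split; [exact: lt_le_trans au _|exact: le_lt_trans vb].
have cgK T x : u <= x <= v -> {for x, continuous (fun x => g x * K T x)}.
  by move=> xuv; apply: cvgM; [exact: cg|apply: cK; exact: inab].
(* Induction on the number [n] of pieces that cover [[u, w]]. On the last piece [g] is compared with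
   [g w], and half of the slack [eta] pays for the kernel integral there. *)
have main n w : u <= w <= v -> w <= u + n%:R * d -> forall eta, 0 < eta ->
    \forall T \near +oo, `|\int[mu]_(x in `[u, w]) (g x * K T x)| <= e1 * (w - u) + eta.
  elim: n w => [|n IH] w /andP[uw wv] wn eta eta0.
    have -> : w = u by lra.
    by near=> T; rewrite set_itv1 Rintegral_set1 normr0 subrr mulr0 add0r ltW.
  pose w' := Num.max u (w - d).
  have w'w : w' <= w by rewrite ge_max uw/=; lra.
  have uw' : u <= w' by rewrite le_max lexx.
  have w'v : w' <= v by lra.
  have w'd : w - w' <= d by rewrite lerBlDr -lerBlDl le_max lexx orbT.
  have w'n : w' <= u + n%:R * d.
    rewrite ge_max; apply/andP; split; last by move: wn; rewrite -natr1; lra.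
    by rewrite lerDl mulr_ge0// ltW.
  have h1 : u <= w' <= v by rewrite uw'.
  have := IH w' h1 w'n (eta / 2).
  rewrite divr_gt0// => /(_ isT) {}IH.
  have gK0 : g w * \int[mu]_(x in `[w', w]) K T x @[T --> +oo] --> 0.
    rewrite -[X in _ --> X](mulr0 (g w)); apply: cvgMr.
    by apply: K0; [exact: lt_le_trans uw'|exact: w'w|exact: le_lt_trans vb].
  have /cvgrPdist_le/(_ (eta / 2)) := gK0.
  rewrite divr_gt0// => /(_ isT) {}gK0.
  near=> T.
  rewrite (@Rint_chasles _ u w w'); first last.
    by apply: cont_integrable => x /andP[h2 h3]; apply: cgK; rewrite h2 (le_trans h3).
    by rewrite uw'.
  have i1 : mu.-integrable `[w', w] (EFin \o K T).
    by apply: cont_integrable => x /andP[h2 h3]; apply/cK/inab; rewrite (le_trans uw' h2) (le_trans h3).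
  have i2 : mu.-integrable `[w', w] (EFin \o (fun x => (g x - g w) * K T x)).
    apply: cont_integrable => x /andP[h2 h3].
    have xuv : u <= x <= v by rewrite (le_trans uw' h2) (le_trans h3).
    by apply: cvgM; [apply: cvgB; [exact: cg|exact: cvg_cst]|apply/cK/inab].
  have -> : \int[mu]_(x in `[w', w]) (g x * K T x) =
     \int[mu]_(x in `[w', w]) ((g x - g w) * K T x) + g w * \int[mu]_(x in `[w', w]) K T x.
    rewrite -RintegralZl//= -RintegralD//=; last exact: integrable_mulr.
    by apply: eq_Rintegral => x _; ring.
  have b1 : `|\int[mu]_(x in `[u, w']) (g x * K T x)| <= e1 * (w' - u) + eta / 2 by near: T.
  have b2 : `|g w * \int[mu]_(x in `[w', w]) K T x| <= eta / 2.
    by rewrite -normrN -[X in `|X|]add0r; near: T.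
  have b3 : `|\int[mu]_(x in `[w', w]) ((g x - g w) * K T x)| <= e1 * (w - w').
    apply: le_trans (le_normr_Rintegral _ i2) _ => //.
    apply: (@le_trans _ _ (\int[mu]_(x in `[w', w]) e1)).
      apply: le_Rintegral => //=.
      - exact: integrable_norm.
      - by apply: cont_integrable => x _; exact: cvg_cst.
      - move=> x; rewrite in_itv/= => /andP[h2 h3]; rewrite normrM.
        rewrite -[leRHS]mulr1 ler_pM//; apply: gd.
        + by rewrite (le_trans uw' h2) (le_trans h3).
        + by rewrite uw.
        + by rewrite distrC ger0_norm ?subr_ge0//; lra.
    rewrite Rintegral_cst//= lebesgue_measure_itv/= lte_fin; case: ifPn => [h|_]; first by [].
    by rewrite mulr0 mulr_ge0 ?subr_ge0// ltW.
  apply: le_trans (ler_normD _ _) _.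
  apply: (@le_trans _ _ (e1 * (w' - u) + eta / 2 + (e1 * (w - w') + eta / 2))).
    by apply: lerD => //; apply: le_trans (ler_normD _ _) _; exact: lerD.
  by rewrite le_eqVlt; apply/orP; left; apply/eqP; field.
have [n nP] : exists n : nat, v <= u + n%:R * d.
  exists (Num.truncn ((v - u) / d)).+1.
  have := truncnS_gt ((v - u) / d); rewrite ltr_pdivrMr// => h.
  by rewrite -lerBlDl ltW.
have := main n v _ nP (e / 2); rewrite uv lexx divr_gt0// => /(_ isT isT).
apply: filterS => T; rewrite sub0r normrN => /le_trans; apply.
have : e1 * (v - u) <= e / 2.
  rewrite /e1 invfM mulrA -mulrA -[leRHS]mulr1 ler_pM2l ?divr_gt0//.
  by rewrite mulrC ler_pdivrMr; lra.
lra.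
Unshelve. all: end_near. Qed.

(** Integrability of [f] makes the integral of [|f|] outside a segment small, and [|K T x| <= 1]
    makes this uniform in [T]; the segment case does the rest, so [f] may be unbounded at the
    ends. *)
Lemma riemann_lebesgue_oo f : a < b ->
  (forall x, a < x < b -> {for x, continuous f}) ->
  mu.-integrable `]a, b[ (EFin \o f) ->
  \int[mu]_(x in `]a, b[) (f x * K T x) @[T --> +oo] --> 0.
Proof.
move=> ab cf fi; apply/cvgrPdist_le => e e0.
have cfn x : a < x < b -> {for x, continuous (fun x => `|f x|)}.
  by move=> xab; apply: (@cvg_norm _ _ _ _ _ f); exact: cf.
have fni : mu.-integrable `]a, b[ (EFin \o (fun x => `|f x|)) by exact: integrable_norm.
have cfK T x : a < x < b -> {for x, continuous (fun x => f x * K T x)}.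
  by move=> xab; apply: cvgM; [exact: cf|exact: cK].
have fKi T : mu.-integrable `]a, b[ (EFin \o (fun x => f x * K T x)).
  apply: cont_dominated_integrable fni; first exact: cfK.
  by move=> x _; rewrite normrM -[leRHS]mulr1 ler_pM.
have e20 : 0 < e / 2 by rewrite divr_gt0.
have /cvgrPdist_le/(_ _ e20)[n _ /(_ n (leqnn n)) /= nP] := shrink_cvg ab fni.
have [h1 h2 h3] := shrink_lt n ab.
have ms : measurable (shrink a b n) by exact: measurable_shrink.
have md : measurable (`]a, b[%classic `\` shrink a b n) by apply: measurableD => //; exact: measurable_itv.
have sp F : mu.-integrable `]a, b[ (EFin \o F) -> \int[mu]_(x in `]a, b[) F x =
    \int[mu]_(x in shrink a b n) F x + \int[mu]_(x in `]a, b[ `\` shrink a b n) F x.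
  move=> Fi; rewrite -Rintegral_setU//.
  - by rewrite setDUK//; exact: shrink_sub.
  - by rewrite setDUK//; exact: shrink_sub.
  - by apply/disj_setPS => x [? []].
have dsub : `]a, b[%classic `\` shrink a b n `<=` `]a, b[ by exact: subDsetl.
have tail T : `|\int[mu]_(x in `]a, b[ `\` shrink a b n) (f x * K T x)| <= e / 2.
  have i1 : mu.-integrable (`]a, b[ `\` shrink a b n) (EFin \o (fun x => f x * K T x)).
    by apply: integrableS (fKi T).
  have i2 : mu.-integrable (`]a, b[ `\` shrink a b n) (EFin \o (fun x => `|f x|)).
    by apply: integrableS fni.
  apply: le_trans (le_normr_Rintegral _ i1) _ => //.
  apply: (@le_trans _ _ (\int[mu]_(x in `]a, b[ `\` shrink a b n) `|f x|)).
    apply: le_Rintegral => //=; first exact: integrable_norm.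
    by move=> x _; rewrite normrM -[leRHS]mulr1 ler_pM.
  move: nP; rewrite (sp _ fni) addrAC subrr add0r ger0_norm//.
  by apply: Rintegral_ge0.
have cfs x : a + (b - a) / n.+3%:R <= x <= b - (b - a) / n.+3%:R -> {for x, continuous f}.
  by move=> /andP[h4 h5]; apply: cf; rewrite (lt_le_trans h1)//= (le_lt_trans h5).
have /cvgrPdist_le/(_ _ e20) := riemann_lebesgue_seg h1 (ltW h2) h3 cfs.
apply: filterS => T; rewrite !sub0r !normrN => hT.
by rewrite (sp _ (fKi T)) (le_trans (ler_normD _ _))// [leRHS]splitr lerD// tail.
Qed.

End kernel.
End riemann_lebesgue.

(** * Fubini's theorem for truncated Fourier integrals *)

Section fubini_interval.
Context {R : realType}.
Notation mu := (@lebesgue_measure R).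
Let X := measurableTypeR R.
Variables (g u : R -> R) (h : R -> R) (a b T : R).
Hypotheses (gi : mu.-integrable `]a, b[ (EFin \o g))
  (cu : forall x, a < x < b -> {for x, continuous u})
  (ch : continuous h) (h1 : forall y, `|h y| <= 1).

Let I : set X := `[- T, T]%classic.
Let D : set X := `]a, b[%classic.

Let mI : measurable I. Proof. exact: measurable_itv. Qed.
Let mD : measurable D. Proof. exact: measurable_itv. Qed.

(** The integrand extended by [0] outside the rectangle, so that Fubini's theorem on the whole plane
    applies. Measurability of [u] comes from continuity inside [D], hence the restriction also under
    [h]. *)
Let f (z : X * X) : R := (g \_ D) z.1 * h (z.2 * (u \_ D) z.1) * (\1_I : X -> R) z.2.

Let mh : measurable_fun setT (h : X -> R).
Proof. exact: continuous_measurable_fun. Qed.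

Let mg : measurable_fun setT (g \_ D : X -> R).
Proof.
have gm : measurable_fun D (g : X -> R) by have /measurable_EFinP := measurable_int _ gi.
exact: (iffLR (measurable_restrictT _ mD) gm).
Qed.

Let mu_ : measurable_fun setT (u \_ D : X -> R).
Proof. exact: (iffLR (measurable_restrictT _ mD) (cont_measurable cu)). Qed.

Let m1 : measurable_fun setT (\1_I : X -> R).
Proof. exact: measurable_indic. Qed.

Let mf : measurable_fun setT f.
Proof.
apply: measurable_funM; last exact: (measurableT_comp m1 measurable_snd).
apply: measurable_funM; first exact: (measurableT_comp mg measurable_fst).
apply: (measurableT_comp mh); apply: measurable_funM; first exact: measurable_snd.
exact: (measurableT_comp mu_ measurable_fst).
Qed.

Let fE1 x : a < x < b -> (\int[mu]_t (f (x, t))%:E)%E =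
  (g x * \int[mu]_(t in `[- T, T]) h (t * u x))%:E.
Proof.
move=> xab.
have ih : mu.-integrable `[- T, T] (EFin \o (fun t => h (t * u x))).
  apply: cont_integrable => t _; apply: continuous_comp; last exact: ch.
  exact: mulrr_continuous.
transitivity (\int[mu]_(t in `[(- T)%R, T]) (g x * h (t * u x))%R%:E)%E; last first.
  rewrite -RintegralZl//= /Rintegral fineK//.
  by apply: integrable_fin_num => //; exact: (integrable_mulr (g x) _ ih).
rewrite [RHS]integral_mkcond; apply: eq_integral => t _.
have xD : x \in D by rewrite inE/D/= in_itv.
rewrite /f /= !patchE xD/= indicE.
by rewrite -/I; case: ifPn => _; rewrite ?mulr1 ?mulr0.
Qed.

Let integrable_slice t : mu.-integrable D (EFin \o (fun x => g x * h (t * u x))).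
Proof.
have m : measurable_fun D (fun x : X => g x * h (t * u x)).
  apply: measurable_funM; first by have /measurable_EFinP := measurable_int _ gi.
  apply: (measurableT_comp mh); apply: measurable_funM; first exact: measurable_cst.
  exact: cont_measurable.
apply: (@le_integrable _ _ _ mu D mD _ (EFin \o g)) => //.
  exact/measurable_EFinP.
by move=> x _; rewrite lee_fin normrM -[leRHS]mulr1 ler_pM.
Qed.

Let fE2 t : (\int[mu]_x (f (x, t))%:E)%E =
  ((fun t => \int[mu]_(x in D) (g x * h (t * u x)))%R \_ I t)%:E.
Proof.
have ih := integrable_slice t.
rewrite patchE; case: ifPn => tI.
  rewrite /Rintegral fineK; last exact: integrable_fin_num.
  rewrite [RHS]integral_mkcond; apply: eq_integral => x _.
  rewrite /f /= !patchE indicE tI mulr1; case: ifPn => //; by rewrite mul0r.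
rewrite -[RHS](integral0 mu setT); apply: eq_integral => x _.
by rewrite /f/= indicE (negbTE tI) mulr0.
Qed.

Let fi : (mu \x mu)%E.-integrable setT (EFin \o f).
Proof.
apply/integrable12ltyP; first exact/measurable_EFinP.
apply: (@le_lt_trans _ _ (\int[mu]_x (`|(g \_ D) x|%:E * mu I)%E)%E).
  apply: ge0_le_integral => //.
  - by move=> x _; exact: integral_ge0.
  - apply: (@measurable_fun_fubini_tonelli_F _ _ _ _ _ _ (abse \o (EFin \o f))) => //.
    + by apply: measurableT_comp => //; exact/measurable_EFinP.
    + by move=> x; exact: abse_ge0.
  - by apply: emeasurable_funM => //; apply/measurable_EFinP; apply: measurableT_comp.
  move=> x _.
  apply: (@le_trans _ _ (\int[mu]_t (`|(g \_ D) x|%:E * (\1_I t)%:E))%E).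
    apply: ge0_le_integral => //.
    - apply/measurable_EFinP; apply: measurableT_comp => //.
      by apply: measurableT_comp mf _; exact: measurable_pair1.
    - by apply: emeasurable_funM => //; exact/measurable_EFinP.
    - move=> t _; have i0 : 0 <= (\1_I : X -> R) t by rewrite indicE ler0n.
      rewrite /f/= lee_fin !normrM (ger0_norm i0).
      by rewrite ler_wpM2r// -[leRHS]mulr1 ler_pM.
  rewrite ge0_integralZl//; last exact/measurable_EFinP.
  by rewrite integral_indic// setIT.
have Ifin : mu I \is a fin_num.
  by rewrite /I lebesgue_measure_itv/=; case: ifPn.
rewrite -(fineK Ifin) ge0_integralZr//; last 2 first.
  by apply/measurable_EFinP; apply: measurableT_comp.
  by rewrite lee_fin fine_ge0.
apply: lte_mul_pinfty => //.
- exact: integral_ge0.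
- by rewrite ge0_fin_numE; [|exact: integral_ge0];
  have /(integrable_mkcond _ mD)/integrableP[_] := gi;
  under eq_integral do rewrite restrict_EFin.
- by rewrite ltry.
Qed.

Lemma integrable_fubini_fst :
  mu.-integrable `]a, b[ (EFin \o (fun x => g x * \int[mu]_(t in `[- T, T]) h (t * u x))).
Proof.
have := integrable_fubini_F fi; move=> /(@integrableS _ _ _ mu setT D _ measurableT mD (@subsetT _ _)).
by apply: eq_integrable => // x; rewrite /D inE/= in_itv/= => /fE1.
Qed.

Lemma integrable_fubini_snd :
  mu.-integrable `[- T, T] (EFin \o (fun t => \int[mu]_(x in `]a, b[) (g x * h (t * u x)))).
Proof.
have gni : mu.-integrable D (EFin \o (fun x => `|g x|)) by exact: integrable_norm.
apply: (@le_integrable _ _ _ mu I mI _ (EFin \o cst (\int[mu]_(x in D) `|g x|))).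
- apply/(measurable_restrictT _ mI).
  have := measurable_fubini_G fi; apply: eq_measurable_fun => t _.
  by rewrite /fubini_G/= fE2 restrict_EFin.
- move=> t _ /=; rewrite lee_fin.
  have ih := integrable_slice t.
  apply: le_trans (le_normr_Rintegral _ ih) _ => //.
  rewrite ger0_norm; last exact: Rintegral_ge0.
  apply: le_Rintegral => //=; first exact: integrable_norm.
  by move=> x _; rewrite normrM -[leRHS]mulr1 ler_pM.
- by apply: cont_integrable => x _; exact: cvg_cst.
Qed.

Lemma Rintegral_fubini :
  \int[mu]_(t in `[- T, T]) \int[mu]_(x in `]a, b[) (g x * h (t * u x)) =
  \int[mu]_(x in `]a, b[) (g x * \int[mu]_(t in `[- T, T]) h (t * u x)).
Proof.
rewrite /Rintegral; congr fine.
have := Fubini fi.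
rewrite [X in X = _ -> _](_ : _ = \int[mu]_(x in `]a, b[) (g x * \int[mu]_(t in `[(- T)%R, T]) h (t * u x))%R%:E)%E.
  rewrite [X in _ = X -> _](_ : _ = \int[mu]_(t in `[(- T)%R, T]) (\int[mu]_(x in `]a, b[) (g x * h (t * u x)))%R%:E)%E.
    by move=> ->.
  rewrite [RHS]integral_mkcond; apply: eq_integral => t _.
  by rewrite fE2 !patchE -/I; case: ifPn.
rewrite [RHS]integral_mkcond; apply: eq_integral => x _; rewrite patchE; case: ifPn.
  by rewrite inE/= in_itv/= => /fE1.
move=> xD; rewrite -[RHS](integral0 mu setT); apply: eq_integral => t _.
by rewrite /f/= patchE (negbTE xD) !mul0r.
Qed.

End fubini_interval.

(** * The Dirichlet kernel in logarithmic scale *)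

Section derivatives.
Context {R : realType}.
Implicit Types (f g : R -> R) (x df dg : R).

Lemma drv_eq f x df dg : is_derive x 1 f df -> df = dg -> is_derive x 1 f dg.
Proof. by move=> h <-. Qed.

Lemma drvD f g x df dg : is_derive x 1 f df -> is_derive x 1 g dg ->
  is_derive x 1 (fun y => f y + g y) (df + dg).
Proof. by move=> ? ?; exact: is_deriveD. Qed.

Lemma drvN f x df : is_derive x 1 f df -> is_derive x 1 (fun y => - f y) (- df).
Proof. by move=> ?; exact: is_deriveN. Qed.

Lemma drvM f g x df dg : is_derive x 1 f df -> is_derive x 1 g dg ->
  is_derive x 1 (fun y => f y * g y) (df * g x + f x * dg).
Proof.
move=> h1 h2; apply: is_derive_eq (@is_deriveM _ _ f g x 1 df dg h1 h2) _.
by rewrite /GRing.scale/= addrC [g x * df]mulrC.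
Qed.

Lemma drvZ f x df (k : R) : is_derive x 1 f df -> is_derive x 1 (fun y => k * f y) (k * df).
Proof. by move=> ?; exact: (@is_deriveZ _ _ _ f k x 1 df). Qed.

Lemma drvV f x df : f x != 0 -> is_derive x 1 f df ->
  is_derive x 1 (fun y => (f y)^-1) (- df / f x ^+ 2).
Proof.
move=> fx0 h; have := is_deriveV fx0 h.
by rewrite /GRing.scale/= mulrC mulrN mulNr.
Qed.

Lemma drv_div f g x df dg : g x != 0 -> is_derive x 1 f df -> is_derive x 1 g dg ->
  is_derive x 1 (fun y => f y / g y) ((df * g x - f x * dg) / g x ^+ 2).
Proof.
move=> gx0 h1 h2; apply: is_derive_eq (drvM h1 (drvV gx0 h2)) _.
by field.
Qed.

Lemma drv_comp f g x df dg : is_derive x 1 g dg -> is_derive (g x) 1 f df ->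
  is_derive x 1 (fun y => f (g y)) (df * dg).
Proof. by move=> ? ?; apply: is_derive_eq (@is_derive1_comp _ f g x df dg _ _) _; rewrite /GRing.scale/= mulrC. Qed.

Lemma drv_cst x (k : R) : is_derive x 1 (fun=> k) 0.
Proof. exact: is_derive_cst. Qed.

Lemma drv_id x : is_derive x 1 (fun y : R => y) 1.
Proof. exact: is_derive_id. Qed.

Lemma drv_sin f x df : is_derive x 1 f df -> is_derive x 1 (fun y => sin (f y)) (cos (f x) * df).
Proof. by move=> h; exact: (drv_comp h (is_derive_sin _)). Qed.

Lemma drv_cos f x df : is_derive x 1 f df -> is_derive x 1 (fun y => cos (f y)) (- sin (f x) * df).
Proof. by move=> h; exact: (drv_comp h (is_derive_cos _)). Qed.

Lemma drv_ln f x df : 0 < f x -> is_derive x 1 f df -> is_derive x 1 (fun y => ln (f y)) (df / f x).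
Proof. by move=> fx h; apply: is_derive_eq (drv_comp h (is_derive1_ln fx)) _; rewrite mulrC. Qed.

Lemma drv_exp f x df : is_derive x 1 f df -> is_derive x 1 (fun y => expR (f y)) (expR (f x) * df).
Proof. by move=> h; exact: (drv_comp h (is_derive_expR _)). Qed.

End derivatives.

(** Differentiation directed by the shape of the function. The order matters: constants come first,
    and quotients before products, since [f / g] is [f * g^-1]. Side conditions such as [g x != 0]
    are left as goals. Below, [drvc] obtains continuity from differentiability, and [drve] leaves
    the equation between the computed and the claimed derivative. *)
Ltac drv1 := cbv beta; lazymatch goal with
 | |- is_derive _ _ (fun _ => ?k) _ => exact (drv_cst _ k)
 | |- is_derive _ _ (fun y => y) _ => exact (drv_id _)
 | |- is_derive _ _ (fun y => @GRing.add _ (@?f y) (@?g y)) _ => notypeclasses refine (@drvD _ f g _ _ _ _ _)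
 | |- is_derive _ _ (fun y => @GRing.opp _ (@?f y)) _ => notypeclasses refine (@drvN _ f _ _ _)
 | |- is_derive _ _ (fun y => @GRing.mul _ (@?f y) (@GRing.inv _ (@?g y))) _ => notypeclasses refine (@drv_div _ f g _ _ _ _ _ _)
 | |- is_derive _ _ (fun y => @GRing.mul _ (@?f y) (@?g y)) _ => notypeclasses refine (@drvM _ f g _ _ _ _ _)
 | |- is_derive _ _ (fun y => @GRing.inv _ (@?f y)) _ => notypeclasses refine (@drvV _ f _ _ _ _)
 | |- is_derive _ _ (fun y => sin (@?f y)) _ => notypeclasses refine (@drv_sin _ f _ _ _)
 | |- is_derive _ _ (fun y => cos (@?f y)) _ => notypeclasses refine (@drv_cos _ f _ _ _)
 | |- is_derive _ _ (fun y => expR (@?f y)) _ => notypeclasses refine (@drv_exp _ f _ _ _)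
 | |- is_derive _ _ (fun y => ln (@?f y)) _ => notypeclasses refine (@drv_ln _ f _ _ _ _)
 end.
Ltac drv := repeat drv1; cbv beta.
Tactic Notation "drvc" := notypeclasses refine (is_derive_cont _); [drv|..]; cbv beta.
Tactic Notation "drve" := notypeclasses refine (drv_eq _ _); [drv|..]; cbv beta.

(** * Dirichlet's integral and pointwise inversion *)

Section mellin_kernel.
Context {R : realType}.
Notation mu := (@lebesgue_measure R).

Lemma ln_le_subr1 (x : R) : 0 < x -> ln x <= x - 1.
Proof. by move=> x0; have := @le_ln1Dx R (x - 1); rewrite subrKC; apply; lra. Qed.

Lemma squeeze_norm0 {T : Type} (F : set_system T) {FF : Filter F} (f g : T -> R) :
  (\forall t \near F, `|f t| <= g t) -> g t @[t --> F] --> 0 -> f t @[t --> F] --> 0.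
Proof.
move=> fg g0; have gN : - g t @[t --> F] --> 0 by rewrite -oppr0; exact: cvgN.
by apply: (squeeze_cvgr _ gN g0); apply: filterS fg => t; rewrite ler_norml.
Qed.

Lemma norm_sin_le (x : R) : `|sin x| <= `|x|.
Proof.
wlog x0 : x / 0 <= x.
  move=> H; have [x0|x0] := leP 0 x; first exact: H.
  by rewrite -normrN -sinN -[leRHS]normrN; apply: H; rewrite oppr_ge0 ltW.
have [->|xn0] := eqVneq x 0; first by rewrite sin0.
have xp : 0 < x by rewrite lt_neqAle eq_sym xn0.
have [|c] := @MVT R sin cos 0 x xp.
- by apply: cont_within => y _; exact: continuous_sin.
- rewrite in_itv/= => _; rewrite sin0 !subr0 => ->.
  by rewrite normrM ler_piMl// cos_max.
Qed.

Lemma sin_ln_cvg (y0 u v : R) : 0 < u -> u <= v ->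
  \int[mu]_(x in `[u, v]) sin (T * (ln x - y0)) @[T --> +oo] --> 0.
Proof.
move=> u0 uv.
(* The imaginary part of [x * exp(i T (ln x - y0)) / (1 + i T)], an explicit primitive that is
   [O(1 / T)] on bounded sets. *)
pose P T x := x * (sin (T * (ln x - y0)) - T * cos (T * (ln x - y0))) / (1 + T ^+ 2).
have E T : \int[mu]_(x in `[u, v]) sin (T * (ln x - y0)) = P T v - P T u.
  have T0 : 1 + T ^+ 2 != 0 by rewrite gt_eqF// ltr_pwDl// sqr_ge0.
  apply: FTC_seg => // x /andP[ux _]; have x0 : 0 < x by exact: lt_le_trans ux.
    rewrite /P; drve => //; field; by rewrite T0 gt_eqF.
  by drvc.
under eq_cvg do rewrite E.
have b (T x : R) : 1 <= T -> 0 <= x -> `|P T x| <= 2 * x / T.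
  move=> T1 x0; have T0 : 0 < T by exact: lt_le_trans T1.
  rewrite /P !normrM normfV (ger0_norm x0) (@ger0_norm _ (1 + T ^+ 2)); last by rewrite addr_ge0// sqr_ge0.
  rewrite ler_pdivrMr; last by rewrite ltr_pwDl// sqr_ge0.
  apply: (@le_trans _ _ (x * (1 + T))).
    rewrite ler_wpM2l// (le_trans (ler_normB _ _))// lerD ?sin_max//.
    by rewrite normrM gtr0_norm// ler_piMr ?cos_max// ltW.
  rewrite mulrAC ler_pdivlMr//.
  rewrite -subr_ge0 (_ : _ - _ = x * ((T - 1) ^+ 2 + (T - 1) + 2)); last by ring.
  by rewrite mulr_ge0// addr_ge0// addr_ge0 ?sqr_ge0// subr_ge0.
apply/cvgrPdist_le => e e0; near=> T.
have T1 : 1 <= T by near: T; apply: nbhs_pinfty_ge; rewrite num_real.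
have T0 : 0 < T by exact: lt_le_trans T1.
rewrite sub0r normrN (le_trans (ler_normB _ _))//.
have v0 : 0 < v by exact: lt_le_trans uv.
apply: (@le_trans _ _ (2 * v / T + 2 * u / T)).
  by apply: lerD; apply: b => //; exact: ltW.
rewrite -mulrDl ler_pdivrMr// -ler_pdivrMl//.
Unshelve. all: end_near. Qed.

Lemma sin_ln_cont (y0 T x : R) : 0 < x -> {for x, continuous (fun x => sin (T * (ln x - y0)))}.
Proof. by move=> x0; drvc. Qed.

Lemma riemann_lebesgue_ln (f : R -> R) (y0 a b : R) : 0 <= a -> a < b ->
  (forall x, a < x < b -> {for x, continuous f}) ->
  mu.-integrable `]a, b[ (EFin \o f) ->
  \int[mu]_(x in `]a, b[) (f x * sin (T * (ln x - y0))) @[T --> +oo] --> 0.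
Proof.
move=> a0 ab cf fi.
apply: (riemann_lebesgue_oo (K := fun T x => sin (T * (ln x - y0)))) => //.
- by move=> T x /andP[ax _]; apply: sin_ln_cont; exact: le_lt_trans ax.
- by move=> T x; exact: sin_max.
- by move=> u v au uv _; apply: sin_ln_cvg => //; exact: le_lt_trans au.
Qed.

(** Kept as an integral so that [u = 0] gives [2 T]; the closed form [2 sin (T u) / u] would be [0]
    there by the convention on inverses. *)
Definition dirichlet (T u : R) : R := \int[mu]_(t in `[- T, T]) cos (t * u).

Lemma dirichletE (T u : R) : 0 <= T -> u != 0 -> dirichlet T u = 2 * sin (T * u) / u.
Proof.
move=> T0 u0; have TT : - T <= T by rewrite ge0_cp.
have dF (t : R) : - T <= t <= T -> is_derive t 1 (fun t => sin (t * u) / u) (cos (t * u)).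
  by move=> _; drve => //; field.
rewrite /dirichlet (FTC_seg TT dF).
  by rewrite mulNr sinN; field.
by move=> t _; drvc.
Qed.

Lemma bounded_cont_integrable (f : R -> R) (a b M : R) :
  (forall x, a < x < b -> {for x, continuous f}) ->
  (forall x, a < x < b -> `|f x| <= M) -> mu.-integrable `]a, b[ (EFin \o f).
Proof.
move=> cf fM; apply: cont_dominated_integrable cf fM _.
apply: (@integrableS _ _ _ mu `[a, b]); [exact: measurable_itv|exact: measurable_itv| |].
  by apply: subset_itvW.
by apply: cont_integrable => x _; exact: cvg_cst.
Qed.

Section half_dirichlet.
Variables (x0 eta : R).
Hypotheses (x00 : 0 < x0) (eta0 : 0 < eta).

Definition half_dirichlet (T : R) := \int[mu]_(y in `]0, eta[) (sin (T * y) / y).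

Let k (T x : R) := sin (T * (ln x - ln x0)) / (ln x - ln x0) / x.

Let xl := x0 * expR (- eta).
Let xr := x0 * expR eta.

Let xl0 : 0 < xl. Proof. by rewrite mulr_gt0// expR_gt0. Qed.
Let xlx0 : xl < x0.
Proof. by rewrite /xl gtr_pMr// expR_lt1 oppr_lt0. Qed.

Let ln_xl : ln xl = ln x0 - eta.
Proof. by rewrite /xl lnM ?posrE ?expR_gt0// expRK. Qed.

Let ln_neq (x : R) : 0 < x -> x != x0 -> ln x - ln x0 != 0.
Proof. by move=> xp; apply: contra; rewrite subr_eq0 => /eqP/ln_inj ->//; rewrite posrE. Qed.

Let ln_cvg (x : R) : 0 < x -> {for x, continuous (fun y => ln y)}.
Proof. by move=> xp; drvc. Qed.

Let k_cont (T x : R) : 0 < x -> x != x0 -> {for x, continuous (k T)}.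
Proof. by move=> xp xx0; rewrite /k; drvc; first [exact: ln_neq | by rewrite gt_eqF | done]. Qed.

Let k_bound (T x : R) : 0 < x -> `|k T x| <= `|T| / x.
Proof.
move=> xp; have xi : 0 <= x^-1 by rewrite invr_ge0 ltW.
rewrite /k normrM (ger0_norm xi); apply: ler_pM => //.
have [->|h] := eqVneq (ln x - ln x0) 0; first by rewrite mulr0 sin0 mul0r normr0.
by rewrite normrM normfV ler_pdivrMr ?normr_gt0// (le_trans (norm_sin_le _))// normrM.
Qed.

(** The substitution [y = ln x0 - ln x], which decreases in [x] and turns [dx / x] into [- dy]. *)
Lemma kernel_left T : mu.-integrable `]xl, x0[ (EFin \o k T) /\
  \int[mu]_(x in `]xl, x0[) k T x = half_dirichlet T.
Proof.
have ki : mu.-integrable `]xl, x0[ (EFin \o k T).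
  apply: (@bounded_cont_integrable _ _ _ (`|T| / xl)) => x /andP[h1 h2].
    by apply: k_cont; [exact: lt_trans h1|rewrite lt_eqF].
  have xp : 0 < x by exact: lt_trans h1.
  apply: le_trans (k_bound _ xp) _; rewrite ler_wpM2l// lef_pV2 ?posrE//; exact: ltW.
have kE x : x \in `]xl, x0[%classic -> k T x = (fun y => sin (T * y) / y) (ln x0 - ln x) * - (- x^-1).
  by rewrite opprK /= /k -[ln x0 - _]opprB mulrN sinN invrN mulrNN.
have dg x : xl < x < x0 -> is_derive x 1 (fun x => ln x0 - ln x) (- x^-1).
  move=> /andP[h1 h2]; have xp : 0 < x by exact: lt_trans h1.
  by drve => //; field; rewrite gt_eqF.
have cg' x : xl < x < x0 -> {for x, continuous (fun x : R => - x^-1)}.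
  move=> /andP[h1 h2]; have xp : 0 < x by exact: lt_trans h1.
  by drvc; rewrite gt_eqF.
have g'0 x : xl < x < x0 -> - x^-1 < 0.
  by move=> /andP[h1 h2]; rewrite oppr_lt0 invr_gt0 (lt_trans _ h1).
have ga : ln x0 - ln x @[x --> xl^'+] --> eta.
  rewrite (_ : eta = ln x0 - ln xl); last by rewrite ln_xl; ring.
  by apply: cvg_at_right_filter; apply: cvgB; [exact: cvg_cst|exact: ln_cvg].
have gb : ln x0 - ln x @[x --> x0^'-] --> 0.
  rewrite -(subrr (ln x0)); apply: cvg_at_left_filter.
  by apply: cvgB; [exact: cvg_cst|exact: ln_cvg].
have cG (y : R) : 0 < y < eta -> {for y, continuous (fun y => sin (T * y) / y)}.
  by move=> /andP[y0 _]; drvc; rewrite gt_eqF.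
have [|_ h] := substitution_oo xlx0 dg cg' g'0 ga gb cG.
  by apply: eq_integrable ki => // x /kE /= ->.
by split => //; rewrite /half_dirichlet h; exact: eq_Rintegral.
Qed.

(** The map [x |-> x0 ^ 2 / x] reflects [ln x] in [ln x0]. The kernel is even there and [dx / x]
    only changes sign, so this decreasing map carries the left integral to the right one. *)
Lemma kernel_right T : mu.-integrable `]x0, xr[ (EFin \o k T) /\
  \int[mu]_(x in `]x0, xr[) k T x = half_dirichlet T.
Proof.
have [ki <-] := kernel_left T.
have kE x : x \in `]xl, x0[%classic -> k T x = k T (x0 ^+ 2 / x) * - (- (x0 ^+ 2 / x ^+ 2)).
  rewrite inE/= in_itv/= => /andP[h1 h2]; have xp : 0 < x by exact: lt_trans h1.
  rewrite opprK /k ln_div ?posrE ?exprn_gt0// lnXn// mulr2n.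
  rewrite (_ : ln x0 + ln x0 - ln x - ln x0 = - (ln x - ln x0)); last by ring.
  have := ln_neq xp; rewrite lt_eqF// => /(_ isT).
  set w := ln x - ln x0 => w0.
  by rewrite mulrN sinN; field; rewrite w0 !gt_eqF.
have dg x : xl < x < x0 -> is_derive x 1 (fun x => x0 ^+ 2 / x) (- (x0 ^+ 2 / x ^+ 2)).
  move=> /andP[h1 h2]; have xp : 0 < x by exact: lt_trans h1.
  by drve; [rewrite gt_eqF|field; rewrite gt_eqF].
have cg' x : xl < x < x0 -> {for x, continuous (fun x : R => - (x0 ^+ 2 / x ^+ 2))}.
  move=> /andP[h1 h2]; have xp : 0 < x by exact: lt_trans h1.
  apply: cvgN; apply: cvgMr; apply: cvgV; first by rewrite expf_neq0// gt_eqF.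
  exact: exprn_continuous.
have g'0 x : xl < x < x0 -> - (x0 ^+ 2 / x ^+ 2) < 0.
  by move=> /andP[h1 h2]; rewrite oppr_lt0 divr_gt0// ?exprn_gt0//; exact: lt_trans h1.
have ga : x0 ^+ 2 / x @[x --> xl^'+] --> xr.
  rewrite (_ : xr = x0 ^+ 2 / xl); last first.
    by rewrite /xr /xl expRN; field; rewrite !gt_eqF// expR_gt0.
  by apply: cvg_at_right_filter; apply: cvgMr; apply: cvgV; [rewrite gt_eqF|exact: cvg_id].
have gb : x0 ^+ 2 / x @[x --> x0^'-] --> x0.
  rewrite [X in _ --> X](_ : x0 = x0 ^+ 2 / x0); last by field; rewrite gt_eqF.
  by apply: cvg_at_left_filter; apply: cvgMr; apply: cvgV; [rewrite gt_eqF|exact: cvg_id].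
have cG (y : R) : x0 < y < xr -> {for y, continuous (k T)}.
  by move=> /andP[y0 _]; apply: k_cont; [exact: lt_trans y0|by rewrite gt_eqF].
have [|i h] := substitution_oo xlx0 dg cg' g'0 ga gb cG.
  by apply: eq_integrable ki => // x /kE /= ->.
by split => //; rewrite h; apply: eq_Rintegral => x /kE.
Qed.

End half_dirichlet.

(** With [x = exp(- y)] this is the Laplace transform of the cosine at [1]. Its integral over [t] is
    an arctangent, whose limit supplies the [pi / 2] of Dirichlet's integral. *)
Lemma integral_cos_ln (t : R) : \int[mu]_(x in `]0, 1[) cos (t * ln x) = (1 + t ^+ 2)^-1.
Proof.
(* The real part of [x ^ (1 + i t) / (1 + i t)]. *)
pose P x := x * (cos (t * ln x) + t * sin (t * ln x)) / (1 + t ^+ 2).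
have t0 : 1 + t ^+ 2 != 0 by rewrite gt_eqF// ltr_pwDl// sqr_ge0.
have ci x : 0 < x < 1 -> {for x, continuous (fun x => cos (t * ln x))}.
  by move=> /andP[? ?]; drvc.
have ic : mu.-integrable `]0, 1[ (EFin \o (fun x => cos (t * ln x))).
  by apply: (@bounded_cont_integrable _ _ _ 1) => // x _; exact: cos_max.
have dP (x : R) : 0 < x < 1 -> is_derive x 1 P (cos (t * ln x)).
  by move=> /andP[x0 _]; rewrite /P; drve => //; field; rewrite t0 gt_eqF.
have P0 : P x @[x --> 0^'+] --> 0.
  pose M := (1 + `|t|) / (1 + t ^+ 2).
  have M0 : 0 <= M by rewrite divr_ge0// addr_ge0// sqr_ge0.
  have hM : x * M @[x --> 0^'+] --> 0.
    rewrite -[X in _ --> X](mul0r M); apply: cvgMl.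
    by apply: cvg_at_right_filter; exact: cvg_id.
  apply: squeeze_norm0 hM; near=> x; rewrite /P -mulrA normrM.
  have x0 : 0 <= x by near: x; exact: nbhs_right_ge.
  rewrite ger0_norm// ler_wpM2l// normrM /M.
  rewrite [`|(1 + _)^-1|]ger0_norm ?invr_ge0 ?addr_ge0 ?sqr_ge0//.
  rewrite ler_wpM2r ?invr_ge0 ?addr_ge0 ?sqr_ge0//.
  by rewrite (le_trans (ler_normD _ _))// lerD ?cos_max// normrM ler_piMr// sin_max.
have P1 : P x @[x --> 1^'-] --> (1 + t ^+ 2)^-1.
  apply: cvg_at_left_filter; rewrite (_ : _^-1 = P 1); last first.
    by rewrite /P ln1 mulr0 cos0 sin0; field.
  have cP : {for 1, continuous P} by rewrite /P; drvc.
  exact: cP.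
by rewrite (FTC_oo ltr01 ic dP ci P0 P1) subr0.
Unshelve. all: end_near. Qed.

(* On ]0, 1[ the integral of [sin (T * ln x) / ln x] is exactly [atan T]; what
   remains is handled by the Riemann-Lebesgue lemma. *)
Lemma half_dirichlet_cvg (eta : R) : 0 < eta ->
  half_dirichlet eta T @[T --> +oo] --> pi / 2.
Proof.
move=> eta0.
pose a := expR (- eta) : R.
have a0 : 0 < a by exact: expR_gt0.
have a1 : a < 1 by rewrite expR_lt1 oppr_lt0.
have ic1 : mu.-integrable `]0, 1[ (EFin \o (fun=> 1 : R)).
  by apply: (@bounded_cont_integrable _ _ _ 1) => x _; [exact: cvg_cst|rewrite normr1].
have cln (x : R) : 0 < x < 1 -> {for x, continuous (@ln R)}.
  by move=> /andP[x0 _]; exact: continuous_ln.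
have ln0 (x : R) : 0 < x < 1 -> ln x < 0 by move=> ?; exact: ln_lt0.
pose S T x := sin (T * ln x) / ln x : R.
(* [S T x] is half of [dirichlet T (ln x)]. After exchanging the integrals, half of the integral of
   [1 / (1 + t ^ 2)] over [[- T, T]] remains. *)
have SE T : 0 <= T -> mu.-integrable `]0, 1[ (EFin \o S T) /\
    \int[mu]_(x in `]0, 1[) S T x = atan T.
  move=> T0; have eS : {in `]0, 1[%classic, (fun x => 1 / 2 * (1 * dirichlet T (ln x))) =1 S T}.
    move=> x; rewrite inE/= in_itv/= => /ln0 lx.
    by rewrite mul1r dirichletE ?lt_eqF// /S; field; rewrite lt_eqF.
  have i1 := integrable_fubini_fst T ic1 cln (@continuous_cos R) (@cos_max R).
  split; first by apply: eq_integrable (integrable_mulr (1 / 2) _ i1) => // x xD /=; rewrite -eS.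
  transitivity (\int[mu]_(x in `]0, 1[) (1 / 2 * (1 * dirichlet T (ln x)))).
    by apply/esym; exact: eq_Rintegral.
  rewrite RintegralZl// -Rintegral_fubini//; [|exact: continuous_cos|exact: cos_max].
  under eq_Rintegral do (under eq_Rintegral do rewrite mul1r).
  under eq_Rintegral do rewrite integral_cos_ln.
  have TT : - T <= T by rewrite ge0_cp.
  have dF (t : R) : - T <= t <= T -> is_derive t 1 (@atan R) (1 + t ^+ 2)^-1.
    by move=> _; exact: is_derive1_atan.
  rewrite (FTC_seg TT dF).
    by rewrite atanN; field.
  move=> t _; apply: cvgV; first by rewrite gt_eqF// ltr_pwDl// sqr_ge0.
  by apply: cvgD; [exact: cvg_cst|exact: exprn_continuous].
have RL1 : \int[mu]_(x in `]0, a[) S T x @[T --> +oo] --> 0.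
  have -> : (fun T => \int[mu]_(x in `]0, a[) S T x) =
      (fun T => \int[mu]_(x in `]0, a[) ((ln x)^-1 * sin (T * (ln x - 0)))).
    by apply/funext => t; apply: eq_Rintegral => x _; rewrite subr0 mulrC.
  have c1 (x : R) : 0 < x < a -> {for x, continuous (fun x => (ln x)^-1)}.
    move=> /andP[x0 xa]; drvc => //.
    by rewrite lt_eqF// ln0// x0 (lt_trans xa).
  apply: riemann_lebesgue_ln => //.
  apply: (@bounded_cont_integrable _ _ _ eta^-1) => // x /andP[x0 xa].
  have h : ln x < - eta by rewrite -[ltRHS](@expRK R) ltr_ln ?posrE.
  have h0 : ln x < 0 by apply: lt_trans h _; rewrite oppr_lt0.
  rewrite normfV lef_pV2 ?posrE ?normr_gt0 ?lt_eqF//.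
  by rewrite ltr0_norm// lerNr ltW.
(* The half Dirichlet integral carries [dx / x] where [S] carries [dx]; the difference has the
   factor [(x^-1 - 1) / ln x], which stays bounded up to [x = 1]. *)
have RL2 : \int[mu]_(x in `]a, 1[) ((x^-1 - 1) / ln x * sin (T * (ln x - 0))) @[T --> +oo] --> 0.
  have c1 (x : R) : a < x < 1 -> {for x, continuous (fun x : R => (x^-1 - 1) / ln x)}.
    move=> /andP[xa x1]; have x0 : 0 < x by exact: lt_trans xa.
    drvc => //; first by rewrite lt_eqF// ln0// x0.
    by rewrite gt_eqF.
  apply: riemann_lebesgue_ln => //; first exact: ltW.
  apply: (@bounded_cont_integrable _ _ _ a^-1) => // x /andP[xa x1].
  have x0 : 0 < x by exact: lt_trans xa.
  have lx : ln x < 0 by rewrite ln0// x0.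
  have h := ln_le_subr1 x0.
  rewrite normrM normfV ler_pdivrMr ?normr_gt0 ?lt_eqF// (ltr0_norm lx).
  have -> : x^-1 - 1 = x^-1 * (1 - x) by field; rewrite gt_eqF.
  rewrite normrM gtr0_norm ?invr_gt0// gtr0_norm ?subr_gt0//; apply: ler_pM.
  - by rewrite invr_ge0 ltW.
  - by rewrite subr_ge0 ltW.
  - by rewrite lef_pV2 ?posrE// ltW.
  - lra.
have hE T : 0 <= T -> half_dirichlet eta T = atan T - \int[mu]_(x in `]0, a[) S T x
    + \int[mu]_(x in `]a, 1[) ((x^-1 - 1) / ln x * sin (T * (ln x - 0))).
  move=> T0; have [iS <-] := SE T T0.
  have h01 : 0 < a < 1 by rewrite a0.
  rewrite (Rint_split_oo h01 iS) [X in _ = X - _ + _]addrC addrK.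
  have iS' : mu.-integrable `]a, 1[ (EFin \o S T).
    by apply: integrable_sub_oo iS => //; exact: ltW.
  have [] := kernel_left ltr01 eta0 T; rewrite mul1r -/a => ik <-.
  have ek : {in `]a, 1[%classic, (fun x => S T x + (x^-1 - 1) / ln x * sin (T * (ln x - 0))) =1
     (fun x => sin (T * (ln x - ln 1)) / (ln x - ln 1) / x)}.
    move=> x; rewrite inE/= in_itv/= => /andP[xa x1]; have x0 : 0 < x by exact: lt_trans xa.
    have lx : ln x != 0 by rewrite lt_eqF// ln0// x0.
    by rewrite ln1 !subr0 /S; field; rewrite lx gt_eqF.
  rewrite -RintegralD//; first by apply/esym; exact: eq_Rintegral.
  have id := integrable_subr _ ik iS'.
  by apply: eq_integrable (id _) => // x /ek /= <-; rewrite addrC addKr.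
apply: (@cvg_trans _ ((atan T - \int[mu]_(x in `]0, a[) S T x
    + \int[mu]_(x in `]a, 1[) ((x^-1 - 1) / ln x * sin (T * (ln x - 0)))) @[T --> +oo])).
  by apply: near_eq_cvg; near=> T; rewrite hE.
rewrite (_ : pi / 2 = pi / 2 - 0 + 0 :> R); last by rewrite subr0 addr0.
by apply: cvgD => //; apply: cvgB => //; exact: cvgy_atan.
Unshelve. all: end_near. Qed.

(** From [ln t <= t - 1] at [t = x / y]. It lets a slope bound in [x] control a quotient by a
    difference of logarithms. *)
Lemma ln_lipschitz (x y : R) : 0 < x -> 0 < y -> `|x - y| <= (x + y) * `|ln x - ln y|.
Proof.
wlog xy : x y / x <= y.
  move=> H x0 y0; have [xy|/ltW yx] := leP x y; first exact: H.
  by rewrite distrC [x + y]addrC [`|ln x - _|]distrC; apply: H.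
move=> x0 y0; rewrite ler0_norm ?subr_le0// ler0_norm ?subr_le0 ?ler_ln ?posrE// opprB opprB.
have h : ln x - ln y <= x / y - 1.
  by rewrite -ln_div ?posrE//; apply: ln_le_subr1; rewrite divr_gt0.
have h2 : 1 - x / y <= ln y - ln x by lra.
apply: (@le_trans _ _ ((x + y) * (1 - x / y))); last by rewrite ler_wpM2l// addr_ge0// ltW.
rewrite -subr_ge0 (_ : _ - _ = x * (y - x) / y); last by field; rewrite gt_eqF.
by rewrite divr_ge0 ?mulr_ge0 ?subr_ge0// ltW.
Qed.

Section mellin_kernel_cvg.
Variables (k : R -> R) (c x0 : R).
Hypotheses (ck : forall x, 0 < x < c -> {for x, continuous k})
  (ki : mu.-integrable `]0, c[ (EFin \o (fun x => k x / x)))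
  (x0c : 0 < x0 < c) (dk : derivable k x0 1).

Let u x := ln x - ln x0.
Let phi T x := k x / x * dirichlet T (u x).

Let x00 : 0 < x0. Proof. by have /andP[] := x0c. Qed.

Let cu (x : R) : 0 < x < c -> {for x, continuous u}.
Proof. by move=> /andP[xp _]; rewrite /u; drvc. Qed.

Let u_neq0 (x : R) : 0 < x -> x != x0 -> u x != 0.
Proof. by move=> xp; apply: contra; rewrite subr_eq0 => /eqP/ln_inj ->//; rewrite posrE. Qed.

Let ckx (x : R) : 0 < x < c -> {for x, continuous (fun x => k x / x)}.
Proof.
move=> xc; apply: cvgM; first exact: ck.
by apply: cvgV; [case/andP: xc => x_gt0 _; rewrite gt_eqF|exact: cvg_id].
Qed.

Let phi_int T : mu.-integrable `]0, c[ (EFin \o phi T).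
Proof. by apply: integrable_fubini_fst => //; [exact: continuous_cos|exact: cos_max]. Qed.

(** Away from [x0] the factor [1 / u x] of the closed form is bounded by [1 / d], so the
    Riemann-Lebesgue lemma applies to [k x / x / u x]. *)
Let kernel_far (a b : R) (d : R) : 0 <= a -> a < b -> b <= c -> 0 < d ->
  (forall x, a < x < b -> d <= `|u x|) ->
  \int[mu]_(x in `]a, b[) phi T x @[T --> +oo] --> 0.
Proof.
move=> a0 ab bc d0 du.
have sub x : a < x < b -> 0 < x < c.
  by move=> /andP[h1 h2]; rewrite (le_lt_trans a0 h1) (lt_le_trans h2).
have un0 x : a < x < b -> u x != 0.
  by move=> /du h; rewrite -normr_gt0; exact: lt_le_trans h.
pose f x := k x / x / u x.
have cf x : a < x < b -> {for x, continuous f}.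
  move=> xab; apply: cvgM; first exact/ckx/sub.
  by apply: cvgV; [exact: un0|apply/cu/sub].
have fi : mu.-integrable `]a, b[ (EFin \o f).
  apply: (cont_dominated_integrable (F := fun x => d^-1 * `|k x / x|)) => //.
    move=> x xab; rewrite /f normrM mulrC normfV; apply: ler_wpM2r => //.
    by rewrite lef_pV2 ?posrE//; [exact: du|exact: lt_le_trans (du _ xab)].
  apply: integrable_mulr; first exact: measurable_itv.
  apply: integrable_norm; apply: integrableS ki; [exact: measurable_itv|exact: measurable_itv|].
  by move=> z /=; rewrite !in_itv/=; exact: sub.
have RL := riemann_lebesgue_ln (ln x0) a0 ab cf fi.
have L : 2 * \int[mu]_(x in `]a, b[) (f x * sin (T * (ln x - ln x0))) @[T --> +oo] --> (2 * 0 : R).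
  exact: cvgMr.
rewrite mulr0 in L; apply: cvg_trans L; apply: near_eq_cvg; near=> T.
have T0 : 0 <= T by near: T; apply: nbhs_pinfty_ge; rewrite num_real.
have i : mu.-integrable `]a, b[ (EFin \o (fun x => f x * sin (T * (ln x - ln x0)))).
  apply: (cont_dominated_integrable (F := fun x => `|f x|)).
  - move=> x xab; apply: cvgM; first exact: cf.
    by apply: sin_ln_cont; have /andP[] := sub _ xab.
  - by move=> x _; rewrite normrM ler_piMr// sin_max.
  - exact: integrable_norm.
rewrite -RintegralZl//; apply: eq_Rintegral => x; rewrite inE/= in_itv/= => xab.
rewrite /phi dirichletE//; last exact: un0.
by rewrite /f /u; have := un0 _ xab; rewrite /u => h; field; rewrite h gt_eqF//; have /andP[] := sub _ xab.
Unshelve. all: end_near. Qed.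

(** After subtraction of [k x0], the quotient by [u x] is bounded thanks to [ln_lipschitz] and
    disappears by Riemann-Lebesgue; the constant [k x0] meets twice the half Dirichlet integral. The
    last hypothesis is the form in which [kernel_left] and [kernel_right] both fit. *)
Let kernel_near (a b eta M : R) : 0 < a -> a < b -> b <= c -> 0 < eta ->
  (forall x, a < x < b -> x != x0 /\ `|k x - k x0| <= M * `|x - x0|) ->
  (forall T, mu.-integrable `]a, b[ (EFin \o (fun x => sin (T * u x) / u x / x)) /\
    \int[mu]_(x in `]a, b[) (sin (T * u x) / u x / x) = half_dirichlet eta T) ->
  \int[mu]_(x in `]a, b[) phi T x @[T --> +oo] --> pi * k x0.
Proof.
move=> a0 ab bc eta0 kM kE.
have sub x : a < x < b -> 0 < x < c.
  by move=> /andP[h1 h2]; rewrite (lt_trans a0 h1) (lt_le_trans h2).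
have un0 x : a < x < b -> u x != 0.
  by move=> xab; apply: u_neq0; [case/andP: (sub _ xab)|case: (kM _ xab)].
pose f x := (k x - k x0) / x / u x.
have cf x : a < x < b -> {for x, continuous f}.
  move=> xab; apply: cvgM; last by apply: cvgV; [exact: un0|apply/cu/sub].
  apply: cvgM; first by apply: cvgB; [exact/ck/sub|exact: cvg_cst].
  by apply: cvgV; [case/andP: (sub _ xab) => x_gt0 _; rewrite gt_eqF|exact: cvg_id].
have fi : mu.-integrable `]a, b[ (EFin \o f).
  apply: (@bounded_cont_integrable _ _ _ (`|M| * (1 + x0 / a))) => // x xab.
  have /andP[xp _] := sub _ xab; have [xx0 kx] := kM _ xab.
  rewrite /f !normrM !normfV ler_pdivrMr ?normr_gt0 ?un0//.
  rewrite ler_pdivrMr ?normr_gt0 ?gt_eqF//.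
  apply: le_trans kx _; apply: (@le_trans _ _ (`|M| * `|x - x0|)).
    by rewrite ler_wpM2r// ler_norm.
  rewrite -!mulrA ler_wpM2l//; apply: le_trans (ln_lipschitz xp x00) _.
  rewrite (gtr0_norm xp) -/(u x) [`|u x| * x]mulrC mulrA ler_wpM2r//.
  rewrite mulrDl mul1r lerD2l mulrAC ler_pdivlMr// ler_pM2l//.
  by case/andP: xab => /ltW.
have RL := riemann_lebesgue_ln (ln x0) (ltW a0) ab cf fi.
have L : 2 * \int[mu]_(x in `]a, b[) (f x * sin (T * u x)) + 2 * k x0 * half_dirichlet eta T @[T --> +oo] -->
    2 * 0 + 2 * k x0 * (pi / 2).
  by apply: cvgD; [exact: cvgMr|apply: cvgMr; exact: half_dirichlet_cvg].
rewrite (_ : pi * k x0 = 2 * 0 + 2 * k x0 * (pi / 2)); last by field.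
apply: cvg_trans L; apply: near_eq_cvg; near=> T.
have T0 : 0 <= T by near: T; apply: nbhs_pinfty_ge; rewrite num_real.
have [i2 <-] := kE T.
have i : mu.-integrable `]a, b[ (EFin \o (fun x => f x * sin (T * u x))).
  apply: (cont_dominated_integrable (F := fun x => `|f x|)).
  - move=> x xab; apply: cvgM; first exact: cf.
    by apply: sin_ln_cont; have /andP[] := sub _ xab.
  - by move=> x _; rewrite normrM ler_piMr// sin_max.
  - exact: integrable_norm.
rewrite -RintegralZl// -RintegralZl// -RintegralD//; [|exact: integrable_mulr|exact: integrable_mulr].
apply: eq_Rintegral => x; rewrite inE/= in_itv/= => xab.
rewrite /phi dirichletE//; last exact: un0.
by rewrite /f; have := un0 _ xab => h; field; rewrite h gt_eqF//; have /andP[] := sub _ xab.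
Unshelve. all: end_near. Qed.

(** Dini's criterion, with differentiability at [x0] bounding the slopes of [k]. Each one-sided
    neighbourhood of [x0] contributes [pi * k x0], and the far parts vanish. *)
Lemma mellin_kernel_cvg :
  \int[mu]_(x in `]0, c[) (k x / x * dirichlet T (ln x - ln x0)) @[T --> +oo] --> 2 * pi * k x0.
Proof.
have [g [kg cg _]] : exists g : R -> R, [/\ forall z, k z - k x0 = g z * (z - x0),
    {for x0, continuous g} & g x0 = 'D_1 k x0].
  by apply/is_derive1_caratheodory; exact: derivableP.
pose M := `|g x0| + 1.
have [r r0 rM] : exists2 r : R, 0 < r & forall z, `|x0 - z| < r -> `|g z| <= M.
  have /cvgrPdist_lt/(_ 1 ltr01)[r /= r0 rM] := cg; exists r => // z /rM h.
  rewrite /M -[g z](subrKC (g x0)) addrC (le_trans (ler_normD _ _))// addrC lerD2l.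
  by rewrite distrC ltW.
have [x0p x0c'] := andP x0c.
have [eta [eta0 h1 h2 h3]] : exists eta : R, [/\ 0 < eta, x0 * expR eta < x0 + r,
    x0 - r < x0 * expR (- eta) & x0 * expR eta < c].
  have c1 : x0 * expR e @[e --> 0^'+] --> x0.
    rewrite -[X in _ --> X]mulr1 -expR0; apply: cvgMr; apply: cvg_at_right_filter.
    exact: continuous_expR.
  have c2 : x0 * expR (- e) @[e --> 0^'+] --> x0.
    have c2' : {for 0, continuous (fun e => x0 * expR (- e))} by drvc.
    by have := cvg_at_right_filter c2'; rewrite oppr0 expR0 mulr1.
  near (0:R)^'+ => eta; exists eta; split; first by near: eta; exact: nbhs_right_gt.
  - by near: eta; apply: (cvgr_lt _ c1); rewrite ltrDl.
  - by near: eta; apply: (cvgr_gt _ c2); rewrite ltrBlDr ltrDl.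
  - by near: eta; exact: (cvgr_lt _ c1).
pose xl := x0 * expR (- eta); pose xr := x0 * expR eta.
have xl0 : 0 < xl by rewrite mulr_gt0// expR_gt0.
have xlx0 : xl < x0 by rewrite /xl gtr_pMr// expR_lt1 oppr_lt0.
have xrx0 : x0 < xr by rewrite /xr ltr_pMr// expR_gt1.
have kM z : `|x0 - z| < r -> `|k z - k x0| <= M * `|z - x0|.
  by move=> /rM h; rewrite kg normrM ler_wpM2r.
have L1 : \int[mu]_(x in `]0, xl[) phi T x @[T --> +oo] --> 0.
  apply: (kernel_far (d := eta)) => //; first by rewrite ltW// (lt_trans xlx0).
  move=> x /andP[xp xxl]; have : u x < - eta.
    rewrite /u ltrBlDl -[- eta]expRK -lnM ?posrE ?expR_gt0// ltr_ln ?posrE//.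
  by move=> h; rewrite ltr0_norm; [rewrite lerNr ltW|rewrite (lt_trans h)// oppr_lt0].
have L4 : \int[mu]_(x in `]xr, c[) phi T x @[T --> +oo] --> 0.
  apply: (kernel_far (d := eta)) => //; first by rewrite ltW// (lt_trans x0p).
  move=> x /andP[xxr xc]; have : eta < u x.
    rewrite /u ltrBrDl -[eta]expRK -lnM ?posrE ?expR_gt0// ltr_ln ?posrE//.
      by rewrite mulr_gt0// expR_gt0.
    by rewrite (lt_trans _ xxr)// (lt_trans x0p).
  by move=> h; rewrite gtr0_norm ?(ltW h)// (lt_trans eta0).
have L2 : \int[mu]_(x in `]xl, x0[) phi T x @[T --> +oo] --> pi * k x0.
  apply: (kernel_near (eta := eta) (M := M)) => //; first exact: ltW.
    move=> x /andP[h4 h5]; split; first by rewrite lt_eqF.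
    apply: kM; rewrite gtr0_norm ?subr_gt0//.
    by move: h2; rewrite -/xl; lra.
  by move=> T; exact: kernel_left.
have L3 : \int[mu]_(x in `]x0, xr[) phi T x @[T --> +oo] --> pi * k x0.
  apply: (kernel_near (eta := eta) (M := M)) => //; first exact: ltW.
    move=> x /andP[h4 h5]; split; first by rewrite gt_eqF.
    apply: kM; rewrite ltr0_norm ?subr_lt0//.
    by move: h1; rewrite -/xr; lra.
  by move=> T; exact: kernel_right.
have iS (a b : R) T : 0 <= a -> b <= c -> mu.-integrable `]a, b[ (EFin \o phi T).
  by move=> a0 bc; exact: integrable_sub_oo (phi_int T).
have -> : (fun T => \int[mu]_(x in `]0, c[) (k x / x * dirichlet T (ln x - ln x0))) =
  (fun T => (\int[mu]_(x in `]0, xl[) phi T x + \int[mu]_(x in `]xl, x0[) phi T x) +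
    (\int[mu]_(x in `]x0, xr[) phi T x + \int[mu]_(x in `]xr, c[) phi T x)).
  apply/funext => T.
  rewrite -/(phi T) (Rint_split_oo x0c (phi_int T)).
  rewrite (@Rint_split_oo _ _ 0 x0 xl) ?xl0//; last by apply: iS => //; exact: ltW.
  rewrite (@Rint_split_oo _ _ x0 c xr) ?xrx0//.
  by apply: iS => //; exact: ltW.
rewrite (_ : 2 * pi * k x0 = (0 + pi * k x0) + (pi * k x0 + 0)); last by ring.
by apply: cvgD; apply: cvgD.
Unshelve. all: end_near. Qed.

End mellin_kernel_cvg.

End mellin_kernel.

(** * The curve and its contiguity relations *)

Section curve.
Context {R : realType}.
Variable p : R.
Hypothesis p1 : 1 < p.
Implicit Types (x r s : R).

Let q := p - 1.
Let e := pi / p : R.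

Let p0 : 0 < p. Proof. exact: lt_trans ltr01 p1. Qed.
Let q0 : 0 < q. Proof. by rewrite subr_gt0. Qed.
Let pe : p * e = pi. Proof. by rewrite /e mulrC divfK// gt_eqF. Qed.
Let e0 : 0 < e. Proof. by rewrite divr_gt0// pi_gt0. Qed.
Let epi : e < pi. Proof. by rewrite ltr_pdivrMr// ltr_pMr// pi_gt0. Qed.
Let qe : q * e < pi. Proof. by rewrite -pe ltr_pM2r// /q ltrBlDr ltrDl. Qed.

Lemma sin_gt0_lt_pi (y : R) : 0 < y -> y < pi -> 0 < sin y.
Proof. by move=> h1 h2; apply: sin_gt0_pi; rewrite h1. Qed.

Lemma curve_sin_gt0 x : 0 < x < e -> [/\ 0 < sin x, 0 < sin (p * x) & 0 < sin (q * x)].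
Proof.
move=> /andP[x0 xe]; split; apply: sin_gt0_lt_pi; rewrite ?mulr_gt0//.
- exact: lt_trans epi.
- by rewrite -pe ltr_pM2l.
- by apply: lt_trans qe; rewrite ltr_pM2l.
Qed.

(* [expR (theta x)] is the point of ]0, c(p)[ with parameter [x], that is
   [sin (p x) ^ p / (sin x * sin (q x) ^ q)], and [expR (lnA x)] is
   [sin (p x) / sin (q x)]. Up to a factor [pi], the measure [V(y) dy] is
   [omega r x dx] transported by [expR \o theta]. *)
Definition lnA x := ln (sin (p * x)) - ln (sin (q * x)).
Definition theta x := p * ln (sin (p * x)) - ln (sin x) - q * ln (sin (q * x)).
(** For [B = exp(lnA x + i x)] one has [B - 1 = sin x / sin (q x) * exp(i p x)], whose logarithm has
    derivative [cotdiff x + i p]. Hence [omega r x] is the imaginary part of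
    [B ^ r * B' / (B - 1)]. *)
Definition cotdiff x := cos x / sin x - q * (cos (q * x) / sin (q * x)).
Definition dlnA x := p * (cos (p * x) / sin (p * x)) - q * (cos (q * x) / sin (q * x)).
Definition dtheta x := p ^+ 2 * (cos (p * x) / sin (p * x)) - cos x / sin x
  - q ^+ 2 * (cos (q * x) / sin (q * x)).
Definition omega r x := expR (r * lnA x) * (p * cos (r * x) + cotdiff x * sin (r * x)).
(** The imaginary part of [B ^ r], the function differentiated to obtain the recurrence. *)
Definition Fcurve r x := expR (r * lnA x) * sin (r * x).

Lemma is_derive_lnA x : 0 < x < e -> is_derive x 1 lnA (dlnA x).
Proof.
move=> /curve_sin_gt0[h1 h2 h3]; rewrite /lnA; drve => //.
by rewrite /dlnA; field; rewrite !gt_eqF.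
Qed.

Lemma is_derive_theta x : 0 < x < e -> is_derive x 1 theta (dtheta x).
Proof.
move=> /curve_sin_gt0[h1 h2 h3]; rewrite /theta; drve => //.
by rewrite /dtheta; field; rewrite !gt_eqF.
Qed.

Lemma is_derive_Fcurve r x : 0 < x < e ->
  is_derive x 1 (Fcurve r) (r * expR (r * lnA x) * (dlnA x * sin (r * x) + cos (r * x))).
Proof.
move=> xe; have h := is_derive_lnA xe; rewrite /Fcurve.
by drve; [exact: h|ring].
Qed.

Lemma expR_lnA x : 0 < x < e -> expR (lnA x) = sin (p * x) / sin (q * x).
Proof. by move=> /curve_sin_gt0[h1 h2 h3]; rewrite /lnA expRB !lnK. Qed.

Let trig x : [/\ sin (p * x) = sin x * cos (q * x) + cos x * sin (q * x),
  cos (p * x) = cos x * cos (q * x) - sin x * sin (q * x),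
  cos x ^+ 2 = 1 - sin x ^+ 2 & cos (q * x) ^+ 2 = 1 - sin (q * x) ^+ 2].
Proof.
have -> : p * x = x + q * x by rewrite /q; ring.
by split; [exact: sinD|exact: cosD|exact: cos2sin2|exact: cos2sin2].
Qed.

(** The imaginary part of [B' = (B - 1) (cotdiff x + i p)] divided by [exp(i x)]; [dlnA_expR_lnA] is
    the real part. *)
Lemma expR_lnA_cotdiff x : 0 < x < e -> q * expR (lnA x) = p * cos x - cotdiff x * sin x.
Proof.
move=> xe; have [h1 h2 h3] := curve_sin_gt0 xe; rewrite expR_lnA// /cotdiff.
have [-> _ _ _] := trig x; have -> : p = q + 1 by rewrite /q subrK.
by field; rewrite !gt_eqF.
Qed.

(** [p ^ 2 + cotdiff x ^ 2] is the squared modulus of [B' / (B - 1)]; in this form the sign of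
    [dtheta] is visible. *)
Lemma dthetaE x : 0 < x < e ->
  dtheta x = - ((p ^+ 2 + cotdiff x ^+ 2) * sin x * sin (q * x) / sin (p * x)).
Proof.
move=> xe; have [h1 h2 h3] := curve_sin_gt0 xe; rewrite /dtheta /cotdiff.
move: h2; have [-> -> c1 c2] := trig x; have -> : p = q + 1 by rewrite /q subrK.
by move=> h2; field; rewrite !gt_eqF.
Qed.

Lemma dtheta_expR_lnA x : 0 < x < e ->
  dtheta x * expR (lnA x) = - ((p ^+ 2 + cotdiff x ^+ 2) * sin x).
Proof.
move=> xe; have [h1 h2 h3] := curve_sin_gt0 xe.
by rewrite dthetaE// expR_lnA//; field; rewrite !gt_eqF.
Qed.

Lemma dlnA_expR_lnA x : 0 < x < e ->
  dlnA x * expR (lnA x) = expR (lnA x) * cotdiff x - p * sin x - cotdiff x * cos x.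
Proof.
move=> xe; have [h1 h2 h3] := curve_sin_gt0 xe; rewrite expR_lnA// /dlnA /cotdiff.
move: h2; have [-> -> c1 c2] := trig x; have -> : p = q + 1 by rewrite /q subrK.
by move=> h2; field; rewrite !gt_eqF.
Qed.

(** Together with [expR_lnA_sin], the real and imaginary parts of [B - 1]. *)
Lemma expR_lnA_cos x : 0 < x < e ->
  sin x / sin (q * x) * cos (p * x) = expR (lnA x) * cos x - 1.
Proof.
move=> xe; have [h1 h2 h3] := curve_sin_gt0 xe; rewrite expR_lnA//.
have [-> -> c1 c2] := trig x.
rewrite (_ : _ - 1 = sin x / sin (q * x) * (cos x * cos (q * x)) + cos x ^+ 2 - 1); last first.
  by field; rewrite gt_eqF.
by rewrite c1; field; rewrite gt_eqF.
Qed.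

Lemma expR_lnA_sin x : 0 < x < e ->
  sin x / sin (q * x) * sin (p * x) = expR (lnA x) * sin x.
Proof. by move=> xe; rewrite expR_lnA//; ring. Qed.

Let trigS s x : [/\ cos ((s - 1) * x) = cos (s * x) * cos x + sin (s * x) * sin x &
  sin ((s - 1) * x) = sin (s * x) * cos x - cos (s * x) * sin x].
Proof.
have -> : (s - 1) * x = s * x - x by ring.
by rewrite cosB sinB.
Qed.

Let expS s x : expR (s * lnA x) = expR ((s - 1) * lnA x) * expR (lnA x).
Proof. by rewrite -expRD; congr expR; ring. Qed.

(** [theta] is the logarithm of [B ^ p / (B - 1)] and is real, so [dtheta x * B ^ s] is
    [p B ^ (s - 1) B' - B ^ s B' / (B - 1)]. Take imaginary parts, splitting the first term as in
    [omega_dF]. *)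
Lemma omega_dtheta s x : 0 < x < e ->
  dtheta x * Fcurve s x = q * omega s x - p * omega (s - 1) x.
Proof.
move=> xe; rewrite /Fcurve /omega expS; have [-> ->] := trigS s x.
have A1 := expR_lnA_cotdiff xe; have A2 := dtheta_expR_lnA xe.
rewrite (_ : dtheta x * _ = expR ((s - 1) * lnA x) * (dtheta x * expR (lnA x)) * sin (s * x)); last by ring.
rewrite (_ : q * _ = expR ((s - 1) * lnA x) * (q * expR (lnA x)) *
   (p * cos (s * x) + cotdiff x * sin (s * x))); last by ring.
by rewrite A1 A2; ring.
Qed.

(** The imaginary part of [B ^ (s - 1) B' = (B ^ s - B ^ (s - 1)) B' / (B - 1)]. *)
Lemma omega_dF s x : 0 < x < e ->
  expR (s * lnA x) * (dlnA x * sin (s * x) + cos (s * x)) = omega s x - omega (s - 1) x.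
Proof.
move=> xe; rewrite /omega expS; have [-> ->] := trigS s x.
have A1 := expR_lnA_cotdiff xe; have A3 := dlnA_expR_lnA xe.
have A1' : expR (lnA x) = p * expR (lnA x) - (p * cos x - cotdiff x * sin x).
  by rewrite -A1 /q; ring.
rewrite (_ : _ * _ * _ = expR ((s - 1) * lnA x) * ((dlnA x * expR (lnA x)) * sin (s * x) +
   expR (lnA x) * cos (s * x))); last by ring.
by rewrite A3 [X in _ + X * cos _]A1'; ring.
Qed.

(** The equation [B ^ p = rho (B - 1)] of the curve, multiplied by [B ^ s B' / (B - 1)]. *)
Lemma omega_shift s x : 0 < x < e ->
  omega (s + p) x = expR (theta x) * (omega (s + 1) x - omega s x).
Proof.
move=> xe; have [h1 h2 h3] := curve_sin_gt0 xe.
have A4 := expR_lnA_cos xe; have A5 := expR_lnA_sin xe.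
have E : expR ((s + p) * lnA x) = expR (theta x) * expR (s * lnA x) * (sin x / sin (q * x)).
  have -> : sin x / sin (q * x) = expR (ln (sin x) - ln (sin (q * x))) by rewrite expRB !lnK.
  rewrite -!expRD; congr expR.
  by rewrite /theta /lnA /q; ring.
have E1 : expR ((s + 1) * lnA x) = expR (s * lnA x) * expR (lnA x).
  by rewrite -expRD; congr expR; ring.
rewrite /omega E E1.
have -> : (s + p) * x = s * x + p * x by ring.
have -> : (s + 1) * x = s * x + x by ring.
rewrite !cosD !sinD.
set B := sin x / _ in A4 A5 *.
transitivity (expR (theta x) * expR (s * lnA x) * (p * (cos (s * x) * (B * cos (p * x))
   - sin (s * x) * (B * sin (p * x))) + cotdiff x * (sin (s * x) * (B * cos (p * x)) +
   cos (s * x) * (B * sin (p * x))))); first by ring.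
by rewrite A4 A5; ring.
Qed.

Lemma dtheta_lt0 x : 0 < x < e -> dtheta x < 0.
Proof.
move=> xe; have [h1 h2 h3] := curve_sin_gt0 xe; rewrite dthetaE// oppr_lt0.
by rewrite divr_gt0// !mulr_gt0// ltr_pwDl ?sqr_ge0// exprn_gt0.
Qed.

Lemma theta_cont x : 0 < x < e -> {for x, continuous theta}.
Proof. by move=> /is_derive_theta; exact: is_derive_cont. Qed.

Lemma lnA_cont x : 0 < x < e -> {for x, continuous lnA}.
Proof. by move=> /is_derive_lnA; exact: is_derive_cont. Qed.

Let cotdiff_cont' x : 0 < sin x -> 0 < sin (q * x) -> {for x, continuous cotdiff}.
Proof. by move=> h1 h3; rewrite /cotdiff; drvc; rewrite gt_eqF. Qed.

Lemma cotdiff_cont x : 0 < x < e -> {for x, continuous cotdiff}.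
Proof. by move=> /curve_sin_gt0[h1 h2 h3]; exact: cotdiff_cont'. Qed.

Lemma sinc_right_cvg (k : R) : sin (k * x) / x @[x --> 0^'+] --> k.
Proof.
have h : is_derive (0 : R) 1 (fun x => sin (k * x)) k.
  by drve; rewrite mulr0 cos0; ring.
have [g [gE gc g0]] := (is_derive1_caratheodory _ _ _).1 h.
rewrite -[X in _ --> X]g0; apply: cvg_trans (cvg_at_right_filter gc); apply: near_eq_cvg.
near=> x; have x0 : 0 < x by near: x; exact: nbhs_right_gt.
by have := gE x; rewrite mulr0 sin0 !subr0 => ->; rewrite mulfK// gt_eqF.
Unshelve. all: end_near. Qed.

Lemma sin_left_cvg : sin (p * x) / (e - x) @[x --> e^'-] --> p.
Proof.
have h : is_derive e 1 (fun x => sin (p * x)) (- p).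
  by drve; rewrite pe cospi; ring.
have [g [gE gc g0]] := (is_derive1_caratheodory _ _ _).1 h.
rewrite -[X in _ --> X](opprK p) -g0.
apply: cvg_trans (cvg_at_left_filter (cvgN gc)); apply: near_eq_cvg.
near=> x; have x0 : x < e by near: x; exact: nbhs_left_lt.
have := gE x; rewrite pe sinpi subr0 => ->.
by rewrite /= -[e - x]opprB invrN mulrN mulfK// lt_eqF// subr_lt0.
Unshelve. all: end_near. Qed.

Let ln_sinc_cvg (k : R) : 0 < k -> ln (sin (k * x) / x) @[x --> 0^'+] --> ln k.
Proof. by move=> k0; apply: (@cvg_comp _ _ _ (fun x => sin (k * x) / x) (@ln R) _ (nbhs k)); [exact: sinc_right_cvg|exact: continuous_ln]. Qed.

Lemma lnA_right_cvg : lnA x @[x --> 0^'+] --> ln p - ln q.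
Proof.
have h : ln (sin (p * x) / x) - ln (sin (q * x) / x) @[x --> 0^'+] --> ln p - ln q.
  by apply: cvgB; exact: ln_sinc_cvg.
apply: cvg_trans h; apply: near_eq_cvg.
near=> x; have xe : 0 < x < e by near: x; exact: near_right_oo.
have [h1 h2 h3] := curve_sin_gt0 xe; have /andP[x0 _] := xe.
by rewrite /lnA !ln_div ?posrE//; ring.
Unshelve. all: end_near. Qed.

Lemma theta_right_cvg : theta x @[x --> 0^'+] --> p * ln p - q * ln q.
Proof.
have h : p * ln (sin (p * x) / x) - ln (sin (1 * x) / x) - q * ln (sin (q * x) / x)
   @[x --> 0^'+] --> p * ln p - ln 1 - q * ln q.
  apply: cvgB; last by apply: cvgMr; exact: ln_sinc_cvg.
  by apply: cvgB; [apply: cvgMr; exact: ln_sinc_cvg|exact: ln_sinc_cvg].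
rewrite ln1 subr0 in h; apply: cvg_trans h; apply: near_eq_cvg.
near=> x; have xe : 0 < x < e by near: x; exact: near_right_oo.
have [h1 h2 h3] := curve_sin_gt0 xe; have /andP[x0 _] := xe.
by rewrite /theta mul1r !ln_div ?posrE// /q; ring.
Unshelve. all: end_near. Qed.

(** The poles of the two cotangents cancel. The numerator [N] over the common denominator
    [sin x * sin (q x)] has derivative [(q ^ 2 - 1) sin y sin (q y)]; both sines increase near [0],
    so the mean value theorem bounds [N x] by [|q ^ 2 - 1| x] times the denominator. *)
Lemma cotdiff_right_cvg : cotdiff x @[x --> 0^'+] --> (0 : R).
Proof.
pose M := `|q ^+ 2 - 1|.
have hM : M * x @[x --> 0^'+] --> 0.
  rewrite -[X in _ --> X](mulr0 M); apply: cvgMr.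
  by apply: cvg_at_right_filter; exact: cvg_id.
apply: squeeze_norm0 hM; near=> x.
have xe : 0 < x < e by near: x; exact: near_right_oo.
have [h1 h2 h3] := curve_sin_gt0 xe; have /andP[x0 _] := xe.
have x2 : x < pi / 2 by near: x; apply: nbhs_right_lt; rewrite divr_gt0// pi_gt0.
have qx2 : q * x < pi / 2.
  rewrite -ltr_pdivlMl//; near: x; apply: nbhs_right_lt.
  by rewrite mulr_gt0 ?invr_gt0// divr_gt0// pi_gt0.
pose N y := cos y * sin (q * y) - q * (cos (q * y) * sin y).
have dN (y : R) : is_derive y 1 N ((q ^+ 2 - 1) * (sin y * sin (q * y))).
  by rewrite /N; drve; ring.
have [|c] := @MVT R N (fun y => (q ^+ 2 - 1) * (sin y * sin (q * y))) 0 x x0.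
- by apply: cont_within => y _; exact: is_derive_cont (dN y).
rewrite in_itv/= => /andP[c0 cx].
rewrite {2}/N mulr0 sin0 !mulr0 subrr !subr0 => NE.
have -> : cotdiff x = N x / (sin x * sin (q * x)).
  by rewrite /cotdiff /N; field; rewrite !gt_eqF.
rewrite normrM normfV ler_pdivrMr ?normr_gt0 ?gt_eqF ?mulr_gt0//.
rewrite NE !normrM (gtr0_norm x0) (gtr0_norm h1) (gtr0_norm h3) -/M -!mulrA.
apply: ler_wpM2l; first exact: normr_ge0.
rewrite mulrA mulrC ler_pM2l//.
have qc : q * c < pi / 2 by apply: lt_trans qx2; rewrite ltr_pM2l.
have pih : 0 < pi / 2 :> R by rewrite divr_gt0// pi_gt0.
have s1 : 0 <= sin c <= sin x.
  rewrite sin_ge0_pi ?(ltW c0)/=; last by move: cx x2 pih; lra.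
  by rewrite ltW// ltr_sin ?in_itv/=//; move: c0 cx x2 pih; lra.
have s2 : 0 <= sin (q * c) <= sin (q * x).
  have qc0 : 0 < q * c by rewrite mulr_gt0.
  have qcx : q * c < q * x by rewrite ltr_pM2l.
  rewrite sin_ge0_pi ?(ltW qc0)/=; last by move: qc pih; lra.
  by rewrite ltW// ltr_sin ?in_itv/=//; move: qc0 qcx qx2 pih; lra.
have [/andP[s10 s11] /andP[s20 s21]] := (s1, s2).
by rewrite !ger0_norm//; exact: ler_pM.
Unshelve. all: end_near. Qed.

Lemma oo_bounded (f : R -> R) (a b l1 l2 : R) : a < b ->
  (forall x, a < x < b -> {for x, continuous f}) ->
  f x @[x --> a^'+] --> l1 -> f x @[x --> b^'-] --> l2 ->
  exists M, forall x, a < x < b -> `|f x| <= M.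
Proof.
move=> ab cf fa fb.
pose m := (a + b) / 2.
have am : a < m by rewrite /m; lra.
have mb : m < b by rewrite /m; lra.
have [u [au um uP]] : exists u, [/\ a < u, u < m & forall x, a < x -> x <= u -> `|f x| <= `|l1| + 1].
  have : \forall x \near a^'+, `|f x| <= `|l1| + 1.
    have /cvgrPdist_le/(_ 1 ltr01) := fa; apply: filterS => x h.
    by rewrite -[f x](subrKC l1) (le_trans (ler_normD _ _))// lerD2l distrC.
  move=> [d /= d0 dP]; exists (Num.min ((a + m) / 2) (a + d / 2)); split.
  - by rewrite lt_min; apply/andP; split; lra.
  - by rewrite gt_min; apply/orP; left; lra.
  - move=> x ax; rewrite le_min => /andP[h1 h2]; apply: dP => //=.
    by rewrite ltr0_norm ?subr_lt0// opprB; lra.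
have [v [vb mv vP]] : exists v, [/\ v < b, m < v & forall x, x < b -> v <= x -> `|f x| <= `|l2| + 1].
  have : \forall x \near b^'-, `|f x| <= `|l2| + 1.
    have /cvgrPdist_le/(_ 1 ltr01) := fb; apply: filterS => x h.
    by rewrite -[f x](subrKC l2) (le_trans (ler_normD _ _))// lerD2l distrC.
  move=> [d /= d0 dP]; exists (Num.max ((b + m) / 2) (b - d / 2)); split.
  - by rewrite gt_max; apply/andP; split; lra.
  - by rewrite lt_max; apply/orP; left; lra.
  - move=> x xb; rewrite ge_max => /andP[h1 h2]; apply: dP => //=.
    by rewrite gtr0_norm ?subr_gt0//; lra.
have uv : u <= v by lra.
have cn : {within `[u, v], continuous (fun x => `|f x|)}.
  apply: cont_within => x /andP[h1 h2]; apply: (@cvg_norm _ _ _ _ _ f); apply: cf.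
  by apply/andP; split; lra.
have [w _ wM] := EVT_max uv cn.
exists (`|l1| + 1 + (`|l2| + 1) + `|f w|) => x /andP[ax xb].
have n1 := normr_ge0 l1; have n2 := normr_ge0 l2; have n3 := normr_ge0 (f w).
have [xu|ux] := leP x u; first by have := uP x ax xu; lra.
have [vx|xv] := leP v x; first by have := vP x xb vx; lra.
have xuv : x \in `[u, v] by rewrite in_itv/= !ltW.
by have := wM x xuv; lra.
Qed.

(** At [x = pi / p] only [sin (p x)] vanishes, to first order, and it carries the exponent
    [p * be + r]; divided by that power of [e - x], the left side has limits at both ends. Hence
    integrability for [p * be + r > -1], and vanishing boundary terms for [p * be + r > 0]. *)
Lemma curve_bound (be r : R) : exists M, forall x, 0 < x < e ->
  expR (be * theta x + r * lnA x) * (p + `|cotdiff x|) <= M * expR ((p * be + r) * ln (e - x)).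
Proof.
pose E x := be * theta x + r * lnA x - (p * be + r) * ln (e - x).
pose f x := expR (E x) * (p + `|cotdiff x|).
have cf x : 0 < x < e -> {for x, continuous f}.
  move=> xe; have /andP[x0 xe'] := xe.
  have cln : {for x, continuous (fun x => (p * be + r) * ln (e - x))}.
    by drvc; rewrite subr_gt0.
  apply: cvgM.
    apply: continuous_comp; last exact: continuous_expR.
    apply: cvgB; first by apply: cvgD; apply: cvgMr; [exact: theta_cont|exact: lnA_cont].
    exact: cln.
  by apply: cvgD; [exact: cvg_cst|apply: (@cvg_norm _ _ _ _ _ cotdiff); exact: cotdiff_cont].
have fa : f x @[x --> 0^'+] --> expR (be * (p * ln p - q * ln q) + r * (ln p - ln q) -
    (p * be + r) * ln (e - 0)) * (p + `|0 : R|).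
  apply: cvgM.
    apply: (continuous_cvg _ (@continuous_expR R _)); apply: cvgB.
      by apply: cvgD; apply: cvgMr; [exact: theta_right_cvg|exact: lnA_right_cvg].
    have cln : {for 0, continuous (fun x => (p * be + r) * ln (e - x))}.
      by drvc; rewrite subr0.
    exact: cvg_at_right_filter cln.
  by apply: cvgD; [exact: cvg_cst|apply: cvg_norm; exact: cotdiff_right_cvg].
have [se sq] : 0 < sin e /\ 0 < sin (q * e).
  by split; apply: sin_gt0_lt_pi => //; rewrite mulr_gt0.
have fb : f x @[x --> e^'-] --> expR ((p * be + r) * ln p - be * ln (sin e) - (q * be + r) * ln (sin (q * e))) *
   (p + `|cotdiff e|).
  apply: cvgM.
    apply: (continuous_cvg _ (@continuous_expR R _)).
    have : (p * be + r) * ln (sin (p * x) / (e - x)) - be * ln (sin x) - (q * be + r) * ln (sin (q * x)) @[x --> e^'-] -->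
       (p * be + r) * ln p - be * ln (sin e) - (q * be + r) * ln (sin (q * e)).
      apply: cvgB.
        apply: cvgB.
          by apply: cvgMr; apply: (@cvg_comp _ _ _ (fun x => sin (p * x) / (e - x)) (@ln R) _ (nbhs p)); [exact: sin_left_cvg|exact: continuous_ln].
        have c1 : {for e, continuous (fun x => be * ln (sin x))} by drvc.
        exact: cvg_at_left_filter c1.
      have c1 : {for e, continuous (fun x => (q * be + r) * ln (sin (q * x)))} by drvc.
      exact: cvg_at_left_filter c1.
    apply: cvg_trans; apply: near_eq_cvg; near=> x; have xe : 0 < x < e by near: x; exact: near_left_oo.
    have [h1 h2 h3] := curve_sin_gt0 xe; have /andP[_ xe'] := xe.
    by rewrite /E ln_div ?posrE ?subr_gt0// /theta /lnA /q; ring.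
  apply: cvgD; [exact: cvg_cst|apply: cvg_norm; apply: cvg_at_left_filter; exact: cotdiff_cont'].
have [M MP] := oo_bounded e0 cf fa fb; exists M => x xe.
have := MP x xe; rewrite /f ger0_norm; last first.
  by rewrite mulr_ge0 ?expR_ge0// addr_ge0// ltW.
by rewrite /E expRB mulrAC ler_pdivrMr ?expR_gt0.
Unshelve. all: end_near. Qed.

End curve.

(** * Laplace's method for exponential weights *)

Section concentration.
Context {R : realType}.
Notation mu := (@lebesgue_measure R).

Lemma expR_ln_cvg0 (eps : R) : 0 < eps -> expR (eps * ln y) @[y --> 0^'+] --> (0 : R).
Proof.
move=> eps0; apply/cvgrPdist_le => d d0; near=> y.
have y0 : 0 < y by near: y; exact: nbhs_right_gt.
rewrite sub0r normrN ger0_norm ?expR_ge0// -[leRHS](lnK d0) ler_expR mulrC -ler_pdivlMr//.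
rewrite -[leRHS]expRK ler_ln ?posrE ?expR_gt0//.
by near: y; apply: nbhs_right_le; exact: expR_gt0.
Unshelve. all: end_near. Qed.

Lemma expR_ln_left_cvg0 (eps a M : R) : 0 < eps -> M * expR (eps * ln (a - x)) @[x --> a^'-] --> (0 : R).
Proof.
move=> eps0; rewrite -[X in _ --> X](mulr0 M); apply: cvgMr.
apply: (@cvg_comp _ _ _ (fun x => a - x) (fun y => expR (eps * ln y)) _ (0^'+)); last exact: expR_ln_cvg0.
move=> A [d /= d0 dA]; exists d => //= x /= xd xa; apply: dA => /=.
  by rewrite sub0r normrN.
by rewrite subr_gt0.
Qed.

Lemma integrable_expR_ln (e eps : R) : 0 < e -> -1 < eps ->
  mu.-integrable `]0, e[ (EFin \o (fun x => expR (eps * ln (e - x)))).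
Proof.
move=> e0 eps1; have eps10 : 0 < eps + 1 by lra.
pose F x := - expR ((eps + 1) * ln (e - x)) / (eps + 1).
have dF (x : R) : 0 < x < e -> is_derive x 1 F (expR (eps * ln (e - x))).
  move=> /andP[x0 xe]; have ex : 0 < e - x by rewrite subr_gt0.
  rewrite /F; drve; rewrite ?gt_eqF//.
  have -> : expR ((eps + 1) * ln (e - x)) = expR (eps * ln (e - x)) * (e - x).
    by rewrite mulrDl mul1r expRD lnK.
  by field; rewrite !gt_eqF.
apply: (ge0_FTC_integrable e0 dF (M := expR ((eps + 1) * ln e) / (eps + 1))).
- by move=> x /andP[x0 xe]; drvc; rewrite subr_gt0.
- by move=> x _; exact: expR_ge0.
- move=> x /andP[x0 xe]; have ex : 0 < e - x by rewrite subr_gt0.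
  rewrite /F normrM normrN normfV (gtr0_norm eps10) ger0_norm ?expR_ge0//.
  rewrite ler_pM2r ?invr_gt0// ler_expR ler_pM2l// ler_ln ?posrE//; lra.
Qed.

Variables (theta g : R -> R) (e L : R).
Hypotheses (e0 : 0 < e) (ct : forall x, 0 < x < e -> {for x, continuous theta})
  (td : forall x y, 0 < x -> x < y -> y < e -> theta y < theta x)
  (tb : exists M, forall x, 0 < x < e -> theta x <= M)
  (cg : forall x, 0 < x < e -> {for x, continuous g})
  (gi : mu.-integrable `]0, e[ (EFin \o g)) (gL : g x @[x --> 0^'+] --> L).

Let w (N : nat) x := expR (N%:R * theta x).

Let cw N x : 0 < x < e -> {for x, continuous (w N)}.
Proof.
move=> xe; apply: continuous_comp; last exact: continuous_expR.
by apply: cvgMr; exact: ct.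
Qed.

Let wi N : mu.-integrable `]0, e[ (EFin \o w N).
Proof.
have [M tM] := tb.
apply: (@bounded_cont_integrable _ _ _ _ (expR (N%:R * M))) => [x|x xe]; first exact: cw.
by rewrite ger0_norm ?expR_ge0// ler_expR ler_wpM2l// tM.
Qed.

Let wgi N (k : R -> R) : (forall x, 0 < x < e -> {for x, continuous k}) ->
  mu.-integrable `]0, e[ (EFin \o k) ->
  mu.-integrable `]0, e[ (EFin \o (fun x => w N x * k x)).
Proof.
move=> ck ki; have [M tM] := tb.
apply: (cont_dominated_integrable (F := fun x => expR (N%:R * M) * `|k x|)).
- by move=> x xe; apply: cvgM; [exact: cw|exact: ck].
- move=> x xe; rewrite normrM ler_wpM2r// ger0_norm ?expR_ge0// ler_expR.
  by rewrite ler_wpM2l// tM.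
- by apply: integrable_mulr => //; exact: integrable_norm.
Qed.

Lemma integral_expR_ge N d : 0 < d < e -> d * expR (N%:R * theta d) <= \int[mu]_(x in `]0, e[) w N x.
Proof.
move=> hd; have /andP[d0 de] := hd; rewrite (Rint_split_oo hd (wi N)) -[leLHS]addr0 lerD//; last first.
  by apply: Rintegral_ge0 => x _; exact: expR_ge0.
apply: (@le_trans _ _ (\int[mu]_(x in `]0, d[) w N d)).
  by rewrite Rintegral_cst//= lebesgue_measure_itv/= lte_fin d0 /= subr0 mulrC.
apply: le_Rintegral => //=.
- by apply: (@bounded_cont_integrable _ _ _ _ `|w N d|) => // x _; exact: cvg_cst.
- by apply: integrable_sub_oo (wi N) => //; exact: ltW.
- by move=> x; rewrite in_itv/= => /andP[x0 xd]; rewrite ler_expR ler_wpM2l//; exact/ltW/td.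
Qed.

(** Beyond [d] the weight is at most [expR (N * theta d)], while the total mass is at least
    [d / 2 * expR (N * theta (d / 2))]. As [theta] decreases strictly, the ratio is geometrically
    small, without any expansion of [theta] at [0]. *)
Lemma concentration :
  (\int[mu]_(x in `]0, e[) (w N x * g x)) / (\int[mu]_(x in `]0, e[) w N x) @[N --> \oo] --> L.
Proof.
have ep := e0; apply/cvgrPdist_le => eps eps0.
have e2 : 0 < eps / 2 by rewrite divr_gt0.
have [d [d0 de dP]] : exists d, [/\ 0 < d, d < e & forall x, 0 < x < d -> `|L - g x| <= eps / 2].
  have /cvgrPdist_le/(_ _ e2)[d /= d0 dP] := gL.
  exists (Num.min d (e / 2)); split; first by rewrite lt_min d0/=; lra.
    by rewrite gt_min; apply/orP; right; lra.
  move=> x /andP[x0]; rewrite lt_min => /andP[xd _]; apply: dP => //=.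
  by rewrite sub0r normrN gtr0_norm.
pose k x := g x - L.
have ck x : 0 < x < e -> {for x, continuous k}.
  by move=> xe; apply: cvgB; [exact: cg|exact: cvg_cst].
have ki : mu.-integrable `]0, e[ (EFin \o k).
  apply: integrable_subr => //.
  by apply: (@bounded_cont_integrable _ _ _ _ `|L|) => // x _; exact: cvg_cst.
have kn : mu.-integrable `]0, e[ (EFin \o (fun x => `|k x|)) by exact: integrable_norm.
have ckn x : 0 < x < e -> {for x, continuous (fun x => `|k x|)}.
  by move=> xe; apply: (@cvg_norm _ _ _ _ _ k); exact: ck.
pose K := \int[mu]_(x in `]0, e[) `|k x|.
have K0 : 0 <= K by exact: Rintegral_ge0.
pose dt := theta (d / 2) - theta d.
have dt0 : 0 < dt by rewrite subr_gt0; apply: td; lra.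
pose D N := \int[mu]_(x in `]0, e[) w N x.
have h2 : 0 < d / 2 < e by apply/andP; split; lra.
have Dlow N : d / 2 * expR (N%:R * theta (d / 2)) <= D N by exact: integral_expR_ge.
have D0 N : 0 < D N.
  by apply: lt_le_trans (Dlow N); rewrite mulr_gt0 ?expR_gt0// divr_gt0.
have sub (a b : R) (f : R -> R) fi a0 be := @integrable_sub_oo R f 0 e a b a0 be fi.
have hd : 0 < d < e by rewrite d0.
have Dup N : \int[mu]_(x in `]0, e[) (w N x * `|k x|) <= eps / 2 * D N + expR (N%:R * theta d) * K.
  rewrite (Rint_split_oo hd (wgi N ckn kn)); apply: lerD.
    apply: (@le_trans _ _ (\int[mu]_(x in `]0, d[) (eps / 2 * w N x))).
      apply: le_Rintegral => //=.
      - by apply: sub; [exact: wgi|by []|exact: ltW].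
      - by apply: integrable_mulr => //; apply: sub => //; exact: ltW.
      - move=> x; rewrite in_itv/= => xd; rewrite mulrC ler_wpM2r ?expR_ge0//.
        by rewrite /k distrC dP.
    rewrite RintegralZl//; last by apply: sub => //; exact: ltW.
    apply: ler_wpM2l; first exact: ltW.
    rewrite /D (Rint_split_oo hd (wi N)) lerDl.
    by apply: Rintegral_ge0 => x _; exact: expR_ge0.
  apply: (@le_trans _ _ (\int[mu]_(x in `]d, e[) (expR (N%:R * theta d) * `|k x|))).
    apply: le_Rintegral => //=.
    - by apply: sub; [exact: wgi|exact: ltW|].
    - by apply: integrable_mulr => //; apply: sub => //; exact: ltW.
    - move=> x; rewrite in_itv/= => /andP[dx xe]; rewrite ler_wpM2r// ler_expR ler_wpM2l//.
      by apply/ltW/td.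
  rewrite RintegralZl//; last by apply: sub => //; exact: ltW.
  apply: ler_wpM2l; first exact: expR_ge0.
  rewrite /K (Rint_split_oo hd kn) lerDr.
  exact: Rintegral_ge0.
have lim0 : 2 * K / d * expR (- dt) ^+ N @[N --> \oo] --> 2 * K / d * 0.
  apply: cvgMr; apply: cvg_expr; rewrite ger0_norm ?expR_ge0//.
  by rewrite expR_lt1 oppr_lt0.
rewrite mulr0 in lim0; have /cvgrPdist_le/(_ _ e2) := lim0.
apply: filterS => N; rewrite sub0r normrN ger0_norm; last first.
  by rewrite mulr_ge0// ?exprn_ge0 ?expR_ge0// divr_ge0 ?mulr_ge0// ltW.
move=> h.
have -> : L - \int[mu]_(x in `]0, e[) (w N x * g x) / D N =
   - (\int[mu]_(x in `]0, e[) (w N x * k x) / D N).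
  have -> : \int[mu]_(x in `]0, e[) (w N x * g x) =
     \int[mu]_(x in `]0, e[) (w N x * k x) + L * D N.
    rewrite /D -RintegralZl// -RintegralD//; [|exact: wgi|exact: integrable_mulr].
    by apply: eq_Rintegral => x _; rewrite /k; ring.
  by field; rewrite gt_eqF.
rewrite normrN normrM normfV (gtr0_norm (D0 N)) ler_pdivrMr//.
apply: le_trans (le_normr_Rintegral _ (wgi N ck ki)) _ => //.
apply: (@le_trans _ _ (\int[mu]_(x in `]0, e[) (w N x * `|k x|))).
  rewrite le_eqVlt; apply/orP; left; apply/eqP; apply: eq_Rintegral => x _.
  by rewrite normrM ger0_norm// expR_ge0.
apply: le_trans (Dup N) _; rewrite [leRHS](_ : _ = eps / 2 * D N + eps / 2 * D N); last by field.
rewrite lerD2l; apply: le_trans (ler_wpM2l (ltW e2) (Dlow N)).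
apply: (@le_trans _ _ (2 * K / d * expR (- dt) ^+ N * (d / 2 * expR (N%:R * theta (d / 2))))).
  rewrite -expRM_natl /dt (_ : N%:R * - _ = N%:R * theta d - N%:R * theta (d / 2)); last by ring.
  rewrite expRB le_eqVlt; apply/orP; left; apply/eqP; field.
  by rewrite !gt_eqF ?expR_gt0.
by apply: ler_wpM2r => //; rewrite mulr_ge0 ?expR_ge0//; lra.
Qed.

End concentration.

(** * Integrals along the curve *)

Section curve_integrals.
Context {R : realType}.
Notation mu := (@lebesgue_measure R).
Variable p : R.
Hypothesis p1 : 1 < p.

Let q := p - 1.
Let e := pi / p : R.
Let p0 : 0 < p. Proof. exact: lt_trans ltr01 p1. Qed.
Let e0 : 0 < e. Proof. by rewrite divr_gt0// pi_gt0. Qed.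

Local Notation theta := (@theta R p).
Local Notation lnA := (@lnA R p).
Local Notation omega := (@omega R p).
Local Notation Fcurve := (@Fcurve R p).
Local Notation dtheta := (@dtheta R p).

(** For [h = cos] or [h = sin], the real or imaginary part of [rho ^ (b1 + i b2)]. Leaving [h]
    abstract serves both at once, and also [- sin], the derivative of [cos]. *)
Definition wave (h : R -> R) (b1 b2 x : R) := expR (b1 * theta x) * h (b2 * theta x).

Definition curve_integral (h : R -> R) (b1 b2 r : R) :=
  \int[mu]_(x in `]0, e[) (wave h b1 b2 x * omega r x).

Lemma theta_dec x y : 0 < x -> x < y -> y < e -> theta y < theta x.
Proof.
apply: (@dec_homo R theta dtheta 0 e).
- by move=> z; exact: is_derive_theta.
- by move=> z; exact: dtheta_lt0.
Qed.

Lemma theta_ub x : 0 < x < e -> theta x <= p * ln p - q * ln q.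
Proof.
move=> /andP[x0 xe]; rewrite -(cvg_lim (@Rhausdorff R) (theta_right_cvg p1)).
apply: limr_ge; first by apply/cvg_ex; eexists; exact: (theta_right_cvg p1).
near=> y; have y0 : 0 < y by near: y; exact: nbhs_right_gt.
have yx : y < x by near: y; exact: nbhs_right_lt.
exact/ltW/theta_dec.
Unshelve. all: end_near. Qed.

Lemma omega_cont r x : 0 < x < e -> {for x, continuous (omega r)}.
Proof.
move=> xe; apply: cvgM.
  by apply: continuous_comp; [apply: cvgMr; exact: lnA_cont|exact: continuous_expR].
have cs : {for x, continuous (fun x => sin (r * x))} by drvc.
have cc : {for x, continuous (fun x => p * cos (r * x))} by drvc.
apply: cvgD; [exact: cc|apply: cvgM; [exact: cotdiff_cont|exact: cs]].
Qed.

Lemma omega_right_cvg r : omega r x @[x --> 0^'+] --> expR (r * (ln p - ln q)) * p.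
Proof.
rewrite -[X in _ * X](_ : p * cos (r * 0) + 0 * sin (r * 0) = p); last first.
  by rewrite mulr0 cos0 mulr1 mul0r addr0.
have cs : {for 0, continuous (fun x => sin (r * x))} by drvc.
have cc : {for 0, continuous (fun x => p * cos (r * x))} by drvc.
apply: cvgM.
  apply: (@cvg_comp _ _ _ (fun x => r * lnA x) (@expR R) _ (nbhs (r * (ln p - ln q)))).
    by apply: cvgMr; exact: lnA_right_cvg.
  exact: continuous_expR.
apply: cvgD; first exact: cvg_at_right_filter cc.
by apply: cvgM; [exact: cotdiff_right_cvg|exact: cvg_at_right_filter cs].
Qed.

Section wave.
Variables (h : R -> R) (hc : continuous h) (h1 : forall y, `|h y| <= 1).

Lemma wave_cont b1 b2 x : 0 < x < e -> {for x, continuous (wave h b1 b2)}.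
Proof.
move=> xe; apply: cvgM.
  by apply: continuous_comp; [apply: cvgMr; exact: theta_cont|exact: continuous_expR].
by apply: continuous_comp; [apply: cvgMr; exact: theta_cont|exact: hc].
Qed.

Lemma wave_omega_cont b1 b2 r x : 0 < x < e ->
  {for x, continuous (fun x => wave h b1 b2 x * omega r x)}.
Proof. by move=> xe; apply: cvgM; [exact: wave_cont|exact: omega_cont]. Qed.

Lemma wave_integrable b1 b2 r : -1 < p * b1 + r ->
  mu.-integrable `]0, e[ (EFin \o (fun x => wave h b1 b2 x * omega r x)).
Proof.
move=> br; have [M MP] := curve_bound p1 b1 r.
apply: (cont_dominated_integrable (F := fun x => M * expR ((p * b1 + r) * ln (e - x)))).
- by move=> x; exact: wave_omega_cont.
- move=> x xe; apply: le_trans (MP x xe).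
  rewrite expRD /wave /omega !normrM !(ger0_norm (expR_ge0 _)) mulrACA -mulrA.
  rewrite -[leRHS]mulrA !ler_wpM2l ?expR_ge0// -[leRHS]mul1r; apply: ler_pM => //.
  rewrite (le_trans (ler_normD _ _))// lerD// normrM ?(gtr0_norm p0) ler_piMr//.
  - exact: ltW.
  - exact: cos_max.
  - exact: sin_max.
- by apply: integrable_mulr => //; exact: integrable_expR_ln.
Qed.

Lemma wave_right_cvg b1 b2 : wave h b1 b2 x @[x --> 0^'+] -->
  expR (b1 * (p * ln p - q * ln q)) * h (b2 * (p * ln p - q * ln q)).
Proof.
set l := p * ln p - q * ln q; apply: cvgM.
  apply: (@cvg_comp _ _ _ (fun x => b1 * theta x) (@expR R) _ (nbhs (b1 * l))).
    by apply: cvgMr; exact: theta_right_cvg.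
  exact: continuous_expR.
apply: (@cvg_comp _ _ _ (fun x => b2 * theta x) h _ (nbhs (b2 * l))); last exact: hc.
by apply: cvgMr; exact: theta_right_cvg.
Qed.

Lemma wave_F_right b1 b2 s : wave h b1 b2 x * Fcurve s x @[x --> 0^'+] --> (0 : R).
Proof.
have cs : {for 0, continuous (fun x => sin (s * x))} by drvc.
have cs0 := cvg_at_right_filter cs.
have L : wave h b1 b2 x * (expR (s * lnA x) * sin (s * x)) @[x --> 0^'+] -->
   expR (b1 * (p * ln p - q * ln q)) * h (b2 * (p * ln p - q * ln q)) *
   (expR (s * (ln p - ln q)) * sin (s * 0)).
  apply: cvgM; first exact: wave_right_cvg.
  apply: cvgM; last exact: cs0.
  apply: (@cvg_comp _ _ _ (fun x => s * lnA x) (@expR R) _ (nbhs (s * (ln p - ln q)))).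
    by apply: cvgMr; exact: lnA_right_cvg.
  exact: continuous_expR.
by rewrite mulr0 sin0 !mulr0 in L; exact: L.
Qed.

Lemma wave_F_left b1 b2 s : 0 < p * b1 + s ->
  wave h b1 b2 x * Fcurve s x @[x --> e^'-] --> (0 : R).
Proof.
move=> bs; have [M MP] := curve_bound p1 b1 s.
have L := @expR_ln_left_cvg0 R (p * b1 + s) e (M / p) bs.
apply: squeeze_norm0 L; near=> x.
have xe : 0 < x < e by near: x; exact: near_left_oo.
rewrite [M / p * _]mulrAC ler_pdivlMr//; apply: le_trans (MP x xe).
rewrite expRD /wave /Fcurve !normrM !(ger0_norm (expR_ge0 _)) mulrACA -!mulrA.
rewrite !ler_wpM2l ?expR_ge0// mulrA -[leRHS]mul1r; apply: ler_pM => //.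
- exact: ltW.
- by rewrite -[leRHS]mulr1 ler_pM// sin_max.
- by rewrite lerDl.
Unshelve. all: end_near. Qed.

End wave.

Section recurrence.
Variables (h h' : R -> R) (hc : continuous h) (h1 : forall y, `|h y| <= 1)
  (hc' : continuous h') (h1' : forall y, `|h' y| <= 1)
  (dh : forall y : R, is_derive y 1 h (h' y)).

(* The derivative of [wave h b1 b2 * Fcurve s] has zero integral. *)
Lemma curve_recurrence b1 b2 s : 0 < p * b1 + s ->
  (q * b1 + s) * curve_integral h b1 b2 s + q * b2 * curve_integral h' b1 b2 s =
  (p * b1 + s) * curve_integral h b1 b2 (s - 1) + p * b2 * curve_integral h' b1 b2 (s - 1).
Proof.
move=> bs.
pose f x := (q * b1 + s) * (wave h b1 b2 x * omega s x) + q * b2 * (wave h' b1 b2 x * omega s x) -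
  ((p * b1 + s) * (wave h b1 b2 x * omega (s - 1) x) + p * b2 * (wave h' b1 b2 x * omega (s - 1) x)).
have dF (x : R) : 0 < x < e -> is_derive x 1 (fun x => wave h b1 b2 x * Fcurve s x) (f x).
  move=> xe; have d1 := is_derive_theta p1 xe; have d2 := is_derive_Fcurve p1 s xe.
  have d3 : is_derive x 1 (fun x => h (b2 * theta x)) (h' (b2 * theta x) * (b2 * dtheta x)).
    exact: (drv_comp (drvZ b2 d1) (dh _)).
  have d4 : is_derive x 1 (wave h b1 b2) (dtheta x * (b1 * wave h b1 b2 x + b2 * wave h' b1 b2 x)).
    rewrite /wave; notypeclasses refine (drv_eq _ _).
      notypeclasses refine (drvM _ d3); drv; exact: d1.
    by cbv beta; ring.
  notypeclasses refine (drv_eq (drvM d4 d2) _).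
  rewrite -[s * _ * _]mulrA (omega_dF p1 s xe).
  rewrite (_ : _ * _ * Fcurve s x = (b1 * wave h b1 b2 x + b2 * wave h' b1 b2 x) *
    (dtheta x * Fcurve s x)); last by ring.
  rewrite (omega_dtheta p1 s xe) /f /q.
  by move: (omega s x) (omega (s - 1) x) (wave h b1 b2 x) (wave h' b1 b2 x) => u v w1 w2; ring.
have i1 := wave_integrable hc h1 b2 (r := s) (b1 := b1).
have i2 := wave_integrable hc' h1' b2 (r := s) (b1 := b1).
have i3 := wave_integrable hc h1 b2 (r := s - 1) (b1 := b1).
have i4 := wave_integrable hc' h1' b2 (r := s - 1) (b1 := b1).
have {}i1 := i1 (lt_trans (ltrN10 R) bs); have {}i2 := i2 (lt_trans (ltrN10 R) bs).
have s1 : -1 < p * b1 + (s - 1) by lra.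
have {}i3 := i3 s1; have {}i4 := i4 s1.
have j1 := integrable_mulr (q * b1 + s) (measurable_itv _) i1.
have j2 := integrable_mulr (q * b2) (measurable_itv _) i2.
have j3 := integrable_mulr (p * b1 + s) (measurable_itv _) i3.
have j4 := integrable_mulr (p * b2) (measurable_itv _) i4.
have j12 := integrable_addr (measurable_itv _) j1 j2.
have j34 := integrable_addr (measurable_itv _) j3 j4.
have fi : mu.-integrable `]0, e[ (EFin \o f) := integrable_subr (measurable_itv _) j12 j34.
have fc (x : R) : 0 < x < e -> {for x, continuous f}.
  move=> xe; apply: cvgB; apply: cvgD; apply: cvgMr; by apply: wave_omega_cont.
have := FTC_oo e0 fi dF fc (@wave_F_right h hc b1 b2 s) (@wave_F_left h h1 b1 b2 s bs).
rewrite /f RintegralB// RintegralD// RintegralD// !RintegralZl// subrr.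
by move=> /eqP; rewrite subr_eq0 => /eqP.
Qed.

Lemma curve_shift b1 b2 s : -1 < p * (b1 + 1) + s ->
  curve_integral h b1 b2 (s + p) =
  curve_integral h (b1 + 1) b2 (s + 1) - curve_integral h (b1 + 1) b2 s.
Proof.
move=> bs.
have i1 := wave_integrable hc h1 b2 (r := s) (b1 := b1 + 1) bs.
have bs1 : -1 < p * (b1 + 1) + (s + 1) by lra.
have i2 := wave_integrable hc h1 b2 (r := s + 1) (b1 := b1 + 1) bs1.
rewrite /curve_integral -RintegralB//; apply: eq_Rintegral => x; rewrite inE/= in_itv/= => xe.
rewrite (omega_shift p1 s xe) /wave.
have -> : expR ((b1 + 1) * theta x) = expR (b1 * theta x) * expR (theta x).
  by rewrite mulrDl mul1r expRD.
by set t := expR (theta x); ring.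
Qed.

End recurrence.

Lemma curve_integral_N (h : R -> R) b1 b2 r :
  continuous h -> (forall y, `|h y| <= 1) -> -1 < p * b1 + r ->
  curve_integral (fun y => - h y) b1 b2 r = - curve_integral h b1 b2 r.
Proof.
move=> hc h1 br; rewrite /curve_integral -mulN1r -RintegralZl//; last exact: wave_integrable.
by apply: eq_Rintegral => x _; rewrite /wave; ring.
Qed.

Lemma curve_integral_sin0 b1 r : curve_integral sin b1 0 r = 0.
Proof.
rewrite /curve_integral /wave; under eq_Rintegral do rewrite mul0r sin0 mulr0 mul0r.
by rewrite Rintegral_cst//= mul0r.
Qed.

Lemma curve_integral00 : curve_integral cos 0 0 0 = pi.
Proof.
rewrite /curve_integral.
transitivity (\int[mu]_(x in `]0, e[) p).
  apply: eq_Rintegral => x _; rewrite /wave /omega !mul0r expR0 cos0 sin0; ring.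
rewrite Rintegral_cst//= lebesgue_measure_itv/= lte_fin e0/= subr0.
by rewrite /e mulrC divfK// gt_eqF.
Qed.

(** Since [omega 0] is the constant [p], the denominator is [p] times the mass of the weight; this
    cancels the factor [p] in the limit of [omega r] at [0]. *)
Lemma curve_concentration (h : R -> R) b1 b2 r :
  continuous h -> (forall y, `|h y| <= 1) -> -1 < p * b1 + r ->
  let l := p * ln p - q * ln q in
  curve_integral h (N%:R + b1) b2 r / curve_integral cos N%:R 0 0 @[N --> \oo] -->
  expR (b1 * l) * h (b2 * l) * expR (r * (ln p - ln q)).
Proof.
move=> hc h1 br l.
have gL : wave h b1 b2 x * omega r x @[x --> 0^'+] -->
    expR (b1 * l) * h (b2 * l) * (expR (r * (ln p - ln q)) * p).
  by apply: cvgM; [exact: wave_right_cvg|exact: omega_right_cvg].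
have c := concentration e0 (@theta_cont _ _ p1) theta_dec
  (ex_intro _ l theta_ub) (@wave_omega_cont h hc b1 b2 r) (wave_integrable hc h1 b2 br) gL.
pose I1 N := \int[mu]_(x in `]0, e[) (expR (N%:R * theta x) * (wave h b1 b2 x * omega r x)).
pose I2 N := \int[mu]_(x in `]0, e[) expR (N%:R * theta x).
have {}c : I1 N / I2 N / p @[N --> \oo] --> expR (b1 * l) * h (b2 * l) * (expR (r * (ln p - ln q)) * p) / p.
  by apply: cvgM; [exact: c|exact: cvg_cst].
rewrite mulrA mulfK ?gt_eqF// in c; apply: cvg_trans c; apply: near_eq_cvg; near=> N.
have -> : curve_integral h (N%:R + b1) b2 r =
    \int[mu]_(x in `]0, e[) (expR (N%:R * theta x) * (wave h b1 b2 x * omega r x)).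
  apply: eq_Rintegral => x _; rewrite /wave.
  have -> : expR ((N%:R + b1) * theta x) = expR (N%:R * theta x) * expR (b1 * theta x).
    by rewrite mulrDl expRD.
  ring.
have -> : curve_integral cos N%:R 0 0 = p * \int[mu]_(x in `]0, e[) expR (N%:R * theta x).
  rewrite -RintegralZl//.
    by apply: eq_Rintegral => x _; rewrite /wave /omega !mul0r expR0 cos0 sin0; ring.
  apply: (@bounded_cont_integrable _ _ _ _ (expR (N%:R * l))) => x xe.
    by apply: continuous_comp; [apply: cvgMr; exact: theta_cont|exact: continuous_expR].
  by rewrite ger0_norm ?expR_ge0// ler_expR ler_wpM2l// theta_ub.
rewrite invfM /=; by rewrite -/I2 mulrAC mulrA.
Unshelve. all: end_near. Qed.

End curve_integrals.

(** * Complex limits and Euler's limit for Gamma *)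

Section complex_limits.
Context {R : realType}.
Implicit Types (z w : R[i]) (x y : R).
Local Notation Re := complex.Re.
Local Notation Im := complex.Im.

Lemma complexP z w : Re z = Re w -> Im z = Im w -> z = w.
Proof. by case: z => a b; case: w => c d /= -> ->. Qed.

Lemma cReD z w : Re (z + w) = Re z + Re w. Proof. by case: z => a b; case: w. Qed.
Lemma cImD z w : Im (z + w) = Im z + Im w. Proof. by case: z => a b; case: w. Qed.
Lemma cReN z : Re (- z) = - Re z. Proof. by case: z. Qed.
Lemma cImN z : Im (- z) = - Im z. Proof. by case: z. Qed.
Lemma cReB z w : Re (z - w) = Re z - Re w. Proof. by rewrite cReD cReN. Qed.
Lemma cImB z w : Im (z - w) = Im z - Im w. Proof. by rewrite cImD cImN. Qed.
Lemma cReM z w : Re (z * w) = Re z * Re w - Im z * Im w.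
Proof. by case: z => a b; case: w. Qed.
Lemma cImM z w : Im (z * w) = Re z * Im w + Im z * Re w.
Proof. by case: z => a b; case: w. Qed.
Lemma cReC x : Re x%:C = x. Proof. by []. Qed.
Lemma cImC x : Im x%:C = 0. Proof. by []. Qed.
Lemma natC n : (n%:R : R[i]) = n%:R%:C. Proof. by rewrite rmorph_nat. Qed.
Lemma natC_neq0 n : (0 < n)%N -> (n%:R : R[i]) != 0. Proof. by rewrite pnatr_eq0 lt0n. Qed.
Lemma factC_neq0 n : (n`!%:R : R[i]) != 0. Proof. by rewrite natC_neq0// fact_gt0. Qed.
Lemma Re_nat n : Re (n%:R : R[i]) = n%:R. Proof. by rewrite natC. Qed.
Lemma Im_nat n : Im (n%:R : R[i]) = 0. Proof. by rewrite natC. Qed.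
Lemma cRe1 : Re (1 : R[i]) = 1. Proof. by []. Qed.
Lemma cIm1 : Im (1 : R[i]) = 0. Proof. by []. Qed.
Lemma cRe0 : Re (0 : R[i]) = 0. Proof. by []. Qed.
Lemma cIm0 : Im (0 : R[i]) = 0. Proof. by []. Qed.

Definition ReImE := (cReD, cImD, cReN, cImN, cReM, cImM, cReC, cImC, Re_nat, Im_nat, cRe1, cIm1, cRe0, cIm0).

Lemma Re_le_normc z : `|Re z| <= normc z.
Proof. by case: z => a b /=; rewrite -sqrtr_sqr ler_wsqrtr// lerDl sqr_ge0. Qed.

Lemma Im_le_normc z : `|Im z| <= normc z.
Proof. by case: z => a b /=; rewrite -sqrtr_sqr ler_wsqrtr// lerDr sqr_ge0. Qed.

Lemma normc_leD z : normc z <= `|Re z| + `|Im z|.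
Proof.
have -> : z = (Re z)%:C + (0 +i* Im z) by apply: complexP; rewrite !ReImE/= ?addr0 ?add0r.
apply: le_trans (le_normcD _ _) _.
by rewrite !ReImE/= !addr0 !add0r !expr0n/= addr0 add0r !sqrtr_sqr.
Qed.

Lemma normc_ge0 z : 0 <= normc z. Proof. by case: z => a b; exact: sqrtr_ge0. Qed.

Lemma normcC x : normc x%:C = `|x|. Proof. by rewrite /= expr0n/= addr0 sqrtr_sqr. Qed.

Lemma normc_nat n : normc (n%:R : R[i]) = n%:R.
Proof. by rewrite natC normcC ger0_norm. Qed.

Lemma normE z : `|z| = (normc z)%:C. Proof. by case: z. Qed.

(** Convergence by components, the form in which real limits enter; [ccvgE] identifies it with
    convergence for the modulus. *)
Definition ccvg {T} (F : set_system T) (f : T -> R[i]) z :=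
  (fun t => Re (f t)) @ F --> Re z /\ (fun t => Im (f t)) @ F --> Im z.

Lemma ccvgE {T} (F : set_system T) {FF : Filter F} (f : T -> R[i]) z :
  ((f : T -> R[i]^o) @ F --> (z : R[i]^o)) <-> ccvg F f z.
Proof.
split.
  move=> /cvgrPdist_lt h; split; apply/cvgrPdist_lt => e e0.
  - have ec : 0 < e%:C :> R[i] by rewrite ltcR.
    apply: filterS (h _ ec) => t; rewrite normE ltcR; apply: le_lt_trans.
    by rewrite -cReB; exact: Re_le_normc (z - f t).
  - have ec : 0 < e%:C :> R[i] by rewrite ltcR.
    apply: filterS (h _ ec) => t; rewrite normE ltcR; apply: le_lt_trans.
    by rewrite -cImB; exact: Im_le_normc (z - f t).
move=> [/cvgrPdist_lt hR /cvgrPdist_lt hI]; apply/cvgrPdist_lt => -[e e'].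
rewrite ltcE /= => /andP[/eqP -> e0]; have e2 : 0 < e / 2 by rewrite divr_gt0.
apply: filterS2 (hR _ e2) (hI _ e2) => t h1 h2; rewrite normE ltcR.
by apply: le_lt_trans (normc_leD _) _; rewrite cReB cImB [ltRHS]splitr ltrD.
Qed.

Lemma ccvg_unique {T} (F : set_system T) {FF : ProperFilter F} (f : T -> R[i]) z w :
  ccvg F f z -> ccvg F f w -> z = w.
Proof.
by move=> [a b] [a' b']; apply: complexP; [exact: cvg_unique a a'|exact: cvg_unique b b'].
Qed.

Lemma ccvg_lim {T} (F : set_system T) {FF : ProperFilter F} (f : T -> R[i]) z :
  ccvg F f z -> lim ((f : T -> R[i]^o) @ F) = z.
Proof. by move=> /ccvgE h; apply: cvg_lim => //; exact: norm_hausdorff. Qed.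

Section ops.
Context {T : Type} (F : set_system T) {FF : Filter F}.
Implicit Types f g : T -> R[i].

Lemma ccvg_cst z : ccvg F (fun=> z) z.
Proof. by split; exact: cvg_cst. Qed.

Lemma ccvgD f g z w : ccvg F f z -> ccvg F g w -> ccvg F (fun t => f t + g t) (z + w).
Proof.
move=> [a b] [a' b']; split; under eq_fun do rewrite ?cReD ?cImD; rewrite ?cReD ?cImD; exact: cvgD.
Qed.

Lemma ccvgM f g z w : ccvg F f z -> ccvg F g w -> ccvg F (fun t => f t * g t) (z * w).
Proof.
move=> [a b] [a' b']; split; under eq_fun do rewrite ?cReM ?cImM; rewrite ?cReM ?cImM.
- by apply: cvgB; exact: cvgM.
- by apply: cvgD; exact: cvgM.
Qed.

Lemma cReV z : Re z^-1 = Re z / (Re z ^+ 2 + Im z ^+ 2). Proof. by case: z. Qed.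
Lemma cImV z : Im z^-1 = - Im z / (Re z ^+ 2 + Im z ^+ 2).
Proof. by case: z => a b /=; rewrite mulNr. Qed.

Lemma sqr_norm_neq0 z : z != 0 -> Re z ^+ 2 + Im z ^+ 2 != 0.
Proof.
case: z => a b; rewrite eq_complex/= paddr_eq0 ?sqr_ge0// !sqrf_eq0.
by move=> /negP h; apply/negP => /andP[? ?]; apply: h; apply/andP.
Qed.

Lemma ccvgV f z : z != 0 -> ccvg F f z -> ccvg F (fun t => (f t)^-1) z^-1.
Proof.
move=> z0 [a b].
have L : (fun t => Re (f t) ^+ 2 + Im (f t) ^+ 2) @ F --> Re z ^+ 2 + Im z ^+ 2.
  by apply: cvgD; apply: cvgM.
have {}L : (fun t => (Re (f t) ^+ 2 + Im (f t) ^+ 2)^-1) @ F --> (Re z ^+ 2 + Im z ^+ 2)^-1.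
  by apply: cvgV L; exact: sqr_norm_neq0.
split; under eq_fun do rewrite ?cReV ?cImV; rewrite ?cReV ?cImV; apply: cvgM; try exact: L; [exact: a|by apply: cvgN; exact: b].
Qed.

Lemma ccvg_prod n (f : 'I_n -> T -> R[i]) (z : 'I_n -> R[i]) :
  (forall i, ccvg F (f i) (z i)) -> ccvg F (fun t => \prod_(i < n) f i t) (\prod_(i < n) z i).
Proof.
elim: n f z => [|n IH] f z h.
  by under eq_fun do rewrite big_ord0; rewrite big_ord0; exact: ccvg_cst.
under eq_fun do rewrite big_ord_recl; rewrite big_ord_recl.
by apply: ccvgM => //; apply: IH => i; exact: h.
Qed.

Lemma ccvg_near f g z : (\forall t \near F, f t = g t) -> ccvg F f z -> ccvg F g z.
Proof.
move=> fg [a b]; split.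
- by apply: cvg_trans a; apply: near_eq_cvg; apply: filterS fg => t ->.
- by apply: cvg_trans b; apply: near_eq_cvg; apply: filterS fg => t ->.
Qed.

End ops.

Definition cexp z : R[i] := (expR (Re z))%:C * (cos (Im z) +i* sin (Im z)).

Lemma cexpD z w : cexp (z + w) = cexp z * cexp w.
Proof.
apply: complexP; rewrite /cexp !ReImE/= expRD ?cosD ?sinD !mul0r ?subr0 ?addr0; ring.
Qed.

Lemma cexp0 : cexp 0 = 1.
Proof. by apply: complexP; rewrite /cexp !ReImE/= expR0 cos0 sin0 ?mulr0 ?mul0r ?subr0 ?addr0 ?mulr1. Qed.

Lemma normc_cexp z : normc (cexp z) = expR (Re z).
Proof.
by rewrite /cexp normcM normcC ger0_norm ?expR_ge0//= cos2Dsin2 sqrtr1 mulr1.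
Qed.

Lemma cexp_neq0 z : cexp z != 0.
Proof.
apply/eqP => h; have := normc_cexp z; rewrite h normc0 => /esym/eqP; by rewrite gt_eqF ?expR_gt0.
Qed.

Lemma cexpN z : cexp (- z) = (cexp z)^-1.
Proof. by apply: (mulfI (cexp_neq0 z)); rewrite -cexpD subrr cexp0 divff ?cexp_neq0. Qed.

Lemma cexpB z w : cexp (z - w) = cexp z / cexp w.
Proof. by rewrite cexpD cexpN. Qed.

Lemma cexpC x : cexp x%:C = (expR x)%:C.
Proof. by apply: complexP; rewrite /cexp !ReImE/= cos0 sin0 ?mulr0 ?mul0r ?subr0 ?addr0 ?mulr1. Qed.

Lemma cpowE x z : 0 < x -> cpow x z = cexp (z * (ln x)%:C).
Proof.
move=> x0; rewrite /cpow /cexp !ReImE/= mulr0 subr0 mulr0 add0r.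
by rewrite /powR gt_eqF.
Qed.

End complex_limits.

(** * Convergence of Euler's limit *)

Section gamma_limit.
Context {R : realType}.
Implicit Types (z w : R[i]) (x y : R).
Local Notation Re := complex.Re.
Local Notation Im := complex.Im.

Lemma norm_cos_sub1 x : `|cos x - 1| <= x ^+ 2.
Proof.
rewrite -{1}[x](@divfK _ 2)// mulr_natr mulr2n cosD.
have := cos2Dsin2 (x / 2); have := norm_sin_le (x / 2).
rewrite normrM (@ger0_norm _ 2^-1)// => h1 h2.
have -> : cos (x / 2) * cos (x / 2) - sin (x / 2) * sin (x / 2) - 1 = - (2 * sin (x / 2) ^+ 2).
  by rewrite -[X in _ - X]h2; ring.
rewrite normrN ger0_norm; last by rewrite mulr_ge0 ?sqr_ge0.
rewrite -(real_normK (num_real (sin (x / 2)))) -(real_normK (num_real x)).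
by have := normr_ge0 x; have := normr_ge0 (sin (x / 2)); nra.
Qed.

Lemma norm_sin_sub x : `|x| <= 1 -> `|sin x - x| <= x ^+ 2.
Proof.
have pos y : 0 < y -> y <= 1 -> `|sin y - y| <= y ^+ 2.
  move=> y0 y1.
  have d (t : R) : is_derive t 1 (fun t => sin t - t) (cos t - 1 : R) by drve; ring.
  have cf : {within `[0, y], continuous (fun t => sin t - t : R)}.
    apply: continuous_subspaceT => t; drvc.
  have [c] := MVT y0 (fun t _ => d t) cf.
  rewrite in_itv/= => /andP[c0 cy]; rewrite sin0 subrr !subr0 => ->.
  rewrite normrM (gtr0_norm y0); apply: (@le_trans _ _ (c ^+ 2 * y)).
    by rewrite ler_wpM2r ?(ltW y0)// norm_cos_sub1.
  by rewrite -[leRHS]mulr1; nra.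
case: (ltgtP x 0) => [x0|x0|->] x1.
- have := pos (- x); rewrite oppr_gt0 => /(_ x0).
  rewrite sinN sqrrN -opprD normrN; apply.
  by rewrite ltr0_norm in x1.
- by apply: pos => //; rewrite gtr0_norm in x1.
- by rewrite sin0 subrr normr0 expr0n.
Qed.

Lemma norm_expR_sub x : `|x| <= 1 / 2 -> `|expR x - 1 - x| <= 2 * x ^+ 2.
Proof.
rewrite ler_norml => /andP[x1 x2]; have h := expR_ge1Dx x.
have h' := expR_ge1Dx (- x).
rewrite ger0_norm; last lra.
have e0 := expR_gt0 x; have e' := expRxMexpNx_1 x.
have : expR x * (1 - x) <= expR x * expR (- x) by rewrite ler_pM2l.
rewrite e'; clear e' h'.
by nra.
Qed.

Lemma normc_cexp_sub w : normc w <= 1 / 2 -> normc (cexp w - 1 - w) <= 5 * normc w ^+ 2.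
Proof.
move=> w1; have a1 := le_trans (Re_le_normc w) w1; have b1 := le_trans (Im_le_normc w) w1.
apply: le_trans (normc_leD _) _.
rewrite !cReB !cImB /cexp cReM cImM/= !mul0r !subr0 addr0.
have -> : normc w ^+ 2 = Re w ^+ 2 + Im w ^+ 2.
  by case: (w) => a b /=; rewrite sqr_sqrtr// addr_ge0// sqr_ge0.
set a := Re w in a1 *; set b := Im w in b1 *.
have ha := norm_expR_sub a1; have hc := norm_cos_sub1 b.
have hs : `|sin b - b| <= b ^+ 2 by apply: norm_sin_sub; apply: le_trans b1 _; lra.
have e0 := expR_gt0 a; have h' := expR_ge1Dx (- a); have e' := expRxMexpNx_1 a.
have e2 : expR a <= 2.
  have : expR a * (1 - a) <= expR a * expR (- a) by rewrite ler_pM2l.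
  rewrite e'.
  by move: a1; rewrite ler_norml => /andP[_ a1]; nra.
have -> : expR a * cos b - 1 - a = (expR a - 1 - a) + expR a * (cos b - 1) by ring.
have -> : expR a * sin b - b = expR a * (sin b - b) + b * (expR a - 1) by ring.
have h1 : `|expR a * (cos b - 1)| <= 2 * b ^+ 2.
  by rewrite normrM gtr0_norm// ler_pM// ltW.
have h2 : `|expR a * (sin b - b)| <= 2 * b ^+ 2.
  by rewrite normrM gtr0_norm// ler_pM// ltW.
have h3 : `|expR a - 1| <= 2 * `|a|.
  have -> : expR a - 1 = (expR a - 1 - a) + a by ring.
  apply: le_trans (ler_normD _ _) _; rewrite -(real_normK (num_real a)) in ha.
  by have := normr_ge0 a; nra.
have h4 : `|b * (expR a - 1)| <= a ^+ 2 + b ^+ 2.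
  rewrite normrM -(real_normK (num_real a)) -(real_normK (num_real b)).
  have := normr_ge0 a; have := normr_ge0 b; have := sqr_ge0 (`|a| - `|b|); nra.
have t1 := ler_normD (expR a - 1 - a) (expR a * (cos b - 1)).
have t2 := ler_normD (expR a * (sin b - b)) (b * (expR a - 1)).
have := sqr_ge0 a; have := sqr_ge0 b.
move: ha h1 h2 h4 t1 t2; lra.
Qed.

Section ratio.
Variables (u : nat -> R[i]) (C : R) (N : nat).
Hypotheses (C0 : 0 <= C) (N0 : (0 < N)%N) (NC : 2 * C <= N%:R).
Hypothesis uN : u N != 0.
Hypothesis hu : forall n, (N <= n)%N ->
  normc (u n.+1 - u n) <= C / (n%:R * n.+1%:R) * normc (u n).

Let stepE n : (N <= n)%N -> C / (n%:R * n.+1%:R) = C / n%:R - C / n.+1%:R.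
Proof.
move=> Nn; have n0 : (n%:R : R) != 0 by rewrite pnatr_eq0 -lt0n (leq_trans N0 Nn).
have n1 : (n.+1%:R : R) != 0 by rewrite pnatr_eq0.
by rewrite -natr1 in n1 *; field; rewrite n0 n1.
Qed.

Let ub n : (N <= n)%N -> normc (u n) <= normc (u N) * expR (C / N%:R - C / n%:R).
Proof.
elim: n => [|n IH]; first by move: N0; case: (N).
rewrite leq_eqVlt => /orP[/eqP <-|]; first by rewrite subrr expR0 mulr1.
rewrite ltnS => Nn; have := hu Nn; rewrite (stepE Nn); move: (IH Nn).
set d := C / n%:R; set d' := C / n.+1%:R => h1 h2.
have -> : u n.+1 = (u n.+1 - u n) + u n by rewrite subrK.
apply: le_trans (le_normcD _ _) _.
have -> : C / N%:R - d' = (C / N%:R - d) + (d - d') by ring.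
rewrite expRD mulrA; apply: (@le_trans _ _ (normc (u n) * expR (d - d'))); last first.
  by rewrite ler_wpM2r ?expR_ge0.
have := expR_ge1Dx (d - d'); have := normc_ge0 (u n); nra.
Qed.

(** [2 * C <= N] keeps each relative step [t] at most [1 / 2], where [1 - t >= exp(- 2 t)]. *)
Let lb n : (N <= n)%N -> normc (u N) * expR (2 * (C / n%:R - C / N%:R)) <= normc (u n).
Proof.
elim: n => [|n IH]; first by move: N0; case: (N).
rewrite leq_eqVlt => /orP[/eqP <-|]; first by rewrite subrr mulr0 expR0 mulr1.
rewrite ltnS => Nn; have := hu Nn; rewrite (stepE Nn); move: (IH Nn).
have n0 : 0 < (n%:R : R) by rewrite ltr0n (leq_trans N0 Nn).
have d0 : 0 <= C / n.+1%:R by rewrite divr_ge0.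
have d2 : C / n%:R <= 1 / 2.
  rewrite ler_pdivrMr// mulrC; have : (N%:R : R) <= n%:R by rewrite ler_nat.
  by move: NC; lra.
have dd : 0 <= C / n%:R - C / n.+1%:R by rewrite -stepE// divr_ge0// mulr_ge0.
move: d0 d2 dd; set d := C / n%:R; set d' := C / n.+1%:R => d0 d2 dd h1 h2.
have t : normc (u n) <= normc (u n.+1) + normc (u n.+1 - u n).
  by rewrite -{1}[u n](subKr (u n.+1)) (le_trans (le_normcD _ _))// normcN.
have -> : 2 * (d' - C / N%:R) = 2 * (d - C / N%:R) - 2 * (d - d') by ring.
rewrite expRD mulrA; apply: (@le_trans _ _ (normc (u n) * expR (- (2 * (d - d'))))).
  by rewrite ler_wpM2r ?expR_ge0.
have e1 := expR_ge1Dx (2 * (d - d')); have e2 := expRxMexpNx_1 (2 * (d - d')).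
have e3 := expR_gt0 (- (2 * (d - d'))).
have : expR (- (2 * (d - d'))) <= 1 - (d - d').
  have : (1 + 2 * (d - d')) * expR (- (2 * (d - d'))) <= expR (2 * (d - d')) * expR (- (2 * (d - d'))).
    by rewrite ler_pM2r.
  rewrite e2.
  move: e3; set E := expR _ => e3; set t0 := d - d' in dd *.
  have : t0 <= 1 / 2 by rewrite /t0; lra.
  by nra.
by have := normc_ge0 (u n); nra.
Qed.

(** The relative steps [C / (n (n + 1))] telescope to [C / n - C / (n + 1)]. This bounds the moduli
    from above and away from [0], so the limit is not [0]. *)
Lemma ratio_ccvg : exists2 z, z != 0 & ccvg \oo u z.
Proof.
pose M := normc (u N) * expR (C / N%:R).
have M0 : 0 <= M by rewrite mulr_ge0 ?normc_ge0 ?expR_ge0.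
have uM n : (N <= n)%N -> normc (u n) <= M.
  move=> Nn; apply: le_trans (ub Nn) _; rewrite ler_wpM2l ?normc_ge0// ler_expR.
  by rewrite gerBl divr_ge0.
have dM n : (N <= n)%N -> normc (u n.+1 - u n) <= M * (C / n%:R - C / n.+1%:R).
  move=> Nn; apply: le_trans (hu Nn) _; rewrite mulrC -stepE//.
  by rewrite ler_wpM2r ?uM// divr_ge0// mulr_ge0.
have key (f : R[i] -> R) : (forall z w, f (z - w) = f z - f w) -> (forall z, `|f z| <= normc z) ->
    cvg ((fun n => f (u n)) @ \oo).
  move=> fB fn.
  have D0 : M * C / n%:R @[n --> \oo] --> (0 : R).
    rewrite -(mulr0 (M * C)); apply: cvgMr.
    by have h := @cvg_harmonic R; rewrite -cvg_shiftS; exact: h.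
  (* A step of [f (u n)] is at least [- (M C / n - M C / (n + 1))], so subtracting [M C / n] makes
     the sequence monotone; it is also bounded. *)
  have inc : cvg ((fun n => f (u (n + N)%N) - M * C / (n + N)%:R) @ \oo).
    apply: nondecreasing_is_cvgn.
      apply/nondecreasing_seqP => n; rewrite addSn.
      have Nn : (N <= n + N)%N by rewrite leq_addl.
      have := le_trans (fn _) (dM _ Nn); rewrite fB ler_norml => /andP[h _].
      rewrite mulrBr !mulrA opprB lerBlDr in h.
      move: h; set t1 := M * C / _; set t2 := M * C / _; lra.
    exists M => _ [n _ <-].
    have Nn : (N <= n + N)%N by rewrite leq_addl.
    have := le_trans (fn _) (uM _ Nn); rewrite ler_norml => /andP[_ h].
    apply: le_trans h => /=; have : 0 <= M * C / (n + N)%:R by apply: divr_ge0 => //; exact: mulr_ge0.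
    by lra.
  have : cvg ((fun n => f (u n) - M * C / n%:R) @ \oo).
    by case/cvg_ex: inc => l hl; apply/cvg_ex; exists l; rewrite -(cvg_shiftn N).
  move=> /cvg_ex[l hl]; apply/cvg_ex; exists (l + 0).
  have L : (f (u n) - M * C / n%:R) + M * C / n%:R @[n --> \oo] --> l + 0 by exact: cvgD.
  by apply: cvg_trans L; apply: near_eq_cvg; near=> n; rewrite subrK.
have /cvg_ex[a ha] := key _ (@cReB R) (@Re_le_normc R).
have /cvg_ex[b hb] := key _ (@cImB R) (@Im_le_normc R).
exists (a +i* b) => //.
pose m := normc (u N) * expR (2 * (- (C / N%:R))).
have m0 : 0 < m.
  rewrite mulr_gt0 ?expR_gt0// lt_def normc_ge0 andbT.
  by apply: contra uN => /eqP/eq0_normc ->.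
have um n : (N <= n)%N -> m ^+ 2 <= Re (u n) ^+ 2 + Im (u n) ^+ 2.
  move=> Nn; have -> : Re (u n) ^+ 2 + Im (u n) ^+ 2 = normc (u n) ^+ 2.
    by case: (u n) => c d /=; rewrite sqr_sqrtr// addr_ge0// sqr_ge0.
  rewrite ler_pXn2r ?nnegrE ?normc_ge0// ?(ltW m0)//; apply: le_trans (lb Nn).
  by rewrite ler_wpM2l ?normc_ge0// ler_expR ler_wpM2l// lerDr divr_ge0.
have L : (Re (u n) ^+ 2 + Im (u n) ^+ 2) @[n --> \oo] --> a ^+ 2 + b ^+ 2.
  by apply: cvgD; apply: cvgM.
have : m ^+ 2 <= a ^+ 2 + b ^+ 2.
  rewrite -(cvg_lim (@Rhausdorff R) L); apply: limr_ge; first by apply/cvg_ex; exists (a ^+ 2 + b ^+ 2).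
  near=> n; apply: um; near: n; exact: nbhs_infty_ge.
move=> h; apply/eqP => -[a0 b0]; move: h; rewrite a0 b0 expr0n/= addr0.
by rewrite leNgt exprn_gt0.
Unshelve. all: end_near. Qed.

End ratio.

Definition euler (n : nat) z : R[i] := n`!%:R * cpow n%:R z / \prod_(i < n.+1) (z + i%:R).

Lemma GammaE z : Gamma z = lim ((fun n => euler n z : R[i]^o) @ \oo).
Proof. by []. Qed.

Lemma prod_neq0 z n : ~ Gamma_pole z -> \prod_(i < n) (z + i%:R) != 0.
Proof.
move=> np; apply/prodf_neq0 => i _.
by apply/eqP => h; apply: np; exists i; apply/eqP; rewrite -addr_eq0 h.
Qed.

Lemma ln_succ_bounds n : (0 < n)%N ->
  (n.+1%:R : R)^-1 <= ln n.+1%:R - ln n%:R <= (n%:R : R)^-1.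
Proof.
move=> n0; have n0' : 0 < (n%:R : R) by rewrite ltr0n.
rewrite -ln_div ?posrE//; apply/andP; split.
  have : 0 < n%:R / n.+1%:R :> R by rewrite divr_gt0.
  move=> /ln_le_subr1; rewrite !ln_div ?posrE//.
  have -> : n%:R / n.+1%:R - 1 = - (n.+1%:R : R)^-1.
    by rewrite -(natr1 n); field; rewrite natr1 pnatr_eq0.
  by move=> h; rewrite -lerN2 opprB.
have : 0 < n.+1%:R / n%:R :> R by rewrite divr_gt0.
move=> /ln_le_subr1.
rewrite (_ : n.+1%:R / n%:R - 1 = (n%:R : R)^-1)//.
by rewrite -(natr1 n); field; rewrite gt_eqF.
Qed.

(** Consecutive terms have ratio [(n + 1) ((n + 1) / n) ^ z / (z + n + 1)]. The numerator of ratio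
    minus [1] is split into two remainders of order [1 / n], which makes the relative increment
    [O(1 / n ^ 2)], as [ratio_ccvg] requires. *)
Lemma eulerS n z : (0 < n)%N -> ~ Gamma_pole z ->
  euler n.+1 z - euler n z = euler n z *
   ((n.+1%:R * (cexp (z * (ln n.+1%:R - ln n%:R)%:C) - 1 - z * (ln n.+1%:R - ln n%:R)%:C) +
     z * (n.+1%:R * (ln n.+1%:R - ln n%:R) - 1)%:C) / (z + n.+1%:R)).
Proof.
move=> n0 np; have hp := prod_neq0 n.+1 np; have := prod_neq0 n.+2 np.
rewrite big_ord_recr/= mulf_eq0 negb_or => /andP[_ hn].
rewrite /euler !cpowE ?ltr0n// [in X in X - _]big_ord_recr/= factS natrM.
have -> : z * (ln n.+1%:R - ln n%:R)%:C = z * (ln n.+1%:R)%:C - z * (ln n%:R)%:C.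
  by rewrite rmorphB mulrBr.
rewrite cexpB rmorphB rmorphM rmorphB rmorph1 /= -!natC.
have := cexp_neq0 (z * (ln n%:R)%:C).
move: (cexp _) (cexp _) hp => E1 E2; set P := \prod_(i < n.+1) _ => hp hE.
move: (n.+1%:R : R[i]) hn => S hn.
by field; rewrite hp hE hn.
Qed.

Lemma euler_ccvg z : ~ Gamma_pole z -> exists2 w, w != 0 & ccvg \oo (fun n => euler n z) w.
Proof.
move=> np.
pose A := normc z; have A0 : 0 <= A := normc_ge0 z.
(* The outer [2] comes from [|z + n + 1| >= (n + 1) / 2], and [10] is the [5] of [normc_cexp_sub]
   times the bound [2] for [(n + 1) / n]. *)
pose C := 2 * (10 * A ^+ 2 + A).
have C0 : 0 <= C by rewrite mulr_ge0// addr_ge0// mulr_ge0// sqr_ge0.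
have /= := nbhs_infty_ger (Num.max (2 * C) (2 * A + 1)).
case=> N _ hN; pose N' := N.+1.
have /(_ (leqnSn N)) := hN N'; rewrite /= ge_max => /andP[N2C N2A].
apply: (@ratio_ccvg _ C N') => //.
  rewrite /euler cpowE//; apply: mulf_neq0; last by rewrite invr_eq0 prod_neq0.
  by apply: mulf_neq0; [rewrite pnatr_eq0 -lt0n fact_gt0|exact: cexp_neq0].
move=> n Nn; have n0 : (0 < n)%N by exact: leq_trans Nn.
have n0' : 0 < (n%:R : R) by rewrite ltr0n.
have nA : 2 * A + 1 <= n%:R by apply: le_trans N2A _; rewrite ler_nat.
rewrite eulerS// normcM mulrC ler_wpM2r ?normc_ge0//.
have /andP[L1 L2] := ln_succ_bounds n0.
set L := ln _ - _ in L1 L2 *.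
have S0 : 0 < (n.+1%:R : R) by [].
have Sn : (n.+1%:R : R) = n%:R + 1 by rewrite natr1.
have L0 : 0 <= L by apply: le_trans L1; rewrite invr_ge0.
have B1 : normc (z * L%:C) <= A / n%:R.
  by rewrite normcM normcC ger0_norm// ler_wpM2l.
have B2 : normc (cexp (z * L%:C) - 1 - z * L%:C) <= 5 * (A / n%:R) ^+ 2.
  apply: le_trans (normc_cexp_sub _) _.
    by apply: le_trans B1 _; rewrite ler_pdivrMr//; lra.
  by rewrite ler_wpM2l// ler_pXn2r ?nnegrE ?normc_ge0// divr_ge0.
have B3 : `|n.+1%:R * L - 1| <= n%:R^-1.
  rewrite ger0_norm; last by rewrite subr_ge0 mulrC -ler_pdivrMr// div1r.
  apply: (@le_trans _ _ (n.+1%:R * n%:R^-1 - 1)); first by rewrite lerB// ler_wpM2l.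
  by rewrite Sn mulrDl divff ?gt_eqF// mul1r addrAC subrr add0r.
have B4 : n.+1%:R / 2 <= normc (z + n.+1%:R).
  have := le_normcD (z + n.+1%:R) (- z).
  by rewrite addrAC subrr add0r normcN normc_nat -/A Sn; lra.
have B4' : 0 < normc (z + n.+1%:R) by apply: lt_le_trans B4; rewrite divr_gt0.
rewrite normcM normcV ler_pdivrMr//.
apply: le_trans (le_normcD _ _) _; rewrite !normcM normc_nat normcC -/A.
apply: (@le_trans _ _ (n.+1%:R * (5 * (A / n%:R) ^+ 2) + A * n%:R^-1)).
  by rewrite lerD// ler_wpM2l.
apply: (@le_trans _ _ (C / (n%:R * n.+1%:R) * (n.+1%:R / 2))); last first.
  by rewrite ler_wpM2l// divr_ge0// mulr_ge0.
have -> : C / (n%:R * n.+1%:R) * (n.+1%:R / 2) = (10 * A ^+ 2 + A) / n%:R.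
  by rewrite /C; field; rewrite !gt_eqF.
have -> : n.+1%:R * (5 * (A / n%:R) ^+ 2) + A * n%:R^-1 = (5 * A ^+ 2 * (n.+1%:R / n%:R) + A) / n%:R.
  by field; rewrite !gt_eqF.
rewrite ler_pM2r ?invr_gt0// lerD2r.
have : n.+1%:R / n%:R <= 2 :> R.
  rewrite ler_pdivrMr// Sn; have : 1 <= (n%:R : R) by rewrite ler1n.
  lra.
by have := sqr_ge0 A; nra.
Qed.

Lemma Gamma_ccvg z : ~ Gamma_pole z -> ccvg \oo (fun n => euler n z) (Gamma z).
Proof. by move=> /euler_ccvg[w _ h]; rewrite GammaE (ccvg_lim h). Qed.

Lemma Gamma_neq0 z : ~ Gamma_pole z -> Gamma z != 0.
Proof. by move=> /euler_ccvg[w w0 h]; rewrite GammaE (ccvg_lim h). Qed.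

Lemma Gamma_at_pole z : Gamma_pole z -> Gamma z = 0.
Proof.
move=> [m zm]; rewrite GammaE; apply: ccvg_lim.
apply: (ccvg_near (f := fun=> 0)); last exact: ccvg_cst.
near=> n.
have mn : (m < n.+1)%N by rewrite ltnS; near: n; exact: nbhs_infty_ge.
rewrite /euler (bigD1 (Ordinal mn))//= zm addNr mul0r invr0 mulr0 //.
Unshelve. all: end_near. Qed.

End gamma_limit.

(** * The integral formula for psi *)

Section psi_integral.
Context {R : realType}.
Implicit Types (z w b : R[i]) (x y r : R).
Local Notation Re := complex.Re.
Local Notation Im := complex.Im.

Lemma cvg_muln_infty (l : nat) : (0 < l)%N -> (l * N)%N @[N --> \oo] --> \oo.
Proof.
move=> l0 A [n _ nA]; exists n => // N /= nN; apply: nA => /=.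
by apply: leq_trans nN _; rewrite leq_pmull.
Qed.

Lemma ccvg_comp {T U : Type} (f : T -> U) (g : U -> R[i]) (F : set_system T) (G : set_system U) z :
  f @ F --> G -> ccvg G g z -> ccvg F (fun t => g (f t)) z.
Proof. by move=> fG [a b]; split; [exact: cvg_comp fG a|exact: cvg_comp fG b]. Qed.

Lemma cvg_invn : (n%:R : R)^-1 @[n --> \oo] --> (0 : R).
Proof. have h := @cvg_harmonic R; rewrite -cvg_shiftS; exact: h. Qed.

Lemma ccvg_invn : ccvg \oo (fun n => (n%:R : R[i])^-1) 0.
Proof.
apply: (ccvg_near (f := fun n => (n%:R^-1 : R)%:C)).
  by near=> n; rewrite natC fmorphV.
by split; [exact: cvg_invn|exact: cvg_cst].
Unshelve. all: end_near. Qed.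

(* [(z + 1) ... (z + n)]: the usual Pochhammer symbol of [z + 1]. *)
Definition poch n z := \prod_(i < n) (z + i.+1%:R).

Lemma pochS n z : poch n.+1 z = poch n z * (z + n.+1%:R).
Proof. by rewrite /poch big_ord_recr. Qed.

Lemma poch_nat n : poch n 0 = n`!%:R.
Proof.
elim: n => [|n IH]; first by rewrite /poch big_ord0.
by rewrite pochS IH add0r factS -natrM mulnC.
Qed.

Lemma poch_neq0 n z : -1 < Re z -> poch n z != 0.
Proof.
move=> z1; apply/prodf_neq0 => i _; apply/eqP => /(congr1 (@complex.Re R)).
rewrite !ReImE => h; have : (0 : R) <= i%:R by [].
by rewrite -natr1 in h; lra.
Qed.

Lemma not_pole z : 0 < Re z -> ~ Gamma_pole z.
Proof.
move=> z0 [n /(congr1 (@complex.Re R))]; rewrite cReN Re_nat => h.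
by have : (0 : R) <= n%:R by []; lra.
Qed.

(** Approximates [1 / Gamma (z + 1)], an entire function, so poles of [Gamma] become mere zeros. The
    shift by [1] matches the three arguments in [psi_quotient]. *)
Definition inv_euler n z := poch n z / (n`!%:R * cpow n%:R z).

(* At a pole of [Gamma] both sides are [0], because [0^-1 = 0]. *)
Lemma inv_euler_ccvg z : ccvg \oo (fun n => inv_euler n z) (Gamma (z + 1))^-1.
Proof.
have [pz|np] := pselect (Gamma_pole (z + 1)).
  rewrite (Gamma_at_pole pz) invr0; apply: (ccvg_near (f := fun=> 0)); last exact: ccvg_cst.
  case: pz => m /eqP; rewrite -subr_eq0 opprK -addrA nat1r => /eqP zm.
  near=> n; have mn : (m < n)%N by near: n; exact: nbhs_infty_gt.
  by rewrite /inv_euler /poch (bigD1 (Ordinal mn))//= zm !mul0r.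
have L1 := @ccvgV R _ \oo (@eventually_filter) _ _ (Gamma_neq0 np) (Gamma_ccvg np).
(* The ratio of [inv_euler n z] to the inverse of [euler n (z + 1)]: the latter has one more factor
   [z + 1 + n], and its power one more factor [n]. *)
have L2 : ccvg \oo (fun n => ((z + 1) * (n%:R)^-1 + 1)^-1) 1.
  rewrite -[X in ccvg _ _ X]invr1; apply: ccvgV; first exact: oner_neq0.
  rewrite -[X in ccvg _ _ X]add0r; apply: ccvgD; last exact: ccvg_cst.
  by rewrite -(mulr0 (z + 1)); apply: ccvgM; [exact: ccvg_cst|exact: ccvg_invn].
have := @ccvgM R _ \oo (@eventually_filter) _ _ _ _ L1 L2; rewrite mulr1; apply: ccvg_near.
near=> n; have n0 : (0 < n)%N by near: n; exact: nbhs_infty_gt.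
have hn := prod_neq0 n.+1 np.
have nn := @natC_neq0 R _ n0; have nf := @factC_neq0 R n.
have eP : \prod_(i < n.+1) (z + 1 + i%:R) = poch n z * (z + 1 + n%:R).
  rewrite big_ord_recr/=; congr (_ * _); apply: eq_bigr => i _.
  by rewrite -addrA nat1r.
rewrite /inv_euler /euler eP in hn *.
move: hn; rewrite mulf_eq0 negb_or => /andP[h1 h2].
have -> : cpow n%:R (z + 1) = cpow n%:R z * n%:R.
  by rewrite !cpowE ?ltr0n// mulrDl mul1r cexpD cexpC lnK ?posrE ?ltr0n// -natC.
have e0 : cpow n%:R z != 0 by rewrite cpowE ?ltr0n// cexp_neq0.
move: (poch n z) (cpow n%:R z) (n`!%:R) (n%:R : R[i]) e0 h1 h2 nf nn => P E f S.
move=> e0 h1 h2 nf nn.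
have h3 : (z + 1) * S^-1 + 1 != 0.
  have -> : (z + 1) * S^-1 + 1 = (z + 1 + S) / S by field.
  by rewrite mulf_neq0// invr_eq0.
have -> : (z + 1) / S + 1 = (z + 1 + S) / S by field.
by field; rewrite h1 h2 nf nn e0.
Unshelve. all: end_near. Qed.

Section integral.
Variables (p : R) (p1 : 1 < p).
Let p0 : 0 < p. Proof. exact: lt_trans ltr01 p1. Qed.

(* [pi^-1] times the integral of [rho ^ b * omega r] along the curve. *)
Definition cJ b r : R[i] :=
  (curve_integral p cos (Re b) (Im b) r / pi) +i* (curve_integral p sin (Re b) (Im b) r / pi).

Let RecJ b r : Re (cJ b r) = curve_integral p cos (Re b) (Im b) r / pi. Proof. by []. Qed.
Let ImcJ b r : Im (cJ b r) = curve_integral p sin (Re b) (Im b) r / pi. Proof. by []. Qed.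

Lemma cJ_recurrence b r : 0 < p * Re b + r ->
  ((p - 1)%:C * b + r%:C) * cJ b r = (p%:C * b + r%:C) * cJ b (r - 1).
Proof.
move=> br; have nsc : continuous (fun y : R => - sin y) by move=> y; apply: cvgN; exact: continuous_sin.
have ns1 (y : R) : `|- sin y| <= 1 by rewrite normrN sin_max.
have dc (y : R) : is_derive y 1 cos (- sin y) by exact: is_derive_cos.
have ds (y : R) : is_derive y 1 sin (cos y) by exact: is_derive_sin.
have h1 := curve_recurrence p1 (@continuous_cos R) (@cos_max R) nsc ns1 dc (Im b) br.
have h2 := curve_recurrence p1 (@continuous_sin R) (@sin_max R) (@continuous_cos R) (@cos_max R) ds (Im b) br.
have br1 : -1 < p * Re b + r by apply: lt_trans br; rewrite ltrN10.
have br2 : -1 < p * Re b + (r - 1) by lra.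
rewrite !(curve_integral_N p1 _ (@continuous_sin R) (@sin_max R))// in h1.
move: (RecJ b r) (ImcJ b r) (RecJ b (r - 1)) (ImcJ b (r - 1)).
move: (cJ b r) (cJ b (r - 1)) => J J' E1 E2 E3 E4.
apply: complexP; rewrite !(cReD, cImD, cReM, cImM, cReC, cImC) ?E1 ?E2 ?E3 ?E4 !mul0r !subr0 !addr0.
- by have := congr1 (fun t => t / pi) h1; rewrite /=; lra.
- by have := congr1 (fun t => t / pi) h2; rewrite /=; lra.
Qed.

Lemma cJ_shift b r : -1 < p * (Re b + 1) + r ->
  cJ b (r + p) = cJ (b + 1) (r + 1) - cJ (b + 1) r.
Proof.
move=> br; have h1 := curve_shift p1 (@continuous_cos R) (@cos_max R) (Im b) br.
have h2 := curve_shift p1 (@continuous_sin R) (@sin_max R) (Im b) br.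
apply: complexP; rewrite ?cReB ?cImB /cJ /= !cReD !cImD/= !addr0; rewrite ?h1 ?h2; ring.
Qed.

Lemma cJ_step1 b r : -1 < p * Re b + r ->
  ((p - 1)%:C * b + r%:C + 1) * cJ b (r + 1) = (p%:C * b + r%:C + 1) * cJ b r.
Proof.
move=> br; have := @cJ_recurrence b (r + 1); rewrite addrA addrK => h.
rewrite -!addrA; have -> : r%:C + 1 = (r + 1)%:C :> R[i] by rewrite rmorphD.
by apply: h; lra.
Qed.

(** The shift combined with the recurrence at [b + 1]. The move from [(b, r)] to
    [(b + 1, r + 1 - p)] raises [p b + r] by [1] and fixes [(p - 1) b + r], whereas [cJ_step1]
    raises both; so iterating either one never leaves the domain. *)
Lemma cJ_step2 b r : -1 < p * Re b + r ->
  (p%:C * b + r%:C + 1) * cJ b r = (b + 1) * cJ (b + 1) (r + 1 - p).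
Proof.
move=> br; have := @cJ_shift b (r - p); rewrite subrK => -> //; last by rewrite mulrDr; lra.
have := @cJ_recurrence (b + 1) (r + 1 - p).
have -> : r + 1 - p - 1 = r - p by ring.
have -> : r - p + 1 = r + 1 - p by ring.
rewrite cReD /= => h; have {}h := h ltac:(rewrite mulrDr; lra).
rewrite mulrBr.
have -> : p%:C * b + r%:C + 1 = p%:C * (b + 1) + (r + 1 - p)%:C.
  by rewrite rmorphB rmorphD rmorph1; ring.
rewrite -h -mulrBl; congr (_ * _).
by rewrite !rmorphB rmorphD rmorph1; ring.
Qed.

Lemma cJ_iter1 j b r : -1 < p * Re b + r ->
  poch j (p%:C * b + r%:C) * cJ b r = poch j ((p - 1)%:C * b + r%:C) * cJ b (r + j%:R).
Proof.
move=> br; elim: j => [|j IH]; first by rewrite /poch !big_ord0 addr0.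
have br' : -1 < p * Re b + (r + j%:R).
  by rewrite addrA; apply: lt_le_trans br _; rewrite lerDl.
have := cJ_step1 br'; rewrite !pochS mulrAC IH => h.
rewrite mulrAC -!mulrA; congr (_ * _); move: h.
have -> : (r + j%:R)%:C = r%:C + j%:R :> R[i] by rewrite rmorphD natC.
by rewrite -!addrA !natr1 !addrA mulrC => <-; rewrite mulrC.
Qed.

Lemma cJ_iter2 i b r : -1 < p * Re b + r ->
  poch i (p%:C * b + r%:C) * cJ b r = poch i b * cJ (b + i%:R) (r + i%:R * (1 - p)).
Proof.
move=> br; elim: i => [|i IH]; first by rewrite /poch !big_ord0 mul0r !addr0.
have br' : -1 < p * Re (b + i%:R) + (r + i%:R * (1 - p)).
  rewrite cReD Re_nat.
  have -> : p * (Re b + i%:R) + (r + i%:R * (1 - p)) = p * Re b + r + i%:R by ring.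
  by apply: lt_le_trans br _; rewrite lerDl.
have := cJ_step2 br'; rewrite !pochS mulrAC IH => h.
rewrite mulrAC -!mulrA; congr (_ * _).
have e1 : p%:C * (b + i%:R) + (r + i%:R * (1 - p))%:C + 1 = p%:C * b + r%:C + i.+1%:R.
  by rewrite rmorphD rmorphM rmorphB rmorph1 /= -natC -natr1; ring.
have e2 : r + i%:R * (1 - p) + 1 - p = r + i.+1%:R * (1 - p) by rewrite -natr1; ring.
rewrite e1 e2 -!addrA natr1 in h.
by rewrite -addrA h.
Qed.

Section rational.
Variables (k l : nat) (l0 : (0 < l)%N) (lk : (l < k)%N) (pkl : p = k%:R / l%:R).

Let kR : 0 < (k%:R : R). Proof. by rewrite ltr0n (leq_trans _ lk). Qed.
Let lR : 0 < (l%:R : R). Proof. by rewrite ltr0n. Qed.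
Let m := (k - l)%N.
Let m0 : (0 < m)%N. Proof. by rewrite subn_gt0. Qed.
Let k0 : (0 < k)%N. Proof. exact: leq_trans lk. Qed.
Let klm : k = (l + m)%N. Proof. by rewrite subnKC// ltnW. Qed.

Lemma cJ_iterate N b r : -1 < p * Re b + r ->
  poch (k * N) (p%:C * b + r%:C) * cJ b r =
  poch (l * N) b * poch (m * N) ((p - 1)%:C * b + r%:C) * cJ (b + (l * N)%:R) r.
Proof.
move=> br; have h2 := cJ_iter2 (l * N) br.
have pE : (l * N)%:R * (1 - p) = - (m * N)%:R.
  have -> : p = (l%:R + m%:R) / l%:R by rewrite pkl klm natrD.
  by rewrite !natrM; field; rewrite gt_eqF.
rewrite pE in h2.
have br' : -1 < p * Re (b + (l * N)%:R) + (r - (m * N)%:R).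
  rewrite cReD Re_nat -pE.
  have -> : p * (Re b + (l * N)%:R) + (r + (l * N)%:R * (1 - p)) = p * Re b + r + (l * N)%:R.
    by ring.
  by apply: lt_le_trans br _; rewrite lerDl.
have h1 := cJ_iter1 (m * N) br'; rewrite subrK in h1.
have eC : (r - (m * N)%:R)%:C = r%:C + (l * N)%:R * (1 - p%:C) :> R[i].
  by rewrite -pE rmorphD; congr (_ + _); rewrite rmorphM rmorphB rmorph1 natC.
have e1 : p%:C * (b + (l * N)%:R) + (r - (m * N)%:R)%:C = p%:C * b + r%:C + (l * N)%:R.
  by rewrite eC; ring.
have e2 : (p - 1)%:C * (b + (l * N)%:R) + (r - (m * N)%:R)%:C = (p - 1)%:C * b + r%:C.
  by rewrite eC rmorphB rmorph1; ring.
rewrite e1 e2 in h1.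
have pochD i j z : poch (i + j) z = poch i z * poch j (z + i%:R).
  rewrite /poch big_split_ord/=; congr (_ * _); apply: eq_bigr => t _.
  by rewrite -addrA -natrD addnS.
rewrite [in LHS]klm mulnDl pochD mulrAC h2 mulrAC -mulrA -[RHS]mulrA -h1.
by rewrite mulrC -!mulrA; congr (_ * _); rewrite mulrC.
Qed.

Lemma cJ00 : cJ 0 0 = 1.
Proof.
rewrite /cJ /= curve_integral00// divff ?gt_eqF ?pi_gt0//.
by rewrite curve_integral_sin0 mul0r.
Qed.

(** The case [b = r = 0] of [cJ_iterate], where [cJ] is [1]. Dividing by it removes the unknown size
    of [cJ (b + l N) r]. *)
Lemma cJ_nat N : (k * N)`!%:R = (l * N)`!%:R * (m * N)`!%:R * cJ (l * N)%:R 0.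
Proof.
have := @cJ_iterate N 0 0; rewrite /= mulr0 addr0 => /(_ (ltrN10 R)).
have -> : (0 : R)%:C = 0 :> R[i] by [].
by rewrite cJ00 !mulr0 !add0r mulr1 !poch_nat.
Qed.

Lemma cJ_natE N : cJ (l * N)%:R 0 = (curve_integral p cos (l * N)%:R 0 0 / pi)%:C.
Proof.
apply: complexP; first by rewrite /cJ /= Re_nat Im_nat.
rewrite /cJ /= Re_nat Im_nat.
by rewrite curve_integral_sin0 mul0r.
Qed.

(** The limit is [c(p) ^ b * (p / (p - 1)) ^ r], the value of [rho ^ b * B ^ r] at the saddle
    point. *)
Lemma cJ_ratio_ccvg b r : -1 < p * Re b + r ->
  ccvg \oo (fun N => cJ (b + (l * N)%:R) r / cJ (l * N)%:R 0)
    (cexp (b * (p * ln p - (p - 1) * ln (p - 1))%:C + (r * (ln p - ln (p - 1)))%:C)).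
Proof.
move=> br.
have h1 := curve_concentration p1 (@continuous_cos R) (@cos_max R) br (b2 := Im b).
have h2 := curve_concentration p1 (@continuous_sin R) (@sin_max R) br (b2 := Im b).
cbv zeta in h1, h2; have lN := cvg_muln_infty l0.
have {}h1 := @cvg_comp _ _ _ (fun N => (l * N)%N) _ _ _ _ lN h1.
have {}h2 := @cvg_comp _ _ _ (fun N => (l * N)%N) _ _ _ _ lN h2.
rewrite cexpD cexpC /cexp !ReImE !mulr0 !subr0 !add0r.
set L := p * ln p - _ in h1 h2 *; set E := expR (r * _) in h1 h2 *.
have cE N : cJ (b + (l * N)%:R) r / cJ (l * N)%:R 0 =
  (curve_integral p cos ((l * N)%:R + Re b) (Im b) r / curve_integral p cos (l * N)%:R 0 0) +i*
  (curve_integral p sin ((l * N)%:R + Re b) (Im b) r / curve_integral p cos (l * N)%:R 0 0).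
  rewrite cJ_natE -fmorphV /cJ !ReImE addr0 [Re b + _]addrC invfM invrK.
  have pi0 : (pi : R) != 0 by rewrite gt_eqF ?pi_gt0.
  move: (curve_integral _ _ _ _ _) (curve_integral _ _ _ _ _) (curve_integral _ _ _ _ _) => c c' s.
  apply: complexP; rewrite !ReImE /= !mulr0 ?subr0 ?add0r mulrACA mulVf// mulr1 //.
apply: (ccvg_near (f := fun N =>
  (curve_integral p cos ((l * N)%:R + Re b) (Im b) r / curve_integral p cos (l * N)%:R 0 0) +i*
  (curve_integral p sin ((l * N)%:R + Re b) (Im b) r / curve_integral p cos (l * N)%:R 0 0))).
  by near=> N; rewrite cE.
split; rewrite !ReImE/= !mul0r !mulr0 ?subr0 ?add0r ?addr0.
  exact: h1.
exact: h2.
Unshelve. all: end_near. Qed.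

(** The hypothesis keeps only the numerator off the poles of [Gamma]. The two arguments in the
    denominator may be poles, which is why they enter through [inv_euler]. *)
Lemma psi_quotientE b r : -1 < p * Re b + r -> psi_quotient p r (b + 1) = cJ b r.
Proof.
move=> br; rewrite /psi_quotient addrK.
have -> : b * p%:C + r%:C + 1 = p%:C * b + r%:C + 1 by rewrite [b * _]mulrC.
have -> : b * (p - 1)%:C + r%:C + 1 = (p - 1)%:C * b + r%:C + 1 by rewrite [b * _]mulrC.
set a := p%:C * b + r%:C; set a' := (p - 1)%:C * b + r%:C.
have Ra : -1 < Re a by rewrite /a !ReImE mul0r subr0.
have npa : ~ Gamma_pole (a + 1) by apply: not_pole; rewrite cReD /=; lra.
have L1 := ccvg_comp (cvg_muln_infty l0) (inv_euler_ccvg b).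
have L2 := ccvg_comp (cvg_muln_infty m0) (inv_euler_ccvg a').
have L3 := ccvg_comp (cvg_muln_infty k0) (inv_euler_ccvg a).
have {}L3 := @ccvgV R _ \oo (@eventually_filter) _ _ (invr_neq0 (Gamma_neq0 npa)) L3; rewrite invrK in L3.
have L4 := cJ_ratio_ccvg br.
(* As [a = b + a'], the powers of [N] in the three Euler products cancel, and [K] is what is left of
   [l N], [m N] and [k N]. It is inverse to the limit in [cJ_ratio_ccvg]. *)
pose K := cexp (b * (ln l%:R)%:C + a' * (ln m%:R)%:C - a * (ln k%:R)%:C).
have cM := @ccvgM R _ \oo (@eventually_filter).
have L := cM _ _ _ _ (cM _ _ _ _ (cM _ _ _ _ L1 L2) L3) (cM _ _ _ _ (@ccvg_cst R _ \oo _ K) L4).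
have K1 : K * cexp (b * (p * ln p - (p - 1) * ln (p - 1))%:C + (r * (ln p - ln (p - 1)))%:C) = 1.
  rewrite -cexpD -[RHS]cexp0; congr cexp.
  have mE : m%:R = k%:R - l%:R :> R by have := congr1 (fun n => n%:R : R) klm; rewrite /= natrD; lra.
  have mn : 0 < (m%:R : R) by rewrite ltr0n.
  have -> : p - 1 = m%:R / l%:R by rewrite pkl mE; field; rewrite gt_eqF.
  rewrite ln_div ?posrE// [in ln p]pkl ln_div ?posrE//.
  rewrite /a /a'.
  have -> : (p - 1)%:C = p%:C - 1 by rewrite rmorphB.
  have -> : m%:R / l%:R = p - 1 by rewrite pkl mE; field; rewrite gt_eqF.
  rewrite !(rmorphD, rmorphM, rmorphB, rmorphN) rmorph1 /=; ring.
rewrite K1 mulr1 in L; rewrite invfM mulrC.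
(* For each [N > 0] the product is exactly [cJ b r]: it is [cJ_iterate] divided by [cJ_nat]. *)
apply: ccvg_unique (L _) _; apply: (ccvg_near (f := fun=> cJ b r)); last exact: ccvg_cst.
near=> N; have N0 : (0 < N)%N by near: N; exact: nbhs_infty_gt.
have := cJ_iterate N br; rewrite -/a -/a' => hJ.
have hN := cJ_nat N.
rewrite /inv_euler.
have NR : 0 < (N%:R : R) by rewrite ltr0n.
have powE i z : (0 < i)%N -> cpow (i * N)%:R z = cexp (z * (ln i%:R)%:C) * cexp (z * (ln N%:R)%:C) :> R[i].
  move=> i0; rewrite cpowE ?ltr0n ?muln_gt0 ?i0// natrM lnM ?posrE ?ltr0n//.
  by rewrite rmorphD mulrDr cexpD.
rewrite !powE//.
have -> : cexp (a * (ln N%:R)%:C) = cexp (b * (ln N%:R)%:C) * cexp (a' * (ln N%:R)%:C) :> R[i].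
  rewrite -cexpD; congr cexp; rewrite /a /a' rmorphB rmorph1; ring.
rewrite /K cexpB cexpD.
have pa := poch_neq0 (k * N) Ra.
have f1 := @factC_neq0 R (k * N); have f2 := @factC_neq0 R (l * N); have f3 := @factC_neq0 R (m * N).
have f4 : cJ (l * N)%:R 0 != 0.
  by apply: contra f1; rewrite hN => /eqP ->; rewrite mulr0.
have e1 := cexp_neq0 (b * (ln l%:R)%:C); have e2 := cexp_neq0 (a' * (ln m%:R)%:C).
have e3 := cexp_neq0 (a * (ln k%:R)%:C); have e4 := cexp_neq0 (b * (ln N%:R)%:C).
have e5 := cexp_neq0 (a' * (ln N%:R)%:C).
apply: (mulfI pa); rewrite hJ.
move: hN f1 f2 f3 f4 e1 e2 e3 e4 e5 pa.
move: (cexp _) (cexp _) (cexp _) (cexp _) (cexp _) (cJ (l * N)%:R 0) (cJ _ _) (_`!%:R) (_`!%:R) (_`!%:R).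
move=> E1 E2 E3 E4 E5 J0 J F1 F2 F3 -> f1 f2 f3 f4 e1 e2 e3 e4 e5 pa.
field; rewrite ?f2 ?f3 ?f4 ?e1 ?e2 ?e3 ?e4 ?e5 ?pa //.
Unshelve. all: end_near. Qed.

End rational.
End integral.
End psi_integral.

(** * Mellin inversion *)

Section density.
Context {R : realType}.
Notation mu := (@lebesgue_measure R).
Variable p : R.
Hypothesis p1 : 1 < p.

Let q := p - 1.
Let e := pi / p : R.
Let p0 : 0 < p. Proof. exact: lt_trans ltr01 p1. Qed.
Let e0 : 0 < e. Proof. by rewrite divr_gt0// pi_gt0. Qed.

Definition c_max : R := expR (p * ln p - (p - 1) * ln (p - 1)).

Local Notation theta := (@theta R p).
Local Notation omega := (@omega R p).
Local Notation dtheta := (@dtheta R p).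

Definition rho x := expR (theta x).
Definition rho' x := rho x * dtheta x.

Lemma is_derive_rho (x : R) : 0 < x < e -> is_derive x 1 rho (rho' x).
Proof. by move=> xe; have h := is_derive_theta p1 xe; rewrite /rho /rho'; drv; exact: h. Qed.

Lemma rho_cont (x : R) : 0 < x < e -> {for x, continuous rho}.
Proof. by move=> xe; apply: is_derive_cont (is_derive_rho xe). Qed.

Lemma rho'_lt0 x : 0 < x < e -> rho' x < 0.
Proof. by move=> xe; rewrite /rho' pmulr_rlt0 ?expR_gt0//; exact: dtheta_lt0. Qed.

Lemma derivable_dtheta (x : R) : 0 < x < e -> exists d, is_derive x 1 dtheta d.
Proof.
move=> xe; have [h1 h2 h3] := curve_sin_gt0 p1 xe; eexists; rewrite /dtheta.
by drv; rewrite ?gt_eqF.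
Qed.

Lemma dtheta_cont (x : R) : 0 < x < e -> {for x, continuous dtheta}.
Proof. by move=> /derivable_dtheta[d /is_derive_cont]. Qed.

Lemma rho'_cont (x : R) : 0 < x < e -> {for x, continuous rho'}.
Proof. by move=> xe; apply: cvgM; [exact: rho_cont|exact: dtheta_cont]. Qed.

Lemma rho_right : rho x @[x --> 0^'+] --> c_max.
Proof.
apply: (@cvg_comp _ _ _ theta (@expR R) _ (nbhs (p * ln p - q * ln q))).
  exact: theta_right_cvg.
exact: continuous_expR.
Qed.

Lemma rho_left : rho x @[x --> e^'-] --> (0 : R).
Proof.
have [M MP] := curve_bound p1 1 0.
have L := @expR_ln_left_cvg0 R p e (M / p) p0.
apply: squeeze_norm0 L; near=> x.
have xe : 0 < x < e by near: x; exact: near_left_oo.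
rewrite ger0_norm ?expR_ge0// [M / p * _]mulrAC ler_pdivlMr//.
have := MP x xe; rewrite mul1r mul0r addr0 mulr1 addr0; apply: le_trans.
by rewrite ler_wpM2l ?expR_ge0// lerDl.
Unshelve. all: end_near. Qed.

Lemma rho_range (x : R) : 0 < x < e -> 0 < rho x < c_max.
Proof.
move=> xe; have H := dec_range is_derive_rho rho'_lt0.
have H1 := H _ _ rho_right rho_left; exact: H1.
Qed.

Lemma rho_inj x y : 0 < x < e -> 0 < y < e -> rho x = rho y -> x = y.
Proof.
move=> /andP[x1 x2] /andP[y1 y2] /expR_inj xy.
case: (ltgtP x y) => // h.
- by have := theta_dec p1 x1 h y2; rewrite xy ltxx.
- by have := theta_dec p1 y1 h x2; rewrite xy ltxx.
Qed.

Lemma rho_surj y : 0 < y < c_max -> exists2 x, 0 < x < e & rho x = y.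
Proof.
move=> /andP[y0 yc].
near (0 : R)^'+ => a.
have a0 : 0 < a by near: a; exact: nbhs_right_gt.
have ae : a < e by near: a; exact: nbhs_right_lt.
have ya : y < rho a by near: a; exact: (cvgr_gt _ rho_right _ yc).
near e^'- => b.
have b0 : a < b by near: b; exact: nbhs_left_gt.
have be : b < e by near: b; exact: nbhs_left_lt.
have yb : rho b < y by near: b; exact: (cvgr_lt _ rho_left _ y0).
have [||x] := @IVT R rho a b y (ltW b0).
- apply: cont_within => x /andP[h1 h2]; apply: rho_cont.
  by rewrite (lt_le_trans a0)//= (le_lt_trans h2).
- by rewrite ge_min le_max (ltW yb) (ltW ya) orbT.
- rewrite in_itv/= => /andP[h1 h2] <-; exists x => //.
  by rewrite (lt_le_trans a0)//= (le_lt_trans h2).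
Unshelve. all: end_near. Qed.

Definition angle y := xget 0 [set x | 0 < x < e /\ rho x = y].

Lemma angleP y : 0 < y < c_max -> 0 < angle y < e /\ rho (angle y) = y.
Proof. by move=> /rho_surj[x xe xy]; rewrite /angle; case: xgetP => [z -> //|/(_ x)[]]. Qed.

Lemma rhoK (x : R) : 0 < x < e -> angle (rho x) = x.
Proof. by move=> xe; have [h1 h2] := angleP (rho_range xe); exact: rho_inj. Qed.

(** This is [1 / (pi y)] times the imaginary part of [B ^ (r + 1) / (p - q B)], where
    [B = 1 + B ^ p / y] is on the curve. As that fraction generates the binomial coefficients of
    [p n + r] over [n], the formula is an instance of Stieltjes inversion. *)
Definition density r y := omega r (angle y) / (pi * - rho' (angle y)).

(** What [mellin_kernel_cvg] asks of the density at a point; [angle] is differentiable as the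
    inverse of [rho], whose derivative does not vanish. *)
Lemma derivable_density r (y : R) : 0 < y < c_max -> exists d, is_derive y 1 (density r) d.
Proof.
move=> yc; have [xe xy] := angleP yc; set x := angle y in xe xy.
have da : is_derive y 1 angle (rho' x)^-1.
  rewrite -xy; apply: is_derive_inverse.
  - by apply: filterS (near_oo xe) => z; exact: rhoK.
  - by apply: filterS (near_oo xe) => z; exact: rho_cont.
  - exact: is_derive_rho.
  - by rewrite lt_eqF// rho'_lt0.
have [h1 h2 h3] := curve_sin_gt0 p1 xe.
have [dd hd] := derivable_dtheta xe.
have hr := is_derive_rho xe; have hl := is_derive_lnA p1 xe.
have [dw hw] : exists d, is_derive x 1 (fun x => omega r x / (pi * - (rho x * dtheta x))) d.
  eexists; rewrite /omega /cotdiff; drv; try exact: hd; try exact: hr; try exact: hl; rewrite ?gt_eqF//.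
  by rewrite mulr_gt0 ?pi_gt0// oppr_gt0; exact: rho'_lt0.
by eexists; exact: (drv_comp da hw).
Qed.

Lemma density_cont r (y : R) : 0 < y < c_max -> {for y, continuous (density r)}.
Proof. by move=> /(derivable_density r)[d /is_derive_cont]. Qed.

Lemma density_integral (h : R -> R) b1 b2 r : continuous h -> (forall y, `|h y| <= 1) ->
  -1 < p * b1 + r ->
  mu.-integrable `]0, c_max[ (EFin \o (fun y => expR (b1 * ln y) * h (b2 * ln y) * density r y)) /\
  \int[mu]_(y in `]0, c_max[) (expR (b1 * ln y) * h (b2 * ln y) * density r y) =
  curve_integral p h b1 b2 r / pi.
Proof.
move=> hc h1 br; pose G y := expR (b1 * ln y) * h (b2 * ln y) * density r y.
have cG (y : R) : 0 < y < c_max -> {for y, continuous G}.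
  move=> yc; have /andP[y0 _] := yc.
  have cl (a : R) : {for y, continuous (fun y => a * ln y)} by drvc.
  apply: cvgM; last exact: density_cont.
  apply: cvgM.
    by apply: continuous_comp; [exact: cl|exact: continuous_expR].
  by apply: continuous_comp; [exact: cl|exact: hc].
have GE x : 0 < x < e -> G (rho x) * - rho' x = pi^-1 * (wave p h b1 b2 x * omega r x).
  move=> xe; rewrite /G /density rhoK// /wave /rho expRK.
  have := rho'_lt0 xe; have := pi_gt0 R.
  by move: (pi : R) (rho' x) => P r' P0 r0; field; rewrite (lt_eqF r0) (gt_eqF P0).
have iG : mu.-integrable `]0, e[ (EFin \o (fun x => G (rho x) * - rho' x)).
  have := integrable_mulr pi^-1 (measurable_itv _) (wave_integrable p1 hc h1 b2 br).
  by apply: eq_integrable => // x; rewrite inE/= in_itv/= => xe; rewrite GE.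
have [i E] := substitution_oo e0 is_derive_rho rho'_cont rho'_lt0 rho_right rho_left cG iG.
split=> //; rewrite E mulrC /curve_integral -RintegralZl//; last exact: wave_integrable.
by apply: eq_Rintegral => x; rewrite inE/= in_itv/= => xe; exact: GE.
Qed.

End density.

(** * Truncated line integrals as Dirichlet integrals *)

Section line_integrals.
Context {R : realType}.
Notation mu := (@lebesgue_measure R).
Implicit Types (z w : R[i]) (x y r : R).
Local Notation Re := complex.Re.
Local Notation Im := complex.Im.

Lemma Rintegral_sin0 (T u : R) : 0 <= T -> \int[mu]_(t in `[- T, T]) sin (t * u) = 0.
Proof.
move=> T0; have TT : - T <= T by rewrite ge0_cp.
have [->|u0] := eqVneq u 0.
  under eq_Rintegral do rewrite mulr0 sin0.
  by rewrite Rintegral_cst//= mul0r.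
have dF (t : R) : - T <= t <= T -> is_derive t 1 (fun t => - (cos (t * u) / u)) (sin (t * u)).
  by move=> _; drve => //; field.
rewrite (FTC_seg TT dF); first by rewrite mulNr cosN subrr.
by move=> t _; drvc.
Qed.

(** Accounts for the change of variable from [u] to [l u], by which the Meijer integrand is compared
    with [psi]. *)
Lemma dirichlet_scale (T tau u : R) : 0 <= T -> 0 < tau ->
  dirichlet T (tau * u) = tau^-1 * dirichlet (tau * T) u.
Proof.
move=> T0 tau0; have [->|u0] := eqVneq u 0.
  have d0 (S : R) : 0 <= S -> dirichlet S 0 = 2 * S.
    move=> S0; rewrite /dirichlet; under eq_Rintegral do rewrite mulr0 cos0.
    rewrite Rintegral_cst//= lebesgue_measure_itv/= lte_fin mul1r.
    case: ifPn => [h|]; first by rewrite /= opprK; ring.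
    rewrite -leNgt => h; have -> : S = 0 by lra.
    by rewrite mulr0.
  by rewrite mulr0 !d0// ?mulr_ge0 ?(ltW tau0)//; field; rewrite gt_eqF.
rewrite !dirichletE ?mulf_neq0 ?(gt_eqF tau0)// ?mulr_ge0 ?(ltW tau0)//.
have -> : T * (tau * u) = tau * T * u by ring.
by field; rewrite u0 gt_eqF.
Qed.

Section kernel.
Variables (g u : R -> R) (a b : R).
Hypotheses (cu : forall x, a < x < b -> {for x, continuous u})
  (gi : mu.-integrable `]a, b[ (EFin \o g)).

(** On the line, [F] is [K] times the integral of [g x * exp(i t u x)]. By Fubini a truncation in
    [t] puts [dirichlet] under the integral; the sine part is odd in [t] and drops out, and the ['i]
    of the parametrization cancels that of [2 pi i]. *)
Lemma line_integral_kernel (F : R[i] -> R[i]) (d K L : R) :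
  (forall t, F (d +i* t) = (K * \int[mu]_(x in `]a, b[) (g x * cos (t * u x))) +i*
                           (K * \int[mu]_(x in `]a, b[) (g x * sin (t * u x)))) ->
  \int[mu]_(x in `]a, b[) (g x * dirichlet T (u x)) @[T --> +oo] --> L ->
  is_line_integral F d (K * L / (2 * pi))%:C.
Proof.
move=> FE gL.
have ic T := integrable_fubini_snd T gi cu (@continuous_cos R) (@cos_max R).
have is_ T := integrable_fubini_snd T gi cu (@continuous_sin R) (@sin_max R).
have ReF t : Re (F (d +i* t) * 'i%C) = - K * \int[mu]_(x in `]a, b[) (g x * sin (t * u x)).
  by rewrite FE cReM /= mulr0 mulr1 sub0r mulNr.
have ImF t : Im (F (d +i* t) * 'i%C) = K * \int[mu]_(x in `]a, b[) (g x * cos (t * u x)).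
  by rewrite FE cImM /= mulr0 mulr1 addr0.
split.
  move=> T; split.
    have := integrable_mulr (- K) (measurable_itv _) (is_ T).
    by apply: eq_integrable => // t _; rewrite ReF.
  have := integrable_mulr K (measurable_itv _) (ic T).
  by apply: eq_integrable => // t _; rewrite ImF.
apply/ccvgE.
apply: (ccvg_near (f := fun T => (K * \int[mu]_(x in `]a, b[) (g x * dirichlet T (u x)) / (2 * pi))%:C)).
  near=> T; have T0 : 0 <= T by near: T; apply: nbhs_pinfty_ge; rewrite num_real.
  rewrite /segment_integral /cintegral.
  have -> : \int[mu]_(t in `[- T, T]) Re (F (d +i* t) * 'i%C) =
      - K * \int[mu]_(t in `[- T, T]) \int[mu]_(x in `]a, b[) (g x * sin (t * u x)).
    by rewrite -RintegralZl//; apply: eq_Rintegral => t _; exact: ReF.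
  have -> : \int[mu]_(t in `[- T, T]) Im (F (d +i* t) * 'i%C) =
      K * \int[mu]_(t in `[- T, T]) \int[mu]_(x in `]a, b[) (g x * cos (t * u x)).
    by rewrite -RintegralZl//; apply: eq_Rintegral => t _; exact: ImF.
  rewrite (Rintegral_fubini T gi cu (@continuous_cos R) (@cos_max R)) (Rintegral_fubini T gi cu (@continuous_sin R) (@sin_max R)).
  have -> : \int[mu]_(x in `]a, b[) (g x * \int[mu]_(t in `[- T, T]) sin (t * u x)) = 0.
    under eq_Rintegral do rewrite Rintegral_sin0// mulr0.
    by rewrite Rintegral_cst//= mul0r.
  rewrite mulr0.
  have pi0 : (pi : R) != 0 by rewrite gt_eqF ?pi_gt0.
  rewrite -/(dirichlet _ _); set A := K * _.
  have -> : 0 +i* A = A%:C * 'i%C by apply: complexP; rewrite ?cReM ?cImM /= ?mulr0 ?mulr1 ?mul0r ?subr0 ?addr0.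
  have i0 : ('i%C : R[i]) != 0 by rewrite eq_complex/= oner_eq0 andbF.
  have pc : pi%:C != 0 :> R[i] by rewrite eq_complex/= negb_and pi0.
  clearbody A; rewrite fmorph_div rmorphM /= rmorph_nat; move: (A%:C) (pi%:C) ('i%C) pc i0 => A' P I P0 I0.
  by field; rewrite P0 I0.
split; last exact: cvg_cst.
by apply: cvgM; [apply: cvgMr|exact: cvg_cst].
Unshelve. all: end_near. Qed.

End kernel.

Section density.
Variables (p : R) (p1 : 1 < p).

Local Notation c := (c_max p).
Local Notation density := (density p).

Definition moment b1 r y := expR (b1 * ln y) * density r y.

Lemma moment_cont b1 r y : 0 < y < c -> {for y, continuous (moment b1 r)}.
Proof.
move=> yc; have /andP[y0 _] := yc.
have cl : {for y, continuous (fun y => b1 * ln y)} by drvc.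
apply: cvgM; last exact: density_cont.
by apply: continuous_comp; [exact: cl|exact: continuous_expR].
Qed.

Lemma moment_integrable b1 r : -1 < p * b1 + r -> mu.-integrable `]0, c[ (EFin \o moment b1 r).
Proof.
move=> br; have [i _] := density_integral p1 0 (@continuous_cos R) (@cos_max R) br.
by apply: eq_integrable i => // y _; rewrite /= mul0r cos0 mulr1.
Qed.

Lemma moment_mul_integrable b1 r (h : R -> R) (t x0 : R) : -1 < p * b1 + r ->
  continuous h -> (forall y, `|h y| <= 1) ->
  mu.-integrable `]0, c[ (EFin \o (fun y => moment b1 r y * h (t * (ln y - x0)))).
Proof.
move=> br hc h1.
apply: (cont_dominated_integrable (F := fun y => `|moment b1 r y|)).
- move=> y yc; have /andP[y0 _] := yc; apply: cvgM; first exact: moment_cont.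
  have cl : {for y, continuous (fun y => t * (ln y - x0))} by drvc.
  by apply: continuous_comp; [exact: cl|exact: hc].
- by move=> y _; rewrite normrM ler_piMr.
- by apply: integrable_norm; exact: moment_integrable.
Qed.

Lemma curve_moment h b1 b2 r : continuous h -> (forall y, `|h y| <= 1) -> -1 < p * b1 + r ->
  curve_integral p h b1 b2 r / pi = \int[mu]_(y in `]0, c[) (moment b1 r y * h (b2 * ln y)).
Proof.
move=> hc h1 br; have [_ <-] := density_integral p1 b2 hc h1 br.
by apply: eq_Rintegral => y _; rewrite /moment; ring.
Qed.

Lemma cJ_twist b1 r t x0 : -1 < p * b1 + r ->
  cexp (0 +i* (- (t * x0))) * cJ p (b1 +i* t) r =
  (\int[mu]_(y in `]0, c[) (moment b1 r y * cos (t * (ln y - x0)))) +i*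
  (\int[mu]_(y in `]0, c[) (moment b1 r y * sin (t * (ln y - x0)))).
Proof.
move=> br.
have E : cexp (0 +i* (- (t * x0))) = cos (t * x0) +i* (- sin (t * x0)).
  by rewrite /cexp /= expR0 cosN sinN; apply: complexP; rewrite !ReImE/= ?mul0r ?subr0 ?addr0 mul1r.
rewrite E /cJ /= (curve_moment _ (@continuous_cos R) (@cos_max R) br) (curve_moment _ (@continuous_sin R) (@sin_max R) br).
have ic := moment_mul_integrable t 0 br (@continuous_cos R) (@cos_max R).
have is_ := moment_mul_integrable t 0 br (@continuous_sin R) (@sin_max R).
have {}ic : mu.-integrable `]0, c[ (EFin \o (fun y => moment b1 r y * cos (t * ln y))).
  by apply: eq_integrable ic => // y _; rewrite /= subr0.
have {}is_ : mu.-integrable `]0, c[ (EFin \o (fun y => moment b1 r y * sin (t * ln y))).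
  by apply: eq_integrable is_ => // y _; rewrite /= subr0.
have zc k := integrable_mulr k (measurable_itv _) ic.
have zs k := integrable_mulr k (measurable_itv _) is_.
apply: complexP; rewrite ?cReM ?cImM /= -!RintegralZl//.
  rewrite -RintegralB//; apply: eq_Rintegral => y _.
  by rewrite mulrBr cosB; ring.
rewrite -RintegralD//; apply: eq_Rintegral => y _.
by rewrite mulrBr sinB; ring.
Qed.

Lemma moment_kernel_cvg b1 r tau x0 : -1 < p * b1 + r -> 0 < tau -> 0 < x0 < c ->
  \int[mu]_(y in `]0, c[) (moment b1 r y * dirichlet T (tau * (ln y - ln x0))) @[T --> +oo] -->
  tau^-1 * (2 * pi * (x0 * moment b1 r x0)).
Proof.
move=> br tau0 x0c; have /andP[x00 _] := x0c.
pose k y := y * moment b1 r y.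
have kE y : 0 < y -> k y / y = moment b1 r y by move=> y0; rewrite /k mulrC mulKf// gt_eqF.
have ck y : 0 < y < c -> {for y, continuous k}.
  by move=> yc; apply: cvgM; [exact: cvg_id|exact: moment_cont].
have ki : mu.-integrable `]0, c[ (EFin \o (fun y => k y / y)).
  have := moment_integrable br; apply: eq_integrable => // y; rewrite inE/= in_itv/= => /andP[y0 _].
  by rewrite kE.
have dk : derivable k x0 1.
  have [dd hd] := derivable_density p1 r x0c.
  have [d [hk _]] : exists d, is_derive x0 1 k d.
    by eexists; rewrite /k /moment; drv; [exact: x00|exact: hd].
  exact: hk.
have L := mellin_kernel_cvg ck ki x0c dk.
have tauT : tau * T @[T --> +oo] --> +oo.
  by apply: gt0_cvgMry => //; exact: cvg_id.
have {}L := @cvg_comp _ _ _ (fun T => tau * T) _ _ _ _ tauT L.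
have {}L : tau^-1 * \int[mu]_(y in `]0, c[) (k y / y * dirichlet (tau * T) (ln y - ln x0)) @[T --> +oo] -->
   tau^-1 * (2 * pi * k x0) by apply: cvgMr; exact: L.
apply: cvg_trans L; apply: near_eq_cvg; near=> T.
have T0 : 0 <= T by near: T; apply: nbhs_pinfty_ge; rewrite num_real.
rewrite -RintegralZl//.
  apply: eq_Rintegral => y; rewrite inE/= in_itv/= => /andP[y0 _].
  by rewrite kE// dirichlet_scale//; ring.
have cu y : 0 < y < c -> {for y, continuous (fun y => ln y - ln x0)}.
  by move=> /andP[y0 _]; drvc.
exact: (integrable_fubini_fst (tau * T) ki cu (@continuous_cos R) (@cos_max R)).
Unshelve. all: end_near. Qed.

(** Serves both inversions: [tau = 1] for [psi], [tau = l] for the Meijer integrand. The phase in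
    [ln x0] is the oscillating part of the power of [x0] in the integrand. *)
Lemma line_integral_cJ (F : R[i] -> R[i]) d K b1 r tau x0 :
  -1 < p * b1 + r -> 0 < tau -> 0 < x0 < c ->
  (forall t, F (d +i* t) = K%:C * (cexp (0 +i* (- (tau * t * ln x0))) * cJ p (b1 +i* (tau * t)) r)) ->
  is_line_integral F d (K / tau * x0 * moment b1 r x0)%:C.
Proof.
move=> br tau0 x0c FE.
have L := moment_kernel_cvg br tau0 x0c.
have cu y : 0 < y < c -> {for y, continuous (fun y => tau * (ln y - ln x0))}.
  by move=> /andP[y0 _]; drvc.
have -> : K / tau * x0 * moment b1 r x0 = K * (tau^-1 * (2 * pi * (x0 * moment b1 r x0))) / (2 * pi).
  have := pi_gt0 R; move: (pi : R) => P P0.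
  by field; rewrite !gt_eqF.
have H := line_integral_kernel cu (moment_integrable br).
apply: H L => t.
rewrite FE cJ_twist//.
rewrite (_ : \int[mu]_(y in `]0, c[) (moment b1 r y * cos (tau * t * (ln y - ln x0))) =
   \int[mu]_(y in `]0, c[) (moment b1 r y * cos (t * (tau * (ln y - ln x0))))); last first.
  by apply: eq_Rintegral => y _; rewrite mulrA [t * _]mulrC.
rewrite (_ : \int[mu]_(y in `]0, c[) (moment b1 r y * sin (tau * t * (ln y - ln x0))) =
   \int[mu]_(y in `]0, c[) (moment b1 r y * sin (t * (tau * (ln y - ln x0))))); last first.
  by apply: eq_Rintegral => y _; rewrite mulrA [t * _]mulrC.
by apply: complexP; rewrite ?cReM ?cImM /= mul0r ?subr0 ?addr0.
Qed.

End density.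
End line_integrals.

(** * The density as inverse Mellin transform *)

Section density_is_V.
Context {R : realType}.
Variables (k l : nat) (p r : R).
Hypotheses (l0 : (0 < l)%N) (lk : (l < k)%N) (pkl : p = k%:R / l%:R).
Local Notation Re := complex.Re.
Local Notation Im := complex.Im.

Lemma ratio_gt1 : 1 < p.
Proof. by rewrite pkl ltr_pdivlMr ?ltr0n// mul1r ltr_nat. Qed.

Let p1 := ratio_gt1.
Let p0 : 0 < p. Proof. exact: lt_trans ltr01 p1. Qed.

Lemma c_E : c_ p = c_max p.
Proof.
rewrite /c_ /powR !gt_eqF ?subr_gt0// -expRD /c_max; congr expR; ring.
Qed.

Lemma mellin_domain (d : R) : 1 - (1 + r) / p < d -> -1 < p * (d - 1) + r.
Proof.
rewrite -(ltr_pM2l p0); have -> : p * (1 - (1 + r) / p) = p - (1 + r) by field; rewrite gt_eqF.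
by rewrite mulrBr mulr1; lra.
Qed.

(** On this half-plane the numerator argument has positive real part, so the branch of [psi] given
    by a limit is never taken. *)
Lemma psi_cJ (s : R[i]) : 1 - (1 + r) / p < Re s -> psi p r s = cJ p (s - 1) r.
Proof.
move=> hs.
have h : -1 < p * Re (s - 1) + r by rewrite cReB; exact: mellin_domain.
rewrite /psi asboolF; first by rewrite -(psi_quotientE p1 l0 lk pkl h) subrK.
apply: not_pole; rewrite cReD cReD cReM !cReC cImC mulr0 subr0.
by move: h; set X := Re (s - 1); lra.
Qed.

Lemma is_V_density (x : R) : 0 < x < c_ p -> is_V p r x (density p r x)%:C.
Proof.
rewrite c_E => xc d hd; have /andP[x0 _] := xc.
have h := mellin_domain hd.
have E t : cpow x (- (d +i* t)) * psi p r (d +i* t) =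
   (expR (- d * ln x))%:C * (cexp (0 +i* (- (1 * t * ln x))) * cJ p ((d - 1) +i* (1 * t)) r).
  rewrite psi_cJ// mulrA; congr (_ * _).
    rewrite cpowE// -cexpC -cexpD; congr cexp.
    have [E1 E2] : Re (d +i* t) = d /\ Im (d +i* t) = t by [].
    have [E3 E4] : Re (0 +i* (- (1 * t * ln x))) = 0 /\ Im (0 +i* (- (1 * t * ln x))) = - (1 * t * ln x) by [].
    move: (d +i* t) (0 +i* _) E1 E2 E3 E4 => z w E1 E2 E3 E4.
    apply: complexP; rewrite !(cReD, cImD, cReM, cImM, cReN, cImN, cReC, cImC) E1 E2 ?E3 ?E4; ring.
  by congr cJ; apply: complexP; rewrite ?cReB ?cImB /=; ring.
have := line_integral_cJ (F := fun s => cpow x (- s) * psi p r s) p1 h ltr01 xc E.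
suff -> : expR (- d * ln x) / 1 * x * moment p (d - 1) r x = density p r x by [].
rewrite /moment divr1 -{2}[x]lnK ?posrE// mulrA -!expRD.
by rewrite (_ : _ + _ = 0) ?expR0 ?mul1r//; ring.
Qed.

Lemma line_integral_unique (F : R[i] -> R[i]) d v w :
  is_line_integral F d v -> is_line_integral F d w -> v = w.
Proof. by move=> [_ /ccvgE a] [_ /ccvgE b]; exact: ccvg_unique a b. Qed.

Lemma V_density (x : R) : 0 < x < c_ p -> V p r x = (density p r x)%:C.
Proof.
move=> xc; have h := is_V_density xc; rewrite /V; case: xgetP => [v -> hv|/(_ _ h)//].
(* [is_V] quantifies over all admissible lines; one of them must be exhibited for the value to be
   determined. *)
have [d hd] : exists d : R, 1 - (1 + r) / p < d.
  by exists (1 - (1 + r) / p + 1); rewrite ltrDl.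
exact: line_integral_unique (hv d hd) (h d hd).
Qed.

Lemma mellin_V (s : R[i]) : 1 - (1 + r) / p < Re s ->
  cintegrable `]0, c_ p[ (fun x => cpow x (s - 1) * V p r x) /\
  psi p r s = cintegral `]0, c_ p[ (fun x => cpow x (s - 1) * V p r x).
Proof.
move=> hs; rewrite psi_cJ//.
have h : -1 < p * Re (s - 1) + r by rewrite cReB; exact: mellin_domain.
have [ic Ec] := density_integral p1 (Im (s - 1)) (@continuous_cos R) (@cos_max R) h.
have [is_ Es] := density_integral p1 (Im (s - 1)) (@continuous_sin R) (@sin_max R) h.
rewrite -c_E in ic is_ Ec Es.
have VE x : 0 < x < c_ p -> cpow x (s - 1) * V p r x =
    (expR (Re (s - 1) * ln x) * cos (Im (s - 1) * ln x) * density p r x) +i*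
    (expR (Re (s - 1) * ln x) * sin (Im (s - 1) * ln x) * density p r x).
  move=> xc; have /andP[x0 _] := xc; rewrite V_density// /cpow /powR gt_eqF//.
  apply: complexP; rewrite ?cReM ?cImM /=; ring.
split.
  split.
    by apply: eq_integrable ic => // x; rewrite inE/= in_itv/= => xc; rewrite VE.
  by apply: eq_integrable is_ => // x; rewrite inE/= in_itv/= => xc; rewrite VE.
rewrite /cJ /cintegral -Ec -Es; congr (_ +i* _).
  by apply: eq_Rintegral => x; rewrite inE/= in_itv/= => xc; rewrite VE.
by apply: eq_Rintegral => x; rewrite inE/= in_itv/= => xc; rewrite VE.
Qed.

End density_is_V.

(** * Gauss's multiplication formula and the Meijer function *)

Section gauss.
Context {R : realType}.
Notation mu := (@lebesgue_measure R).
Implicit Types (z w : R[i]) (x y r : R).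
Local Notation Re := complex.Re.
Local Notation Im := complex.Im.

Lemma nonneg_derive_ge0 (f f' : R -> R) x : 0 <= x -> f 0 = 0 ->
  (forall t : R, 0 <= t -> is_derive t 1 f (f' t)) -> (forall t, 0 <= t -> 0 <= f' t) -> 0 <= f x.
Proof.
rewrite le_eqVlt => /predU1P[<- -> //|x0] f0 df f'0.
have [|| y] := @MVT R f f' 0 x x0.
- by move=> t; rewrite in_itv/= => /andP[t0 _]; apply: df; exact: ltW.
- by apply: cont_within => t /andP[t0 _]; apply: is_derive_cont (df t t0).
- rewrite in_itv/= f0 !subr0 => /andP[y0 _] ->; by rewrite mulr_ge0 ?f'0 ?ltW.
Qed.

(** At [x = 1 / n], after multiplication by [n + 1 / 2], the bounds become [1] and
    [1 + 1 / (4 n (n + 1))], exactly what controls the ratio of consecutive [stirling] terms. *)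
Lemma ln1D_bounds x : 0 <= x ->
  2 * x / (2 + x) <= ln (1 + x) <= (x + x / (1 + x)) / 2.
Proof.
move=> x0; apply/andP; split.
  rewrite -subr_ge0.
  apply: (@nonneg_derive_ge0 (fun t => ln (1 + t) - 2 * t / (2 + t))
     (fun t => t ^+ 2 / ((1 + t) * (2 + t) ^+ 2))) => //.
  - by rewrite addr0 ln1 mulr0 mul0r subrr.
  - move=> t t0; drve; [lra|by rewrite gt_eqF//; lra|].
    by field; rewrite !gt_eqF//; lra.
  - by move=> t t0; rewrite divr_ge0 ?sqr_ge0// mulr_ge0 ?sqr_ge0//; lra.
rewrite -subr_ge0.
apply: (@nonneg_derive_ge0 (fun t => (t + t / (1 + t)) / 2 - ln (1 + t))
     (fun t => t ^+ 2 / (2 * (1 + t) ^+ 2))) => //.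
- by rewrite mul0r !addr0 mul0r ln1 subrr.
- move=> t t0; drve; try lra.
  by field; rewrite !gt_eqF//; lra.
- by move=> t t0; rewrite divr_ge0 ?sqr_ge0// mulr_ge0 ?sqr_ge0.
Qed.

Definition stirling (n : nat) : R := n`!%:R / expR ((n%:R + 1 / 2) * ln n%:R - n%:R).

Lemma stirling_gt0 n : 0 < stirling n.
Proof. by rewrite divr_gt0 ?expR_gt0// ltr0n fact_gt0. Qed.

Lemma stirlingS n : (0 < n)%N ->
  stirling n.+1 = stirling n * expR (1 - (n%:R + 1 / 2) * (ln n.+1%:R - ln n%:R)).
Proof.
move=> n0; rewrite /stirling factS natrM -!expRN.
rewrite -[X in X * _ * _](lnK (x := n.+1%:R)) ?posrE// -[RHS]mulrA -expRD mulrAC -expRD mulrC.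
congr (_ * expR _); rewrite -(natr1 n); set L := ln _; set L' := ln _; lra.
Qed.

(** The criterion used for Euler's limit, with [C = 1 / 4] from [ln1D_bounds]; it also shows that
    the limit is not [0]. The value of the limit is left open until the multiplication formula is
    available. *)
Lemma stirling_cvg : exists2 a : R, 0 < a & stirling n @[n --> \oo] --> a.
Proof.
have [|||||z z0 [h1 h2]] := @ratio_ccvg R (fun n => (stirling n)%:C) (1 / 4) 1.
- by lra.
- by [].
- by lra.
- by rewrite eq_complex/= gt_eqF// stirling_gt0.
- move=> n n0; rewrite -rmorphB !normcC (gtr0_norm (stirling_gt0 n)) stirlingS//.
  have n0' : 0 < (n%:R : R) by rewrite ltr0n.
  have s1 : (n.+1%:R : R) = n%:R + 1 by rewrite natr1.
  rewrite -{2}[stirling n]mulr1 -mulrBr normrM (gtr0_norm (stirling_gt0 n)) mulrC.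
  rewrite ler_wpM2r ?(ltW (stirling_gt0 n))//.
  have /andP := @ln1D_bounds (n%:R^-1) ltac:(by rewrite invr_ge0).
  have -> : 1 + n%:R^-1 = n.+1%:R / n%:R :> R by rewrite s1; field; rewrite gt_eqF.
  rewrite ln_div ?posrE//; set L := ln _ - ln _ => -[L1 L2].
  set t := (n%:R + 1 / 2) * L - 1.
  have t0 : 0 <= t.
    rewrite subr_ge0; apply: le_trans (ler_wpM2l _ L1); last lra.
    by rewrite le_eqVlt; apply/orP; left; apply/eqP; field; rewrite !gt_eqF//; lra.
  have tb : t <= 1 / 4 / (n%:R * n.+1%:R).
    rewrite lerBlDr; apply: le_trans (ler_wpM2l _ L2) _; first lra.
    by rewrite s1 le_eqVlt; apply/orP; left; apply/eqP; field; rewrite !gt_eqF//; lra.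
  have -> : 1 - (n%:R + 1 / 2) * L = - t by rewrite /t; ring.
  rewrite ler0_norm; last by rewrite subr_le0 -expR0 ler_expR oppr_le0.
  apply: le_trans tb; have := expR_ge1Dx (- t).
  by clearbody t; set E := expR _; lra.
- exists (Re z) => //.
  have r0 : 0 <= Re z.
    rewrite -(cvg_lim (@Rhausdorff R) h1); apply: limr_ge.
      by apply/cvg_ex; exists (Re z).
    by near=> n; exact/ltW/stirling_gt0.
  have i0 : Im z = 0.
    by rewrite -(cvg_lim (@Rhausdorff R) h2); exact: lim_cst.
  rewrite lt_def r0 andbT; apply: contra z0 => /eqP r00.
  by apply/eqP; apply: complexP; rewrite ?r00 ?i0.
Unshelve. all: end_near. Qed.

(** Division with remainder: for [0 <= i < n] and [1 <= j <= N], the numbers [z - i + n j] run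
    through [z + 1], ..., [z + n N]. *)
Lemma poch_mul n N z : (0 < n)%N ->
  \prod_(i < n) poch N ((z - i%:R) / n%:R) = poch (n * N) z / n%:R ^+ (n * N).
Proof.
move=> n0; have nn := @natC_neq0 R _ n0.
elim: N => [|N IH].
  by rewrite muln0 /poch expr0 invr1 mulr1 big_ord0; apply: big1 => i _; rewrite big_ord0.
rewrite (eq_bigr (fun i : 'I_n => poch N ((z - i%:R) / n%:R) * ((z - i%:R) / n%:R + N.+1%:R))); last first.
  by move=> i _; rewrite pochS.
rewrite big_split/= IH mulnS addnC exprD invfM.
have -> : poch (n * N + n) z = poch (n * N) z * \prod_(i < n) (z + (n * N + i.+1)%:R).
  rewrite /poch big_split_ord/=; congr (_ * _).
  by apply: eq_bigr => i _; rewrite addnS.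
rewrite mulrACA; congr (_ * _); rewrite (reindex_inj rev_ord_inj)/=.
rewrite -[X in _ = _ * X^-1](_ : \prod_(i < n) n%:R = _); last by rewrite prodr_const card_ord.
rewrite -prodfV -big_split/=; apply: eq_bigr => i _.
rewrite natrB; last exact: ltn_ord.
rewrite !natrD natrM -!natr1.
by field.
Qed.

Lemma sum_natr n : \sum_(i < n) (i%:R : R) = n%:R * (n%:R - 1) / 2.
Proof.
elim: n => [|n IH]; first by rewrite big_ord0 mul0r mul0r.
by rewrite big_ord_recr/= IH -(natr1 n); field.
Qed.

Lemma cexp_sum n (f : 'I_n -> R[i]) : \prod_(i < n) cexp (f i) = cexp (\sum_(i < n) f i).
Proof.
elim: n f => [|n IH] f; first by rewrite !big_ord0 cexp0.
by rewrite !big_ord_recl IH cexpD.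
Qed.

Lemma sqrt_natE n : (0 < n)%N -> Num.sqrt n%:R = expR (ln n%:R / 2) :> R.
Proof.
move=> n0; have nE : expR (ln n%:R / 2) ^+ 2 = n%:R :> R.
  by rewrite expr2 -expRD -splitr lnK// posrE ltr0n.
by rewrite -[in LHS]nE sqrtr_sqr ger0_norm// expR_ge0.
Qed.

(** Gauss's formula before the limit, exact for every [N]: the factorials and powers that do not
    cancel assemble into a quotient of [stirling] terms. *)
Lemma inv_euler_mul n N z : (0 < n)%N -> (0 < N)%N ->
  \prod_(i < n) inv_euler N ((z - i%:R) / n%:R) =
  inv_euler (n * N) z * cexp (z * (ln n%:R)%:C) *
  (stirling (n * N) / stirling N ^+ n * Num.sqrt n%:R)%:C.
Proof.
move=> n0 N0; have nR : 0 < (n%:R : R) by rewrite ltr0n.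
have NR : 0 < (N%:R : R) by rewrite ltr0n.
have nn := @natC_neq0 R _ n0.
rewrite /inv_euler big_split/= poch_mul// prodfV big_split/= prodr_const card_ord.
rewrite (eq_bigr (fun i : 'I_n => cexp ((z - i%:R) / n%:R * (ln N%:R)%:C))); last first.
  by move=> i _; rewrite cpowE.
rewrite cexp_sum -mulr_suml.
have -> : \sum_(i < n) ((z - i%:R) / n%:R) = z - ((n%:R - 1) / 2)%:C.
  rewrite -mulr_suml sumrB sumr_const card_ord -mulr_natr.
  have -> : \sum_(i < n) (i%:R : R[i]) = n%:R * ((n%:R - 1) / 2)%:C.
    rewrite natC -rmorphM mulrA -sum_natr rmorph_sum; apply: eq_bigr => i _; exact: natC.
  by field.
rewrite cpowE; last by rewrite ltr0n muln_gt0 n0 N0.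
rewrite natrM lnM ?posrE//.
have -> : (ln n%:R + ln N%:R)%:C = (ln n%:R)%:C + (ln N%:R)%:C :> R[i] by rewrite rmorphD.
rewrite mulrDr cexpD.
rewrite mulrBl cexpB.
have SE : stirling (n * N) / stirling N ^+ n * Num.sqrt n%:R =
    (n * N)`!%:R / N`!%:R ^+ n * (expR ((n%:R - 1) / 2 * ln N%:R) / n%:R ^+ (n * N)).
  have -> : n%:R ^+ (n * N) = expR (n%:R * N%:R * ln n%:R) :> R.
    by rewrite -[in LHS](lnK (x := n%:R)) ?posrE// -expRM_natl natrM.
  rewrite /stirling sqrt_natE// expr_div_n -expRM_natl -!expRN natrM lnM ?posrE//.
  rewrite invfM -!expRN opprK !mulrA mulrAC -!mulrA; congr (_ * _).
  rewrite mulrCA; congr (_ * _); rewrite -!expRD; congr expR; by field.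
have QE : (expR ((n%:R - 1) / 2 * ln N%:R))%:C = cexp (((n%:R - 1) / 2)%:C * (ln N%:R)%:C) :> R[i].
  by rewrite -cexpC rmorphM.
have e3 := cexp_neq0 (((n%:R - 1) / 2)%:C * (ln N%:R)%:C : R[i]).
rewrite SE; move: (expR _) (cexp (_%:C * _)) QE e3 => Q Q' QE e3.
rewrite !rmorphM !fmorphV !rmorphXn /= -!natC QE.
have f1 := @factC_neq0 R (n * N); have f2 := expf_neq0 n (@factC_neq0 R N).
have f3 : (n%:R ^+ (n * N) : R[i]) != 0 by rewrite expf_neq0.
have e1 := cexp_neq0 (z * (ln N%:R)%:C); have e2 := cexp_neq0 (z * (ln n%:R)%:C).
move: f1 f2 f3 e1 e2.
move: (cexp _) (cexp _) (poch _ _) (_ ^+ _) (_ ^+ _) (_`!%:R).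
move=> E1 E2 P F3 F2 F1 f1 f2 f3 e1 e2.
by field; rewrite f1 f2 f3 e1 e2 e3.
Qed.

Section multiplication.
Variables (a : R) (a0 : 0 < a) (sa : stirling n @[n --> \oo] --> a).

(* At a pole of [Gamma] both sides are [0]. *)
Lemma Gamma_multiplication n z : (0 < n)%N ->
  \prod_(j < n) (Gamma ((z + j.+1%:R) / n%:R))^-1 =
  (Gamma (z + 1))^-1 * cexp (z * (ln n%:R)%:C) * (a / a ^+ n * Num.sqrt n%:R)%:C.
Proof.
move=> n0; have nn := @natC_neq0 R _ n0.
have L1 : ccvg \oo (fun N => \prod_(i < n) inv_euler N ((z - i%:R) / n%:R))
    (\prod_(i < n) (Gamma ((z - i%:R) / n%:R + 1))^-1).
  by apply: ccvg_prod => i; exact: inv_euler_ccvg.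
rewrite (reindex_inj rev_ord_inj)/=.
rewrite (eq_bigr (fun i : 'I_n => (Gamma ((z - i%:R) / n%:R + 1))^-1)); last first.
  move=> i _; congr (Gamma _)^-1; rewrite subnSK// natrB; last exact/ltnW/ltn_ord.
  by field.
apply: (ccvg_unique L1).
have L2 := ccvg_comp (cvg_muln_infty n0) (inv_euler_ccvg z).
have L3 : ccvg \oo (fun N => (stirling (n * N) / stirling N ^+ n * Num.sqrt n%:R)%:C)
    (a / a ^+ n * Num.sqrt n%:R)%:C.
  split; last exact: cvg_cst.
  apply: cvgM; last exact: cvg_cst.
  apply: cvgM.
    by apply: (@cvg_comp _ _ _ (fun N => n * N)%N _ _ _ _ (cvg_muln_infty n0) sa).
  apply: cvgV; first by rewrite expf_neq0// gt_eqF.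
  by apply: (@cvg_comp _ _ _ stirling (fun x => x ^+ n) _ _ _ sa); exact: exprn_continuous.
have cM := @ccvgM R _ \oo (@eventually_filter).
have L := cM _ _ _ _ (cM _ _ _ _ L2 (@ccvg_cst R _ \oo _ (cexp (z * (ln n%:R)%:C)))) L3.
apply: (ccvg_near _ (L _)); near=> N; rewrite -inv_euler_mul//.
by near: N; exact: nbhs_infty_gt.
Unshelve. all: end_near. Qed.

Lemma Gamma1 : Gamma (1 : R[i]) = 1.
Proof.
apply: (@invr_inj); rewrite invr1 -[in LHS](add0r 1).
apply: ccvg_unique (inv_euler_ccvg 0) _; apply: (ccvg_near (f := fun=> 1)); last exact: ccvg_cst.
near=> n; have n0 : (0 < n)%N by near: n; exact: nbhs_infty_gt.
rewrite /inv_euler poch_nat cpowE ?ltr0n// mul0r cexp0 mulr1 divff//.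
Unshelve. all: end_near. Qed.

Lemma Gamma2 : Gamma (2 : R[i]) = 1.
Proof.
apply: (@invr_inj); rewrite invr1 -[2](_ : 1 + 1 = _ :> R[i])//.
apply: ccvg_unique (inv_euler_ccvg 1) _.
apply: (ccvg_near (f := fun n => 1 + n%:R^-1)); last first.
  rewrite -[X in ccvg _ _ X]addr0; apply: ccvgD; [exact: ccvg_cst|exact: ccvg_invn].
near=> n; have n0 : (0 < n)%N by near: n; exact: nbhs_infty_gt.
have pE m : poch m 1 = m.+1`!%:R :> R[i].
  elim: m => [|m IH]; first by rewrite /poch big_ord0.
  by rewrite pochS IH nat1r [in RHS]factS natrM mulrC.
rewrite /inv_euler pE cpowE ?ltr0n// mul1r cexpC lnK ?posrE ?ltr0n// -natC factS natrM -natr1.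
by field; rewrite factC_neq0 natC_neq0.
Unshelve. all: end_near. Qed.

Lemma Gamma_3half_sqr : Gamma (3 / 2 : R[i]) ^+ 2 = (pi / 4)%:C.
Proof.
have p1 : 1 < 2 :> R by lra.
have h : -1 < 2 * Re ((1 / 2)%:C : R[i]) + 0 by rewrite cReC; lra.
have := psi_quotientE p1 (k := 2) (l := 1) isT isT ltac:(by rewrite divr1) h.
have -> : cJ 2 (1 / 2)%:C 0 = (4 / pi)%:C :> R[i].
  rewrite /cJ cReC cImC.
  rewrite curve_integral_sin0.
  (* For [p = 2], [q = 1] one has [rho ^ (1 / 2) = sin (2 x) / sin x = 2 cos x], and [omega 0] is
     [2]. *)
  have -> : curve_integral 2 cos (1 / 2) 0 0 = 4 :> R.
    rewrite /curve_integral.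
    transitivity (\int[mu]_(x in `]0, (pi / 2)[) (4 * cos x)).
      apply: eq_Rintegral => x; rewrite inE/= in_itv/= => /(curve_sin_gt0 p1)[h1 h2 h3].
      rewrite /wave /omega !mul0r cos0 sin0 expR0 !mulr1 !mulr0 addr0 mul1r /theta.
      have -> : 2 - 1 = 1 :> R by lra.
      rewrite !mul1r.
      have -> : 2^-1 * (2 * ln (sin (2 * x)) - ln (sin x) - ln (sin x)) = ln (sin (2 * x)) - ln (sin x) by field.
      rewrite -ln_div ?posrE// lnK ?posrE ?divr_gt0//.
      have -> : 2 * x = x + x by ring.
      by rewrite sinD; field; rewrite gt_eqF.
    have pi2 : 0 < pi / 2 :> R by rewrite divr_gt0// pi_gt0.
    have cs (x : R) : {for x, continuous (fun x => 4 * sin x)} by drvc.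
    have dF (x : R) : 0 < x < pi / 2 -> is_derive x 1 (fun x => 4 * sin x) (4 * cos x).
      by move=> _; drve; ring.
    have cc (x : R) : {for x, continuous (fun x => 4 * cos x)} by drvc.
    have ii : mu.-integrable `]0, (pi / 2)[ (EFin \o (fun x => 4 * cos x)).
      apply: (@bounded_cont_integrable _ _ _ _ 4) => x _; first exact: cc.
      by rewrite normrM ger0_norm// -[leRHS]mulr1 ler_wpM2l// cos_max.
    rewrite (FTC_oo pi2 ii dF (fun x _ => cc x) (cvg_at_right_filter (@cs 0)) (cvg_at_left_filter (@cs _))).
    by rewrite sin_pihalf sin0; ring.
  by rewrite mul0r.
rewrite /psi_quotient addrK.
have -> : (1 / 2)%:C * 2%:C + (0 : R)%:C + 1 = 2 :> R[i].
  by apply: complexP; rewrite !(cReD, cImD, cReM, cImM, cReC, cImC) ?Re_nat ?Im_nat; lra.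
have -> : (1 / 2)%:C * (2 - 1)%:C + (0 : R)%:C + 1 = (1 / 2)%:C + 1 :> R[i].
  by apply: complexP; rewrite !(cReD, cImD, cReM, cImM, cReC, cImC); lra.
have -> : (1 / 2)%:C + 1 = 3 / 2 :> R[i] by rewrite fmorph_div rmorph1 rmorph_nat; field.
rewrite Gamma2 div1r => /(congr1 (@GRing.inv _)); rewrite invrK -expr2 -fmorphV => ->.
by rewrite invf_div.
Qed.

Lemma stirling_lim : a = Num.sqrt (2 * pi).
Proof.
(* Duplication at [z = 1] reads [1 / Gamma (3 / 2) = 2 sqrt 2 / a]. It is squared because only the
   square of [Gamma (3 / 2)] is known; [a > 0] then selects the root. *)
have := @Gamma_multiplication 2 1 isT.
rewrite !big_ord_recr big_ord0 /= mul1r.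
have -> : (1 + 1) / 2 = 1 :> R[i] by field.
have -> : (1 + 2) / 2 = 3 / 2 :> R[i] by rewrite nat1r.
rewrite -[1 + 1](_ : 2 = _ :> R[i])// Gamma1 Gamma2 invr1 !mul1r cexpC lnK ?posrE//.
rewrite -rmorphM => /(congr1 (fun z => z ^+ 2)); rewrite /= exprVn Gamma_3half_sqr -fmorphV -rmorphXn.
move=> /complexI; rewrite invf_div !exprMn sqr_sqrtr// => h.
have pi0 := pi_gt0 R.
have : a ^+ 2 = 2 * pi.
  have : 4 / pi = 8 / a ^+ 2 by rewrite h; field; rewrite gt_eqF.
  move: (pi : R) pi0 => P P0 /(congr1 (fun x => x * P * a ^+ 2)).
  have -> : 4 / P * P * a ^+ 2 = 4 * a ^+ 2 by field; rewrite gt_eqF.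
  have -> : 8 / a ^+ 2 * P * a ^+ 2 = 8 * P by field; rewrite gt_eqF.
  by lra.
by move=> <-; rewrite sqrtr_sqr gtr0_norm.
Qed.

End multiplication.

End gauss.

(** * The Meijer integrand *)

Section meijer.
Context {R : realType}.
Variables (k l : nat) (p r : R).
Hypotheses (l0 : (0 < l)%N) (lk : (l < k)%N) (pkl : p = k%:R / l%:R).
Local Notation Re := complex.Re.
Local Notation Im := complex.Im.

Let p1 : 1 < p := ratio_gt1 l0 lk pkl.
Let p0 : 0 < p. Proof. exact: lt_trans ltr01 p1. Qed.
Let m := (k - l)%N.
Let m0 : (0 < m)%N. Proof. by rewrite subn_gt0. Qed.
Let k0 : (0 < k)%N. Proof. exact: leq_trans lk. Qed.
Let kR : 0 < (k%:R : R). Proof. by rewrite ltr0n. Qed.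
Let lR : 0 < (l%:R : R). Proof. by rewrite ltr0n. Qed.
Let mR : 0 < (m%:R : R). Proof. by rewrite ltr0n. Qed.
Let mE : m%:R = k%:R - l%:R :> R. Proof. by rewrite natrB// ltnW. Qed.
Let kC := @natC_neq0 R _ k0.
Let lC := @natC_neq0 R _ l0.
Let mC := @natC_neq0 R _ m0.
Let p1E : p - 1 = m%:R / l%:R. Proof. by rewrite pkl mE; field; rewrite gt_eqF. Qed.

Lemma prod_Gamma_beta (u : R[i]) : \prod_(j < k) Gamma (beta r j + u) =
  \prod_(j < k) Gamma ((r%:C + k%:R * u + j.+1%:R) / k%:R).
Proof.
apply: eq_bigr => j _; congr Gamma; rewrite /beta fmorph_div rmorphD !rmorph_nat.
by field.
Qed.

Lemma prod_Gamma_alpha (u : R[i]) : \prod_(j < k) Gamma (alpha l r j + u) =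
  \prod_(j < l) Gamma ((l%:R * u + j.+1%:R) / l%:R) *
  \prod_(j < m) Gamma ((r%:C + m%:R * u + j.+1%:R) / m%:R).
Proof.
pose A (j : nat) : R[i] := (if (j.+1 <= l)%N then j.+1%:R / l%:R
   else (r + j.+1%:R - l%:R) / (k%:R - l%:R))%:C.
rewrite -[LHS](big_mkord xpredT (fun j => Gamma (A j + u))) (big_cat_nat (n := l))//=; last exact: ltnW.
congr (_ * _).
  rewrite big_mkord; apply: eq_bigr => j _; congr Gamma.
  by rewrite /A ltn_ord fmorph_div !rmorph_nat; field.
rewrite -{1}[l]add0n big_addn big_mkord; apply: eq_bigr => j _; congr Gamma.
rewrite /A ltnNge leq_addl /= -mE fmorph_div rmorphB rmorphD !rmorph_nat.
by rewrite -addSn natrD; field.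
Qed.

Lemma meijer_quotient (u : R[i]) :
  (\prod_(j < k) Gamma (beta r j + u)) / (\prod_(j < k) Gamma (alpha l r j + u)) =
  (Num.sqrt (2 * pi) * (Num.sqrt l%:R * Num.sqrt m%:R / Num.sqrt k%:R) * expR (r * (ln m%:R - ln k%:R)))%:C *
  (cexp (- (l%:R * u * (ln (c_ p))%:C)) * psi_quotient p r (l%:R * u + 1)).
Proof.
have [a a0 sa] := @stirling_cvg R; rewrite -(stirling_lim a0 sa).
(* Derived from the inverse form, hence valid at poles too, where both sides are [0]. *)
have G n z : (0 < n)%N -> \prod_(j < n) Gamma ((z + j.+1%:R) / n%:R) =
    Gamma (z + 1) * (cexp (z * (ln n%:R)%:C))^-1 * ((a / a ^+ n * Num.sqrt n%:R)%:C)^-1.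
  move=> n0; rewrite -[LHS]invrK -prodfV (Gamma_multiplication a0 sa)//.
  by rewrite !invfM invrK.
rewrite prod_Gamma_beta prod_Gamma_alpha !G//.
rewrite (c_E l0 lk pkl) /c_max expRK.
rewrite /psi_quotient addrK.
have -> : l%:R * u * p%:C + r%:C + 1 = r%:C + k%:R * u + 1.
  by rewrite pkl fmorph_div !rmorph_nat; field.
have -> : l%:R * u * (p - 1)%:C + r%:C + 1 = r%:C + m%:R * u + 1.
  by rewrite p1E fmorph_div !rmorph_nat; field.
have L : p * ln p - (p - 1) * ln (p - 1) = (k%:R * ln k%:R - m%:R * ln m%:R) / l%:R - ln l%:R.
  rewrite p1E pkl !ln_div ?posrE//.
  have -> : k%:R = m%:R + l%:R :> R by rewrite mE subrK.
  by field; rewrite gt_eqF.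
rewrite L.
have sl : Num.sqrt l%:R != 0 :> R by rewrite gt_eqF// sqrtr_gt0.
have sm : Num.sqrt m%:R != 0 :> R by rewrite gt_eqF// sqrtr_gt0.
have sk : Num.sqrt k%:R != 0 :> R by rewrite gt_eqF// sqrtr_gt0.
(* Since [k = l + m], all powers of [a] cancel but one; this is the [sqrt (2 pi)] of the final
   constant. *)
have aE : (a / a ^+ k * Num.sqrt k%:R)^-1 * ((a / a ^+ l * Num.sqrt l%:R) * (a / a ^+ m * Num.sqrt m%:R)) =
   a * (Num.sqrt l%:R * Num.sqrt m%:R / Num.sqrt k%:R).
  have ai i : a ^+ i != 0 by rewrite expf_neq0// gt_eqF.
  have -> : a ^+ k = a ^+ l * a ^+ m by rewrite -exprD subnKC// ltnW.
  by field; rewrite !ai sk gt_eqF.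
have eE : (cexp ((r%:C + k%:R * u) * (ln k%:R)%:C))^-1 * (cexp (l%:R * u * (ln l%:R)%:C) * cexp ((r%:C + m%:R * u) * (ln m%:R)%:C)) =
    (expR (r * (ln m%:R - ln k%:R)))%:C * cexp (- (l%:R * u * ((k%:R * ln k%:R - m%:R * ln m%:R) / l%:R - ln l%:R)%:C)).
  rewrite -cexpN -!cexpC -!cexpD; congr cexp.
  rewrite rmorphM !rmorphB fmorph_div rmorphB !rmorphM !rmorph_nat.
  by field.
move: (a * _) (a / a ^+ k * _) (a / a ^+ l * _) (a / a ^+ m * _) aE => A ck cl cm aE.
have -> : (A * expR (r * (ln m%:R - ln k%:R)))%:C =
    A%:C * (expR (r * (ln m%:R - ln k%:R)))%:C :> R[i] by rewrite rmorphM.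
move: (expR _)%:C (cexp (- _)) (cexp _) (cexp _) (cexp _) eE => E' e' ek el em eE.
rewrite -[RHS]mulrA [E' * _]mulrA -eE -aE !rmorphM fmorphV /= !invfM !invrK.
move: (Gamma _) (Gamma _)^-1 (Gamma _)^-1 ek^-1 (ck%:C)^-1 => *; ring.
Qed.

Lemma is_MeijerG_density (x : R) : 0 < x < c_ p ->
  is_MeijerG (@alpha R k l r) (@beta R k r) (x ^+ l / c_ p ^+ l)
    ((Num.sqrt (2 * pi) * (Num.sqrt l%:R * Num.sqrt m%:R / Num.sqrt k%:R) *
      expR (r * (ln m%:R - ln k%:R))) * x / l%:R * density p r x)%:C.
Proof.
move=> xc d hd; have /andP[x0 _] := xc.
have c0 : 0 < c_ p by rewrite (c_E l0 lk pkl) expR_gt0.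
set C0 := _ * expR _.
(* The index [0] has the smallest [beta], namely [(r + 1) / k], so its condition on [d] is the
   strongest; as [p l = k], it is the domain of [cJ] at [b = l u]. *)
have h : -1 < p * (l%:R * d) + r.
  have := hd (Ordinal k0); rewrite /beta cReC /= => h.
  have -> : p * (l%:R * d) = k%:R * d by rewrite pkl; field; rewrite gt_eqF.
  have : k%:R * - ((r + 1) / k%:R) < k%:R * d by rewrite ltr_pM2l.
  have -> : k%:R * - ((r + 1) / k%:R) = - (r + 1) by field; rewrite gt_eqF.
  lra.
pose F (u : R[i]) := (\prod_(j < k) Gamma (beta r j + u)) / (\prod_(j < k) Gamma (alpha l r j + u)) *
   cpow (x ^+ l / c_ p ^+ l) (- u).
have E t : F (d +i* t) = (C0 * expR (- (l%:R * d * ln x)))%:C *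
    (cexp (0 +i* (- (l%:R * t * ln x))) * cJ p ((l%:R * d) +i* (l%:R * t)) r).
  rewrite /F meijer_quotient.
  have E1 : l%:R * (d +i* t) = (l%:R * d) +i* (l%:R * t) :> R[i].
    by apply: complexP; rewrite ?cReM ?cImM Re_nat Im_nat /= !mul0r ?subr0 ?addr0.
  have Q : cexp (- (l%:R * (d +i* t) * (ln (c_ p))%:C)) * cpow (x ^+ l / c_ p ^+ l) (- (d +i* t)) =
      (expR (- (l%:R * d * ln x)))%:C * cexp (0 +i* (- (l%:R * t * ln x))).
    rewrite cpowE ?divr_gt0 ?exprn_gt0// ln_div ?posrE ?exprn_gt0// !lnXn// -cexpC -!cexpD.
    have [F1 F2] : Re (d +i* t) = d /\ Im (d +i* t) = t by [].
    have [F3 F4] : Re (0 +i* (- (l%:R * t * ln x))) = 0 /\ Im (0 +i* (- (l%:R * t * ln x))) = - (l%:R * t * ln x) by [].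
    congr cexp; rewrite -(mulr_natl (ln x)) -(mulr_natl (ln (c_ p))).
    move: (d +i* t) (0 +i* _) F1 F2 F3 F4 => z w F1 F2 F3 F4.
    apply: complexP; rewrite !(cReD, cImD, cReM, cImM, cReN, cImN, cReC, cImC) Re_nat Im_nat F1 F2 ?F3 ?F4; ring.
  rewrite -[LHS]mulrA [_ * _ * cpow _ _]mulrAC Q E1 (psi_quotientE p1 l0 lk pkl)// -/C0 (rmorphM _ C0).
  by rewrite -!mulrA.
have xc' : 0 < x < c_max p by rewrite -(c_E l0 lk pkl).
have := line_integral_cJ (F := F) p1 h lR xc' E.
suff -> : C0 * expR (- (l%:R * d * ln x)) / l%:R * x * moment p (l%:R * d) r x =
    C0 * x / l%:R * density p r x by [].
rewrite /moment; have := expRxMexpNx_1 (l%:R * d * ln x).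
move: (expR _) (expR _) (density _ _ _) => A B D AB.
transitivity (C0 * x / l%:R * D * (B * A)); last by rewrite AB mulr1.
by ring.
Qed.

Lemma MeijerG_density (x : R) : 0 < x < c_ p ->
  MeijerG_exists (@alpha R k l r) (@beta R k r) (x ^+ l / c_ p ^+ l) /\
  MeijerG (@alpha R k l r) (@beta R k r) (x ^+ l / c_ p ^+ l) =
    ((Num.sqrt (2 * pi) * (Num.sqrt l%:R * Num.sqrt m%:R / Num.sqrt k%:R) *
      expR (r * (ln m%:R - ln k%:R))) * x / l%:R * density p r x)%:C.
Proof.
move=> xc; have h := is_MeijerG_density xc; split; first by eexists; exact: h.
rewrite /MeijerG; case: xgetP => [v -> hv|/(_ _ h)//].
have [d hd] : exists d : R, forall j : 'I_k, - Re (beta r j) < d.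
  exists (- ((r + 1) / k%:R) + 1) => j; rewrite /beta cReC.
  apply: (@le_lt_trans _ _ (- ((r + 1) / k%:R))); last by rewrite ltrDl.
  by rewrite lerN2 ler_pM2r ?invr_gt0// lerD2l -(natr1 j) lerDr.
exact: line_integral_unique (hv d hd) (h d hd).
Qed.

(** With [p = k / l] and [p - 1 = m / l], everything is a product of powers of [k], [l] and [m], and
    the exponents cancel separately for each. *)
Lemma meijer_constant (x : R) : 0 < x ->
  p `^ (r + 1 / 2) * Num.sqrt l%:R / (x * (p - 1) `^ (r + 1 / 2) * Num.sqrt (2 * pi)) *
  ((Num.sqrt (2 * pi) * (Num.sqrt l%:R * Num.sqrt m%:R / Num.sqrt k%:R) *
      expR (r * (ln m%:R - ln k%:R))) * x / l%:R) = 1.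
Proof.
move=> x0; have s2 : 0 < Num.sqrt (2 * pi) :> R by rewrite sqrtr_gt0 mulr_gt0// pi_gt0.
rewrite /powR !gt_eqF ?subr_gt0// p1E pkl !ln_div ?posrE// -[X in _ * x / X](lnK lR) !sqrt_natE//.
move: (Num.sqrt _) s2 => S S0.
set K := ln k%:R; set L := ln l%:R; set M := ln m%:R.
have -> : (r + 1 / 2) * (K - L) = r * K + K / 2 - r * L - L / 2 by field.
have -> : (r + 1 / 2) * (M - L) = r * M + M / 2 - r * L - L / 2 by field.
have -> : r * (M - K) = r * M - r * K by ring.
have e2 : expR L = expR (L / 2) * expR (L / 2) by rewrite -expRD -splitr.
rewrite !expRB !expRD e2.
have e y : expR y != 0 :> R by rewrite gt_eqF ?expR_gt0.
move: (e (r * K)) (e (K / 2)) (e (r * L)) (e (L / 2)) (e (r * M)) (e (M / 2)).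
move: (expR _) (expR _) (expR _) (expR _) (expR _) (expR _) => *.
by field; repeat (apply/andP; split) => //; rewrite gt_eqF.
Qed.

End meijer.

Theorem theorem4p2 (R : realType) (k l : nat) (p r : R)
    (l_ge1 : (1 <= l)%N) (l_lt_k : (l < k)%N) (p_eq : p = k%:R / l%:R) :
  (forall x : R, 0 < x < c_ p ->
     [/\ V_exists p r x,
         MeijerG_exists (@alpha R k l r) (@beta R k r) (x ^+ l / c_ p ^+ l) &
         V p r x =
           (p `^ (r + 1 / 2) * Num.sqrt l%:R /
            (x * (p - 1) `^ (r + 1 / 2) * Num.sqrt (2 * pi)))%:C *
           MeijerG (@alpha R k l r) (@beta R k r) (x ^+ l / c_ p ^+ l)]) /\
  (forall s : R[i], 1 - (1 + r) / p < complex.Re s ->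
     cintegrable `]0, c_ p[ (fun x => cpow x (s - 1) * V p r x) /\
     psi p r s = cintegral `]0, c_ p[ (fun x => cpow x (s - 1) * V p r x)).
Proof.
split=> [x xc|s hs]; last exact: (mellin_V l_ge1 l_lt_k p_eq hs).
have [G_ex G_eq] := MeijerG_density r l_ge1 l_lt_k p_eq xc.
split=> //; first by eexists; exact: (is_V_density l_ge1 l_lt_k p_eq xc).
have /andP[x0 _] := xc.
rewrite G_eq -rmorphM (mulrA _ _ (density p r x)) (meijer_constant r l_ge1 l_lt_k p_eq x0) mul1r.
by rewrite (V_density r l_ge1 l_lt_k p_eq xc).
Qed.
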